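(* Let $n\ge 2$ and let $\alpha\in\mathbb{R}^n$ be a vector of diophantine type $\kappa<\frac{n-1}{n-2}$ such that the components of the vector $(\alpha,1)\in\mathbb{R}^{n+1}$ are linearly independent over $\mathbb{Q}$. If $a=(a_1,\dots,a_n)\in\mathbb{N}^n$ and $D_a=\mathrm{diag}(a_1,\dots,a_n)$, then $$\lim_{N\to\infty}\frac{1}{N^{n/2}}\,R[D_a,\alpha](N)=|E^{D_a}|.$$
   Context: $\mathbb{N}$ is the set of positive integers. A vector $\alpha\in\mathbb{R}^n$ is of diophantine type $\kappa$ if there is $C>0$ with $|\alpha-\frac{m}{q}|>\frac{C}{q^\kappa}$ for all $m\in\mathbb{Z}^n$, $q\in\mathbb{N}$. For $n=2$, $\frac{n-1}{n-2}$ is read as $+\infty$. For a positive definite symmetric integer $n\times n$ matrix $M$, put $Q_M(x)=\langle Mx,x\rangle$, $E^M=\{x\in\mathbb{R}^n:Q_M(x)\le1\}$ with volume $|E^M|$, and for $p,N\in\mathbb{N}$ $$r[M,\alpha](p)=\sum_{m\in\mathbb{Z}^n,\ Q_M(m)=p}e^{-2\pi i\,m\cdot\alpha},\qquad R[M,\alpha](N)=\sum_{p=1}^N|r[M,\alpha](p)|^2.$$ *)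

(* Defs.v *)
From HB Require Import structures.
From mathcomp Require Import all_boot all_order all_algebra.
From mathcomp Require Import complex.
From mathcomp Require Import all_classical all_reals all_analysis.

Set Implicit Arguments.
Unset Strict Implicit.
Unset Printing Implicit Defensive.

Import Order.TTheory GRing.Theory Num.Theory.
Import numFieldNormedType.Exports.

Local Open Scope classical_set_scope.
Local Open Scope ring_scope.

Section lebesgue_Rn.
Context {R : realType}.
Local Notation mR := (measurableTypeR R).

Definition tuple_cons n (p : mR * n.-tuple mR) : n.+1.-tuple mR :=
  [tuple of p.1 :: p.2].

Lemma measurable_tuple_cons n : measurable_fun setT (@tuple_cons n).
Proof. exact: (measurable_cons measurable_fst measurable_snd). Qed.

Section cons_measure.
Variables (n : nat) (mu : {sigma_finite_measure set (n.-tuple mR) -> \bar R}).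

Definition cons_measure : set (n.+1.-tuple mR) -> \bar R :=
  pushforward (lebesgue_measure \x mu)%E (@tuple_cons n).

HB.instance Definition _ := Measure.copy cons_measure
  (measure_function_pushforward__canonical__measure_function_Measure
     (lebesgue_measure \x mu)%E (@measurable_tuple_cons n)).

Lemma cons_measure_sigma_finite : sigma_finite setT cons_measure.
Proof.
pose uncons (t : n.+1.-tuple mR) : mR * n.-tuple mR :=
  (thead t, [tuple of behead t]).
have munc : measurable_fun setT uncons.
  by apply/measurable_fun_pair; [exact: measurable_tnth|exact: measurable_behead].
have unK : cancel (@tuple_cons n) uncons.
  by move=> [x t]; congr (_, _); exact: val_inj.
have /sigma_finiteP[F [TF ndF Foo]] :=
  sigma_finiteT (lebesgue_measure : {sigma_finite_measure set mR -> \bar R}).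
have /sigma_finiteP[G [TG ndG Goo]] := sigma_finiteT mu.
exists (fun k => uncons @^-1` (F k `*` G k)).
  rewrite -preimage_bigcup -(_ : setT = \bigcup_k (F k `*` G k)) ?preimage_setT//.
  rewrite -setXTT TF TG predeqE => -[x y]; split.
    move=> [/= [k _ Fkx] [l _ Gly]]; exists (maxn k l) => //; split.
    - by move: x Fkx; exact/subsetPset/ndF/leq_maxl.
    - by move: y Gly; exact/subsetPset/ndG/leq_maxr.
  by move=> [k _ [/= ? ?]]; split; exists k.
move=> k; have [mF Fk] := Foo k; have [mG Gk] := Goo k.
split; first by rewrite -[X in measurable X]setTI; apply: munc => //; exact: measurableX.
rewrite /cons_measure /pushforward (_ : _ @^-1` _ = F k `*` G k).
  by rewrite product_measure1E// lte_mul_pinfty// ge0_fin_numE.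
by rewrite -comp_preimage (_ : uncons \o _ = id)//; apply/funext.
Qed.

HB.instance Definition _ := Measure_isSigmaFinite.Build _ _ _ cons_measure
  cons_measure_sigma_finite.
End cons_measure.

(* The n-fold product of the Lebesgue measure of the line; in dimension 0 it is
   the unit mass on the one-point space. *)
Fixpoint lebesgue_tuple n : {sigma_finite_measure set (n.-tuple mR) -> \bar R} :=
  match n with
  | 0 => dirac ([tuple] : 0.-tuple mR)
  | n'.+1 => cons_measure (lebesgue_tuple n')
  end.

Definition volume n (A : set 'cV[R]_n) : \bar R :=
  lebesgue_tuple n [set t | A (\col_i tnth t i)].

End lebesgue_Rn.

Definition dotprod (T : pzRingType) n (u v : 'cV[T]_n) : T :=
  \sum_i u i 0 * v i 0.

Definition qform (T : pzRingType) n (M : 'M[T]_n) (x : 'cV[T]_n) : T :=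
  dotprod (M *m x) x.

Section statement_notions.
Context {R : realType}.

Definition enorm n (x : 'cV[R]_n) : R := Num.sqrt (dotprod x x).

Definition ratvec n (m : 'cV[int]_n) (q : nat) : 'cV[R]_n :=
  \col_i ((m i 0)%:~R / q%:R).

Definition diophantine_type n (kappa : R) (alpha : 'cV[R]_n) : Prop :=
  exists2 C : R, 0 < C &
    forall (m : 'cV[int]_n) (q : nat), (0 < q)%N ->
      C / q%:R `^ kappa < enorm (alpha - ratvec m q).

(* (n - 1) / (n - 2), read as +oo when n = 2 *)
Definition kappa_bound (n : nat) : \bar R :=
  if n == 2%N then +oo%E else ((n%:R - 1) / (n%:R - 2))%:E.

Definition Q_independent n (v : 'cV[R]_n) : Prop :=
  forall c : 'cV[rat]_n, \sum_i ratr (c i 0) * v i 0 = 0 -> c = 0.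

Definition ellipsoid n (M : 'M[int]_n) : set 'cV[R]_n :=
  [set x | qform (map_mx intr M) x <= 1].

(* e^(i t) *)
Definition expi (t : R) : R[i] := (cos t +i* sin t)%C.

(* \sum_(_ \in _) is the sum of a finitely supported family, with value 0
   otherwise; the index set is finite when M is positive definite. *)
Definition rcoef n (M : 'M[int]_n) (alpha : 'cV[R]_n) (p : nat) : R[i] :=
  \sum_(m \in [set m : 'cV[int]_n | qform M m = p%:Z])
    expi (- (2 * pi * dotprod (map_mx intr m) alpha)).

Definition Rsum n (M : 'M[int]_n) (alpha : 'cV[R]_n) (N : nat) : R :=
  \sum_(1 <= p < N.+1) Normc.normc (rcoef M alpha p) ^+ 2.

End statement_notions.

Definition diagZ n (a : 'I_n -> nat) : 'M[int]_n := diag_mx (\row_i (a i)%:Z).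

(* Main.v *)
(* Damp the sums by e^(-k p/N).  Since |r(p)|^2 is a correlation, orthogonality of
   additive characters gives
     sum_p |r(p)|^2 e^(-k p/N) = average over a grid of u of prod_j |Theta_j(u)|^2,
   where Theta_j is the one-dimensional theta sum of a_j m^2 u - m alpha_j.  The
   substitution x = m' - m, y = - (m + m') turns |Theta_j(u)|^2 into a bilinear sum
   Z_j(u) of e(x beta_j + x y u) with Gaussian weights of width L ~ sqrt N; here beta_j is
   one of finitely many rational affine images of alpha_j.

   The grid is cut into Farey arcs (h/q, h'/q') of order L.  If q or q' is small compared
   with L, Poisson summation, in the form of a bound for theta sums coming from the Jacobi
   triple product, shows that prod_j |Z_j| is at most L^n (||q beta|| + q/L + ...)^-n; the
   hypothesis kappa < (n-1)/(n-2) makes the total contribution of these arcs small.  If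
   both are large, write (x, y) in the unimodular basis given by the arc, which leaves
   boundedly many terms e((l q + l' q') . beta); the term l = l' = 0 is the main term, and
   the others cancel when summed over q or q', by the rational independence of
   (alpha, 1).

   So the damped sums of |r(p)|^2 and of #{m : Q(m) = p} agree up to o(N^(n/2)).  Stone's
   polynomials remove the damping, and cubes of side about N^(-1/2) compare the lattice
   points of a dilated ellipsoid with its volume. *)
Require Import Defs.
From HB Require Import structures.
From mathcomp Require Import all_boot all_order all_algebra.
From mathcomp Require Import complex.
From mathcomp Require Import all_classical all_reals all_analysis.
From mathcomp Require Import measurable_realfun.
From mathcomp Require Import zify ring lra.

Set Implicit Arguments.
Unset Strict Implicit.
Unset Printing Implicit Defensive.

Import Order.TTheory GRing.Theory Num.Theory.
Import numFieldNormedType.Exports.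
Import Normc.

(** * Farey dissection of a grid *)

Section farey.

(** The independence of [(alpha, 1)] is qualitative and gives no rate of cancellation, which
    dictates the order of choices: the cutoff [e0] between small and large denominators, the size
    [T] of the box of phases and the bound [D] on divisors are all fixed before [L] grows.
    Coprimality of [q] and [q'] is not periodic, so summation by parts does not apply to it; a
    periodic condition on common divisors up to [D + 1] replaces it.

    The exponent comes from one sum. Along an arc starting at [h/q] the bound with exponent [-n],
    summed over grid points, loses one power and brings a factor [1/q], which the at most [q] arcs
    with this denominator cancel. What remains is the sum over [q <= L / e0] of
    [(||q beta|| + q / L)^-(n - 1)]. It is at most a constant times [L e0^-nu] for some [nu > 0] if
    [(n - 2)(kappa - 1) < 1], which is the hypothesis on [kappa].

    The grid has [P] points, where [P] is a multiple of every [q <= L], so that arcs end at grid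
    points, and exceeds all values of the form on a box of lattice points, so that orthogonality is
    exact. *)

Definition fpair (q q' : nat) := [&& 0 < q, 0 < q' & coprime q q'].

Lemma coprime_addl a b : coprime a (a + b) = coprime a b.
Proof. by rewrite /coprime gcdnDl. Qed.

Lemma coprime_addr a b : coprime (a + b) b = coprime a b.
Proof. by rewrite coprime_sym addnC coprime_addl coprime_sym. Qed.

(** Raising the level from [N] to [N.+1] splits exactly the pairs with [q + q' = N.+1] at their
    mediant, so a [g] that is additive under mediants has the same sum at every level; at level 1
    only the pair [(1, 1)] remains. *)
Lemma farey_mediant (V : nmodType) (g : nat -> nat -> V) Q : 0 < Q ->
  (forall q q', fpair q q' -> q + q' <= Q ->
     g q q' = (g q (q + q')%N + g (q + q')%N q')%R) ->
  (\sum_(q < Q.+1) \sum_(q' < Q.+1 | fpair q q' && (Q < q + q')%N) g q q' = g 1%N 1%N)%R.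
Proof.
case: Q => // Q _; elim: Q => [|Q IH] hg.
  rewrite !big_ord_recl !big_ord0 /= !big_mkcond !big_ord_recl !big_ord0 /=.
  by rewrite big_mkcond !big_ord_recl big_ord0 /= /bump /fpair /= !addr0 !add0r.
rewrite -IH; last by move=> q q' h1 h2; apply: hg => //; exact: leqW.
set N := Q.+1.
pose F M q q' := (if fpair q q' && (M < q + q')%N then g q q' else 0)%R.
pose G q q' := (if fpair q q' && (q + q' == N.+1)%N then g q q' else 0)%R.
have FG q q' : (F N q q' = F N.+1 q q' + G q q')%R.
  rewrite /F /G; case: fpair => //=; last by rewrite addr0.
  rewrite (ltnNge N) -ltnS.
  by case: (ltngtP (q + q')%N N.+1) => _ /=; rewrite ?addr0 ?add0r.
rewrite [RHS](eq_bigr (fun q : 'I_N.+1 => \sum_(q' < N.+1) F N.+1 q q' + \sum_(q' < N.+1) G q q')%R); last first.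
  by move=> q _; rewrite big_mkcond -big_split; apply: eq_bigr => q' _; exact: FG.
rewrite big_split /=.
have sumG q : q < N.+1 ->
  (\sum_(q' < N.+1) G q q' = if fpair q N.+1 then g q (N.+1 - q)%N else 0)%R.
  move=> qN; have [q0|q0] := posnP q.
    by rewrite q0 big1// => i _; rewrite /G /fpair.
  have hq : N.+1 - q < N.+1 by lia.
  rewrite (bigD1 (Ordinal hq))//= big1 ?addr0 => [|i].
    rewrite /G subnKC ?eqxx ?andbT//; last exact: ltnW.
    rewrite /fpair q0 subn_gt0 qN /=; congr (if _ then _ else _).
    by rewrite -(coprime_addl q) subnKC// ltnW.
  rewrite -val_eqE /= /G => hi; case: eqP => [h|]; rewrite ?andbF//.
  by exfalso; move/eqP: hi; lia.
rewrite [X in (_ = _ + X)%R](eq_bigr (fun q : 'I_N.+1 =>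
   if fpair q N.+1 then g q N.+1 + g N.+1 (N.+1 - q)%N else 0)%R); last first.
  move=> q _; rewrite sumG ?ltn_ord//; case: ifP => // /and3P[q0 _ cq].
  have qN := ltn_ord q; have e : q + (N.+1 - q) = N.+1 by lia.
  rewrite hg ?e//; rewrite /fpair q0 subn_gt0 qN /=.
  by rewrite -(coprime_addl q) e.
rewrite [LHS](eq_bigr (fun q : 'I_N.+2 => \sum_(q' < N.+2) F N.+1 q q')%R); last first.
  by move=> q _; rewrite big_mkcond.
rewrite big_ord_recr /= (eq_bigr (fun q : 'I_N.+1 => \sum_(q' < N.+1) F N.+1 q q' + F N.+1 q N.+1)%R); last first.
  by move=> q _; rewrite big_ord_recr.
rewrite big_split /= -addrA; congr (_ + _)%R.
rewrite [X in (_ + X)%R]big_ord_recr /=.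
have -> : F N.+1 N.+1 N.+1 = 0%R.
  by rewrite /F /fpair /coprime gcdnn.
rewrite addr0.
rewrite [RHS](eq_bigr (fun q : 'I_N.+1 => F N.+1 q N.+1 +
   (if fpair q N.+1 then g N.+1 (N.+1 - q)%N else 0))%R); last first.
  move=> q _; rewrite /F; case fq : (fpair q N.+1); rewrite /= ?addr0//.
  by case/and3P: fq => q0 _ _; rewrite -[X in X < _]add0n ltn_add2r q0.
rewrite big_split /=; congr (_ + _)%R.
rewrite big_ord_recl [RHS]big_ord_recl /= /F /fpair andbF /= !add0r.
rewrite (reindex_inj rev_ord_inj) /=; apply: eq_bigr => i _.
rewrite /bump /= add1n subSS; have iN := ltn_ord i.
have e1 : (Q - i).+1 = N - i by rewrite -subSn.
rewrite add1n subSS e1 -[X in X < _]addn0 ltn_add2l subn_gt0 iN andbT.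
have e : (i.+1 + (N - i) = N.+1)%N by rewrite addSn subnKC// ltnW.
suff -> : coprime N.+1 (N - i) = coprime i.+1 N.+1 by [].
by rewrite -{1}e coprime_addr -coprime_addl e.
Qed.

(* [fnum q q' / q] is the fraction of denominator [q] whose right Farey neighbour has
   denominator [q']. *)
Definition fnum (q q' : nat) := find (fun h => q %| h * q' + 1) (iota 0 q).

Lemma fnumP q q' : fpair q q' -> fnum q q' < q /\ q %| fnum q q' * q' + 1.
Proof.
case/and3P=> q0 q'0 cq.
have hs : has (fun h => q %| h * q' + 1) (iota 0 q).
  have /coprimeP-/(_ q0)[u hu] := cq.
  apply/hasP; exists (u.2 %% q); first by rewrite mem_iota ltn_mod.
  rewrite /dvdn -modnDml modnMml modnDml -/(dvdn _ _).
  have -> : u.2 * q' + 1 = u.1 * q by lia.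
  exact: dvdn_mull.
have := nth_find 0 hs; rewrite -/(fnum q q').
have := hs; rewrite has_find size_iota => lt; by rewrite nth_iota.
Qed.

Lemma fnum_uniq q q' h : fpair q q' -> h < q -> q %| h * q' + 1 -> fnum q q' = h.
Proof.
move=> fq hq dh; have [gq dg] := fnumP fq; case/and3P: fq => q0 q'0 cq.
have aux a b : a <= b -> b < q -> q %| a * q' + 1 -> q %| b * q' + 1 -> a = b.
  move=> ab bq da db.
  have : q %| (b - a) * q'.
    have -> : (b - a) * q' = (b * q' + 1) - (a * q' + 1) by rewrite mulnBl; lia.
    exact: dvdn_sub.
  rewrite Gauss_dvdl// => dab; apply/eqP; rewrite eqn_leq ab /= -subn_eq0.
  have : b - a < q by exact: leq_ltn_trans (leq_subr a b) bq.
  by case: (b - a) dab => // k /dvdn_leq -/(_ isT); rewrite leqNgt => /negPf ->.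
by have [/aux ->//|/ltnW/aux ->] := leqP (fnum q q') h.
Qed.

(* The inner sum runs over the grid points [b / P] of the Farey arc with end denominators
   [q] and [q']; splitting an arc at its mediant is the recursion behind it. *)
Lemma farey_grid (V : nmodType) (F : nat -> V) (P Q : nat) : 0 < P -> 0 < Q ->
  (forall q, 0 < q <= Q -> q %| P) ->
  (\sum_(b < P) F b =
   \sum_(q < Q.+1) \sum_(q' < Q.+1 | fpair q q' && (Q < q + q')%N)
     \sum_(i < P %/ (q * q')) F (P %/ q * fnum q q' + i)%N)%R.
Proof.
move=> P0 Q0 hP.
rewrite (@farey_mediant V (fun q q' =>
  \sum_(i < P %/ (q * q')) F (P %/ q * fnum q q' + i)%N)%R Q Q0).
  rewrite mul1n divn1; apply: eq_bigr => i _; congr F.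
  by have [/=] := @fnumP 1 1 isT; case: fnum => // _ _; rewrite muln0.
move=> q q' fq qq'; have [hq dh] := fnumP fq; have /and3P[q0 q'0 cq] := fq.
have s0 : 0 < q + q' by lia.
have f1 : fpair q (q + q') by rewrite /fpair q0 s0 coprime_addl.
have f2 : fpair (q + q') q' by rewrite /fpair q'0 s0 coprime_addr.
have [h' eh'] := dvdnP dh; set h := fnum q q' in hq dh eh' *.
have h'q' : h' <= q'.
  rewrite -(leq_pmul2r q0) -eh'.
  have : h * q' <= q.-1 * q' by rewrite leq_mul2r -ltnS prednK// hq orbT.
  have : q.-1 * q' + q' = q' * q by rewrite -{2}(prednK q0); lia.
  lia.
have e1 : fnum q (q + q') = h.
  by apply: fnum_uniq => //; rewrite mulnDr -addnA dvdn_add ?dvdn_mull.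
have e2 : fnum (q + q') q' = h + h'.
  apply: fnum_uniq => //; first by rewrite -addSn leq_add.
  have -> : (h + h') * q' + 1 = h' * (q + q') by rewrite mulnDl mulnDr -eh'; lia.
  exact: dvdn_mull.
(* [q], [q'] and [q + q'] are pairwise coprime divisors of [P], so the arc and its two parts all
   consist of whole grid steps. *)
have dP : q * q' * (q + q') %| P.
  rewrite Gauss_dvd; last by rewrite coprimeMl coprime_addl cq coprime_sym coprime_addr.
  rewrite Gauss_dvd// !hP ?q0 ?q'0 ?s0//; lia.
have [m em] := dvdnP dP.
have m0 : 0 < m by move: P0; rewrite em muln_gt0 => /andP[].
rewrite e1 e2.
have -> : P %/ (q * q') = m * q' + m * q.
  by rewrite em [q * q' * _]mulnC mulnA mulnK ?muln_gt0 ?q0//; lia.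
have -> : P %/ (q * (q + q')) = m * q'.
  by rewrite em [q * q' * _]mulnAC [q * _ * q']mulnC mulnA mulnK ?muln_gt0 ?q0.
have -> : P %/ ((q + q') * q') = m * q.
  by rewrite em -mulnA [q' * _]mulnC mulnA mulnK ?muln_gt0 ?s0.
have -> : P %/ (q + q') = m * (q * q') by rewrite em mulnA mulnK.
have -> : P %/ q = m * (q' * (q + q')).
  by rewrite em -[q * q' * _]mulnA [q * _]mulnC mulnA mulnK.
rewrite big_split_ord /=; congr (_ + _)%R.
apply: eq_bigr => i _; congr F; rewrite addnA; congr (_ + _).
have -> : m * (q * q') * (h + h') = m * q' * (q * h + h' * q) by lia.
by rewrite -eh'; lia.
Qed.

End farey.

Local Open Scope classical_set_scope.
Local Open Scope ring_scope.

(** * Complex modulus and additive characters *)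

Section toolbox.
Context {R : realType}.
Implicit Types (t u x y : R) (z w : R[i]).

Definition nc z : R := normc z.

Lemma nc_ge0 z : 0 <= nc z.
Proof. by rewrite /nc; case: z => a b /=; exact: sqrtr_ge0. Qed.

Lemma nc0 : nc 0 = 0. Proof. exact: normc0. Qed.

Lemma nc1 : nc 1 = 1. Proof. exact: normc1. Qed.

Lemma ncM z w : nc (z * w) = nc z * nc w. Proof. exact: normcM. Qed.

Lemma ncD z w : nc (z + w) <= nc z + nc w. Proof. exact: (@le_normcD R z w). Qed.

Lemma ncN z : nc (- z) = nc z. Proof. exact: (@normcN R z). Qed.

Lemma ncB z w : nc (z - w) <= nc z + nc w.
Proof. by rewrite -(ncN w); exact: ncD. Qed.

Lemma nc_real x : nc x%:C%C = `|x|.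
Proof. by rewrite /nc /= expr0n addr0 sqrtr_sqr. Qed.

Lemma nc_eq0 z : (nc z == 0) = (z == 0).
Proof.
apply/eqP/eqP => [|->]; [exact: eq0_normc|exact: nc0].
Qed.

Lemma nc_sum (I : Type) (s : seq I) (P : pred I) (F : I -> R[i]) :
  nc (\sum_(i <- s | P i) F i) <= \sum_(i <- s | P i) nc (F i).
Proof.
elim/big_rec2: _ => [|i x z _ h]; first by rewrite nc0.
by apply: (le_trans (ncD _ _)); rewrite lerD2l.
Qed.

Lemma nc_prod (I : Type) (s : seq I) (P : pred I) (F : I -> R[i]) :
  nc (\prod_(i <- s | P i) F i) = \prod_(i <- s | P i) nc (F i).
Proof. by elim/big_rec2: _ => [|i x z _ <-]; rewrite ?nc1 ?ncM. Qed.

Lemma ncX z k : nc (z ^+ k) = nc z ^+ k.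
Proof. by elim: k => [|k IH]; rewrite ?expr0 ?nc1// !exprS ncM IH. Qed.

Lemma nc_sqr z : (nc z ^+ 2)%:C%C = z * z^*%C.
Proof.
case: z => a b; rewrite /nc /= sqr_sqrtr ?addr_ge0 ?sqr_ge0//.
by apply/eqP; rewrite eq_complex /=; apply/andP; split; apply/eqP; ring.
Qed.

Definition ce t : R[i] := expi (2 * pi * t).

Lemma ceD s t : ce (s + t) = ce s * ce t.
Proof.
rewrite /ce /expi mulrDr cosD sinD; apply/eqP; rewrite eq_complex /=.
by apply/andP; split; apply/eqP; ring.
Qed.

Lemma ce0 : ce 0 = 1.
Proof. by rewrite /ce /expi mulr0 cos0 sin0. Qed.

Lemma ceNconj t : ce (- t) = (ce t)^*%C.
Proof. by rewrite /ce /expi mulrN cosN sinN. Qed.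

Lemma nc_ce t : nc (ce t) = 1.
Proof. by rewrite /nc /= cos2Dsin2 sqrtr1. Qed.

Lemma ceMn t k : ce (k%:R * t) = ce t ^+ k.
Proof.
elim: k => [|k IH]; first by rewrite mul0r ce0 expr0.
by rewrite -natr1 mulrDl mul1r ceD IH exprSr.
Qed.

Lemma ce1 : ce 1 = 1.
Proof. by rewrite /ce /expi mulr1 mulr_natl cos2pi sin2pi. Qed.

Lemma ce_nat (k : nat) : ce k%:R = 1.
Proof. by rewrite -[k%:R]mulr1 ceMn ce1 expr1n. Qed.

Lemma ce_int (k : int) : ce k%:~R = 1.
Proof.
case: k => k; first by rewrite ce_nat.
have := ceD (k.+1)%:R (- (k.+1)%:R).
by rewrite subrr ce0 ce_nat mul1r NegzE => ->; rewrite mulrNz.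
Qed.

Lemma ceDint t (k : int) : ce (t + k%:~R) = ce t.
Proof. by rewrite ceD ce_int mulr1. Qed.

Lemma ce_sum (I : Type) (s : seq I) (P : pred I) (F : I -> R) :
  ce (\sum_(i <- s | P i) F i) = \prod_(i <- s | P i) ce (F i).
Proof. by elim/big_rec2: _ => [|i x z _ <-]; rewrite ?ce0 ?ceD. Qed.

Lemma cos_double_sin x : 1 - cos (2 * x) = 2 * sin x ^+ 2.
Proof. by rewrite mulrDl mul1r cosD -!expr2 cos2sin2; ring. Qed.

Lemma nc_1Bce t : nc (1 - ce t) ^+ 2 = 2 * (1 - cos (2 * pi * t)).
Proof.
rewrite /nc /ce /expi /= sqr_sqrtr ?addr_ge0 ?sqr_ge0//.
by have := cos2Dsin2 (2 * pi * t); rewrite add0r sqrrN; nra.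
Qed.

Lemma abs_sin_le x : `|sin x| <= `|x|.
Proof.
wlog x0 : x / 0 <= x => [H|].
  have [/H//|/ltW x0] := leP 0 x.
  by rewrite -normrN -sinN -(normrN x); apply: H; rewrite oppr_ge0.
have [c _] := @MVT_segment R sin cos 0 x x0 (fun y _ => is_derive_sin y)
  (continuous_subspaceT (@continuous_sin R)).
rewrite sin0 !subr0 => ->; rewrite normrM ler_piMl//; exact: cos_max.
Qed.

Lemma ce_lip s t : nc (ce s - ce t) <= 2 * pi * `|s - t|.
Proof.
have -> : ce s - ce t = ce s * (1 - ce (t - s)).
  by rewrite mulrBr mulr1 -ceD [s + _]addrC subrK.
rewrite ncM nc_ce mul1r -(@ler_pXn2r _ 2) ?nnegrE ?nc_ge0//; last first.
  by rewrite !mulr_ge0// pi_ge0.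
rewrite nc_1Bce -mulrA cos_double_sin distrC.
have := abs_sin_le (pi * (t - s)); rewrite normrM (ger0_norm (pi_ge0 R)).
rewrite -[sin _ ^+ 2]real_normK ?num_real//.
move: (normr_ge0 (sin (pi * (t - s)))) (mulr_ge0 (pi_ge0 R) (normr_ge0 (t - s))).
rewrite -mulrA; nra.
Qed.

(** By [1 - cos (2 x) = 2 sin x ^ 2] it suffices to bound [sin y] below by a multiple of [y] on
    [[0, pi / 2]]: on [[0, 1]] its derivative is at least [cos 1], and beyond 1 the sine is at least
    [sin 1] while [y <= 2]. *)
Lemma cos_quadratic : exists2 c : R, 0 < c &
  forall t, `|t| <= 2^-1 -> c * t ^+ 2 <= 1 - cos (2 * pi * t).
Proof.
have s1 : 0 < sin 1 :> R by apply: sin2_gt0; rewrite ltr01 ltr1n.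
have c1 := @cos1_gt0 R.
pose c := Num.min (cos 1) (sin 1 / 2) : R.
have c0 : 0 < c by rewrite lt_min c1 divr_gt0.
have key y : 0 <= y <= pi / 2 -> c * y <= sin y.
  move=> /andP[y0 yp]; have p2 := @pihalf_lt2 R; have p1 := @pihalf_ge1 R.
  have [y1|/ltW y1] := leP y 1.
    have [d] := @MVT_segment R sin cos 0 y y0 (fun y _ => is_derive_sin y)
      (continuous_subspaceT (@continuous_sin R)).
    rewrite in_itv /= sin0 !subr0 => /andP[d0 dy] ->.
    apply: ler_wpM2r => //; apply: (@le_trans _ _ (cos 1)).
      by rewrite ge_min lexx.
    have [->//|d1] := eqVneq d 1.
    apply: ltW; rewrite ltr_cos ?in_itv /=; first 1 last.
    - by apply/andP; split; lra.
    - by apply/andP; split; lra.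
    by rewrite lt_neqAle d1 (le_trans dy).
  have : sin 1 <= sin y.
    have [<-//|d1] := eqVneq 1 y.
    apply: ltW; rewrite ltr_sin ?in_itv /=; first 1 last.
    - by apply/andP; split; lra.
    - by apply/andP; split; lra.
    by rewrite lt_neqAle d1.
  have : c * y <= (sin 1 / 2) * 2.
    apply: ler_pM => //; [exact: ltW | by rewrite ge_min lexx orbT|].
    by lra.
  by lra.
exists (2 * c ^+ 2 * pi ^+ 2).
  by rewrite !mulr_gt0// ?exprn_gt0// pi_gt0.
move=> t ht; rewrite -[2 * pi * t]mulrA cos_double_sin.
wlog t0 : t ht / 0 <= t => [H|].
  have [/(H t ht)//|/ltW t0] := leP 0 t.
  by have := H (- t); rewrite normrN oppr_ge0 sqrrN mulrN sinN sqrrN; apply.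
rewrite ger0_norm// in ht.
have h : c * (pi * t) <= sin (pi * t).
  by apply: key; rewrite mulr_ge0 ?pi_ge0//= ler_pM2l ?pi_gt0.
have h0 : 0 <= c * (pi * t) by rewrite !mulr_ge0 ?pi_ge0 ?(ltW c0).
have : (c * (pi * t)) ^+ 2 <= sin (pi * t) ^+ 2.
  by apply: lerXn2r => //; rewrite nnegrE// (le_trans h0).
by rewrite !exprMn; lra.
Qed.

End toolbox.
Arguments nc : simpl never.
Arguments ce : simpl never.

(** * Gaussian sums *)

Section finite_sums.
Context {R : realType}.

Definition zr (M : nat) : seq int := [seq (i%:Z - M%:Z)%R | i <- iota 0 (M.*2).+1].

Lemma zr_uniq M : uniq (zr M).
Proof. by rewrite map_inj_uniq ?iota_uniq// => i j; lia. Qed.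

Lemma mem_zr M (x : int) : (x \in zr M) = (`|x| <= M)%N.
Proof.
apply/mapP/idP => [[k]|h]; first by rewrite mem_iota => ? ->; lia.
by exists `|(x + M%:Z)%R|%N; rewrite ?mem_iota; lia.
Qed.

Lemma sum_zr_ord (V : nmodType) M (F : int -> V) :
  \sum_(x <- zr M) F x = \sum_(i < (M.*2).+1) F (i%:Z - M%:Z).
Proof. by rewrite big_map -{1}[(M.*2).+1]subn0 -[iota _ _]/(index_iota 0 _) big_mkord. Qed.

Lemma sub_sum_le (T : eqType) (s t : seq T) (g : T -> R) :
  uniq s -> {subset s <= t} -> (forall x, 0 <= g x) ->
  \sum_(x <- s) g x <= \sum_(x <- t) g x.
Proof.
move=> us st g0; elim: s t us st => [|x s IH] t /=.
  by move=> _ _; rewrite big_nil; exact: sumr_ge0.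
move=> /andP[xs us] st.
have xt : x \in t by apply: st; rewrite inE eqxx.
rewrite (perm_big _ (perm_to_rem xt)) /= !big_cons lerD2l; apply: IH => // y ys.
have yx : y != x by apply: contraNneq xs => <-.
have : y \in t by apply: st; rewrite inE ys orbT.
by rewrite (perm_mem (perm_to_rem xt)) inE (negbTE yx).
Qed.

Lemma sum_inj_le (I T : eqType) (s : seq I) (t : seq T) (f : I -> T) (g : T -> R) :
  uniq s -> {in s &, injective f} -> (forall x, x \in s -> f x \in t) ->
  (forall x, 0 <= g x) ->
  \sum_(x <- s) g (f x) <= \sum_(y <- t) g y.
Proof.
move=> us fi ft g0; rewrite -(big_map f xpredT g); apply: sub_sum_le => //.
  by rewrite map_inj_in_uniq.
by move=> _ /mapP[x xs ->]; exact: ft.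
Qed.

Lemma geometric_le (x : R) N : 0 <= x < 1 -> \sum_(k <- iota 0 N) x ^+ k <= (1 - x)^-1.
Proof.
move=> /andP[x0 x1]; rewrite -[N in iota _ N]subn0 -[iota _ _]/(index_iota 0 _) big_mkord.
have h : 0 < 1 - x by rewrite subr_gt0.
rewrite -[leRHS]mul1r ler_pdivlMr//.
have := subrX1 x N; have : 0 <= x ^+ N by rewrite exprn_ge0.
by move: (\sum_(i < N) _) => S; lra.
Qed.

Definition gaussC : R := 2 * expR 1.

Lemma gaussC_gt0 : 0 < gaussC. Proof. by rewrite mulr_gt0 ?expR_gt0. Qed.

Lemma gauss_sum (s : seq int) (a tau : R) : uniq s -> 0 < a ->
  \sum_(l <- s) expR (- (a * (l%:~R + tau) ^+ 2)) <= gaussC * (1 + (Num.sqrt a)^-1).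
Proof.
move=> us a0; set v := Num.sqrt a.
have v0 : 0 < v by rewrite sqrtr_gt0.
have va : v ^+ 2 = a by rewrite sqr_sqrtr// ltW.
pose x := expR (- (2 * v)).
have x0 : 0 < x by exact: expR_gt0.
have x1 : x < 1 by rewrite expR_lt1; lra.
(* With [j = l + floor tau], the number [l + tau] lies in [[j, j + 1)], so [ix j] is a lower bound
   for [|l + tau|] on both sides of 0. *)
pose ix (j : int) := match j with Posz k => k | Negz k => k end.
pose g (j : int) := expR 1 * x ^+ ix j.
pose f := Num.floor tau.
have le1 l : expR (- (a * (l%:~R + tau) ^+ 2)) <= g (l + f).
  rewrite /g /x -expRM_natl -expRD ler_expR -va -exprMn.
  have /andP[f1 f2] : (f%:~R <= tau) && (tau < (f + 1)%:~R) by exact: floor_itv.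
  suff : (ix (l + f))%:R <= `|l%:~R + tau|.
    rewrite -[_ ^+ 2]real_normK ?num_real// normrM (gtr0_norm v0).
    by move: (normr_ge0 (l%:~R + tau)) (sqr_ge0 (v * `|l%:~R + tau| - 1)); nra.
  rewrite intrD in f2; have lf := intrD R l f.
  case E : (l + f) lf => [k|k] /= lf; rewrite ler_normr; apply/orP.
    by left; rewrite -[k%:R]/(k%:~R) lf; lra.
  by right; move: lf; rewrite NegzE mulrNz -pmulrn -natr1; lra.
apply: (le_trans (ler_sum _ (fun l _ => le1 l))).
pose B := (\max_(j <- [seq (l + f) | l <- s]) ix j).+1.
have gB : \sum_(l <- s) g (l + f) <=
    \sum_(j <- map Posz (iota 0 B) ++ map Negz (iota 0 B)) g j.
  apply: (sum_inj_le (g := g)) => //; first by move=> ? ? _ _ /addIr.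
    move=> l ls; have : (ix (l + f)%R < B)%N.
      rewrite /B ltnS; apply: (@leq_bigmax_seq _ _ xpredT ix) => //.
      by apply/mapP; exists l.
    by rewrite mem_cat; case: (l + f) => k kB; apply/orP; [left|right];
      apply/mapP; exists k; rewrite ?mem_iota.
  by move=> j; rewrite mulr_ge0 ?expR_ge0 ?exprn_ge0// ltW.
apply: (le_trans gB); rewrite big_cat !big_map /= -!mulr_sumr -mulrDr.
have gl := @geometric_le x B _; rewrite /gaussC -mulrA mulrCA ler_pM2l ?expR_gt0//.
have {}gl : \sum_(k <- iota 0 B) x ^+ k <= (1 - x)^-1.
  by apply: gl; rewrite (ltW x0).
suff : (1 - x)^-1 <= 1 + v^-1 by lra.
have ex : x * (1 + 2 * v) <= 1.
  rewrite -[leRHS](expRxMexpNx_1 (2 * v)) mulrC ler_pM2r//; exact: expR_ge1Dx.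
rewrite -[leLHS]mul1r ler_pdivrMr ?subr_gt0// -(@ler_pM2l _ v)//.
rewrite mulrA [v * (1 + _)]mulrDr mulfV ?gt_eqF//; nra.
Qed.

(** The shift of the first variable may depend on the second: this triangular shape is what
    completing the square in a binary quadratic form produces. *)
Lemma gauss_sum2 (s : seq (int * int)) (a b theta : R) (tau : int -> R) :
  uniq s -> 0 < a -> 0 < b ->
  \sum_(p <- s) expR (- (a * (p.1%:~R + tau p.2) ^+ 2) - b * (p.2%:~R + theta) ^+ 2)
  <= (gaussC * (1 + (Num.sqrt a)^-1)) * (gaussC * (1 + (Num.sqrt b)^-1)).
Proof.
move=> us a0 b0.
pose s1 := undup (map fst s); pose s2 := undup (map snd s).
pose g (p : int * int) :=
  expR (- (a * (p.1%:~R + tau p.2) ^+ 2) - b * (p.2%:~R + theta) ^+ 2).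
apply: (@le_trans _ _ (\sum_(p <- [seq (x, y) | y <- s2, x <- s1]) g p)).
  apply: (sub_sum_le (g := g)) => //; last by move=> p; apply: expR_ge0.
  move=> [x y] xys; apply/allpairsP; exists (y, x) => /=; split => //.
    by rewrite mem_undup; apply/mapP; exists (x, y).
  by rewrite mem_undup; apply/mapP; exists (x, y).
rewrite big_allpairs_dep /=.
apply: (@le_trans _ _ (\sum_(y <- s2) (gaussC * (1 + (Num.sqrt a)^-1)) *
   expR (- (b * (y%:~R + theta) ^+ 2)))).
  apply: ler_sum => y _; rewrite /g /=.
  under eq_bigr do rewrite expRD.
  rewrite -mulr_suml ler_pM2r ?expR_gt0//.
  by apply: gauss_sum => //; exact: undup_uniq.
rewrite -mulr_sumr ler_wpM2l ?mulr_ge0 ?addr_ge0 ?invr_ge0 ?sqrtr_ge0 ?(ltW gaussC_gt0)//.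
by apply: gauss_sum => //; exact: undup_uniq.
Qed.

End finite_sums.

(** * A finite Jacobi triple product *)

Section triple_product.
Context {R : realType}.
Implicit Types (r q s t x : R).

(* The coefficients of [(1 + z) (1 + q z) ... (1 + q ^ N.-1 z)]: the Gaussian binomials times
   [q ^ 'C(k, 2)]. *)
Fixpoint qbinc q (N k : nat) : R :=
  match N with
  | 0 => (k == 0%N)%:R
  | N'.+1 => qbinc q N' k + (if k is k'.+1 then q ^+ N' * qbinc q N' k' else 0)
  end.

Lemma qbinc_gt q N k : (N < k)%N -> qbinc q N k = 0.
Proof.
elim: N k => [|N IH] [|k] //= h; rewrite IH ?IH ?mulr0 ?addr0//; lia.
Qed.

Lemma qbinc_ge0 q N k : 0 <= q -> 0 <= qbinc q N k.
Proof.
move=> q0; elim: N k => [|N IH] [|k] //=; rewrite addr_ge0// mulr_ge0//.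
exact: exprn_ge0.
Qed.

Lemma qbinc_gt0 q N k : 0 < q -> (k <= N)%N -> 0 < qbinc q N k.
Proof.
move=> q0; elim: N k => [|N IH] [|k] //= h; first by rewrite addr0 IH.
by rewrite ltr_wpDl ?qbinc_ge0 ?(ltW q0)// mulr_gt0 ?exprn_gt0 ?IH.
Qed.

Lemma qbincS q N k :
  qbinc q N k.+1 * (1 - q ^+ k.+1) = qbinc q N k * (q ^+ k - q ^+ N).
Proof.
elim: N k => [|N IH] [|k] /=.
- by rewrite expr0 subrr mulr0 mul0r.
- by rewrite !mul0r.
- have := IH 0%N; rewrite !expr1 !expr0 => h; rewrite addr0 mulrDl h exprS; ring.
- rewrite mulrDl IH mulrDl; have := IH k.
  rewrite !exprS; move: (qbinc q N k.+1) (qbinc q N k) => a b.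
  move=> h; have {h} : q * q ^+ N * (a * (1 - q * q ^+ k)) =
    q * q ^+ N * (b * (q ^+ k - q ^+ N)) by rewrite h.
  by lra.
Qed.

Lemma prod_qbinc q N (z : R[i]) :
  \prod_(i < N) (1 + (q ^+ i)%:C%C * z) = \sum_(k < N.+1) (qbinc q N k)%:C%C * z ^+ k.
Proof.
elim: N => [|N IH]; first by rewrite big_ord0 big_ord1 expr0 mulr1.
rewrite big_ord_recr IH /= mulrDr mulr1.
rewrite [RHS]big_ord_recl /= addr0 expr0 mulr1.
under [X in _ = _ + X]eq_bigr do rewrite rmorphD mulrDl.
rewrite big_split /= addrA; congr (_ + _).
  rewrite big_ord_recl expr0 mulr1; congr (_ + _).
  by rewrite [RHS]big_ord_recr /= qbinc_gt// mul0r addr0.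
rewrite mulr_suml; apply: eq_bigr => i _; rewrite rmorphM exprS /=; ring.
Qed.

(* [qbinc q M.*2 (M + y) / qbinc q M.*2 M] without its power of [q]; it tends to 1 as [M]
   grows, which is how the triple product identity is used at finite level. *)
Fixpoint trd q (M y : nat) : R :=
  if y is y'.+1 then trd q M y' * ((1 - q ^+ (M - y')) / (1 - q ^+ (M + y').+1)) else 1.

Lemma expr_lt1' q k : 0 < q < 1 -> (0 < k)%N -> 0 < 1 - q ^+ k.
Proof. by move=> /andP[q0 q1] k0; rewrite subr_gt0 exprn_ilt1 ?(ltW q0)// -lt0n. Qed.

Lemma trd_bound q M y : 0 < q < 1 ->
  0 <= trd q M y <= 1 /\ ((y <= M)%N -> 1 - y%:R * q ^+ (M - y) <= trd q M y).
Proof.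
move=> /[dup] q01 /andP[q0 q1]; elim: y => [|y [/andP[h0 h1] h2]] /=.
  by rewrite ler01 lexx mul0r subr0 lexx.
have d0 := expr_lt1' q01 (ltn0Sn (M + y)).
have n0 : 0 <= 1 - q ^+ (M - y) by rewrite subr_ge0 exprn_ile1 ?ltW.
have k1 : (1 - q ^+ (M - y)) / (1 - q ^+ (M + y).+1) <= 1.
  rewrite ler_pdivrMr// mul1r lerD2l lerN2 ler_wiXn2l ?(ltW q0) ?(ltW q1)//; lia.
have k0 : 0 <= (1 - q ^+ (M - y)) / (1 - q ^+ (M + y).+1) by rewrite divr_ge0// ltW.
split; first by rewrite mulr_ge0// mulr_ile1.
move=> yM; have {}h2 := h2 (ltnW yM).
have k2 : 1 - q ^+ (M - y) <= (1 - q ^+ (M - y)) / (1 - q ^+ (M + y).+1).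
  rewrite ler_pdivlMr// ler_piMr// gerBl exprn_ge0// ltW//.
have e1 : q ^+ (M - y) <= q ^+ (M - y.+1).
  by rewrite ler_wiXn2l ?(ltW q0) ?(ltW q1)// leq_sub2l.
have e0 : 0 <= q ^+ (M - y) by rewrite exprn_ge0// ltW.
have : trd q M y * (1 - q ^+ (M - y)) <= 
  trd q M y * ((1 - q ^+ (M - y)) / (1 - q ^+ (M + y).+1)) by rewrite ler_wpM2l.
apply: le_trans; rewrite -natr1.
have : y%:R * q ^+ (M - y) <= y%:R * q ^+ (M - y.+1) :> R by rewrite ler_wpM2l.
have : trd q M y * q ^+ (M - y) <= q ^+ (M - y) by rewrite ler_piMl.
by lra.
Qed.

(** For [q = r ^ 2] the choice [a = r / q ^ M] makes the [2 M] factors [1 + q ^ i a z] carry the odd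
    exponents of [r] from [1 - 2 M] to [2 M - 1]. The coefficients are then symmetric about the
    central one, and [y] steps of [qbincS] in either direction produce [r ^ (y ^ 2)], the Gaussian
    weight. *)
Lemma trd_qbinc r M y : 0 < r < 1 -> (y <= M)%N ->
  let a := r / (r ^+ 2) ^+ M in
  let w k := qbinc (r ^+ 2) M.*2 k * a ^+ k in
  w (M + y)%N = w M * trd (r ^+ 2) M y * r ^+ (y * y) /\
  w (M - y)%N = w M * trd (r ^+ 2) M y * r ^+ (y * y).
Proof.
move=> /andP[r0 r1] + a w; set q := r ^+ 2.
have q01 : 0 < q < 1 by rewrite exprn_gt0// exprn_ilt1 ?ltW.
have q0 : 0 < q by case/andP: q01.
have qn0 m : q ^+ m != 0 by rewrite expf_neq0 ?gt_eqF.
have wS k : w k.+1 * (1 - q ^+ k.+1) = w k * (q ^+ k - q ^+ M.*2) * a.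
  rewrite /w [a ^+ _]exprS; transitivity (qbinc q M.*2 k.+1 * (1 - q ^+ k.+1) * (a * a ^+ k)).
    by ring.
  by rewrite qbincS; ring.
elim: y => [|y IH] yM; first by rewrite addn0 subn0 muln0 expr0 /= !mulr1.
have [{}IH1 IH2] := IH (ltnW yM).
have d1 := expr_lt1' q01 (ltn0Sn (M + y)).
have My : (0 < M - y)%N by rewrite subn_gt0.
have d2 := expr_lt1' q01 My.
have rn0 : r != 0 by rewrite gt_eqF.
have er : r ^+ (y.+1 * y.+1) = r ^+ (y * y) * q ^+ y * r.
  by rewrite -exprM -exprD -exprSr; congr (_ ^+ _); lia.
have qM : q ^+ M = q ^+ (M - y) * q ^+ y by rewrite -exprD subnK// ltnW.
split.
  rewrite addnS; apply: (mulIf (lt0r_neq0 d1)); rewrite wS IH1 er /=.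
  rewrite -[_ * a]mulrA.
  have -> : (q ^+ (M + y) - q ^+ M.*2) * a = r * q ^+ y * (1 - q ^+ (M - y)) :> R.
    by rewrite -addnn !exprD /a -/q qM; field; rewrite !qn0.
  move: d1; move/lt0r_neq0.
  move: (1 - q ^+ (M + y).+1) (trd q M y) (w M) (r ^+ (y * y)) (q ^+ y) (1 - q ^+ (M - y)).
  by move=> *; field.
have := wS (M - y.+1)%N; rewrite -subSn// subSS IH2 /= -[_ * a]mulrA.
have -> : (q ^+ (M - y.+1) - q ^+ M.*2) * a = r * (1 - q ^+ (M + y).+1) / q ^+ y.+1 :> R.
  have -> : q ^+ (M + y).+1 = q ^+ (M - y.+1) * q ^+ y.+1 * q ^+ y.+1.
    by rewrite -!exprD; congr (_ ^+ _); lia.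
  have qM' : q ^+ M = q ^+ (M - y.+1) * q ^+ y.+1 by rewrite -exprD subnK.
  by rewrite -addnn !exprD /a -/q qM'; field; rewrite !qn0.
move: d1 => /lt0r_neq0; set Q := q ^+ (M + y).+1 => d1 h; have n1 : r * (1 - q ^+ (M + y).+1) / q ^+ y.+1 != 0.
  by rewrite !mulf_neq0 ?invr_eq0.
apply: (mulIf n1); rewrite -h er [q ^+ y.+1]exprS /= -/Q.
have qy := qn0 y; have rr : q = r * r by rewrite /q expr2.
move: Q d1 qy {h n1} => Q.
move: (trd q M y) (w M) (r ^+ (y * y)) (q ^+ y) (1 - q ^+ (M - y)).
by rewrite rr => *; field; apply/and3P.
Qed.

Lemma nc_1Dce s t : 0 <= s ->
  nc (1 + s%:C%C * ce t) ^+ 2 = (1 + s) ^+ 2 - 2 * s * (1 - cos (2 * pi * t)).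
Proof.
move=> s0; rewrite /nc /ce /expi /= sqr_sqrtr ?addr_ge0 ?sqr_ge0//.
have := cos2Dsin2 (2 * pi * t); move: (cos _) (sin _) => c d h.
transitivity (1 + 2 * s * c + s ^+ 2 * (c ^+ 2 + d ^+ 2)); first by ring.
by rewrite h; ring.
Qed.

Lemma nc_1Dce_le s t : 0 <= s -> nc (1 + s%:C%C * ce t) <= 1 + s.
Proof.
move=> s0; rewrite -(@ler_pXn2r _ 2) ?nnegrE ?nc_ge0 ?addr_ge0// nc_1Dce//.
by have := cos_le1 (2 * pi * t); nra.
Qed.

(** For [s <= 1] one has [(1 + s)^2 <= 4], so subtracting [2 s c] from [(1 + s)^2], where
    [c = 1 - cos (2 pi t)], removes at least the fraction [c s / 2]; the square root leaves
    [c s / 4]. *)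
Lemma nc_1Dce_exp s t : 0 <= s <= 1 ->
  nc (1 + s%:C%C * ce t) <= (1 + s) * expR (- ((1 - cos (2 * pi * t)) / 4 * s)).
Proof.
move=> /andP[s0 s1].
rewrite -(@ler_pXn2r _ 2) ?nnegrE ?nc_ge0 ?mulr_ge0 ?addr_ge0 ?expR_ge0//.
rewrite nc_1Dce// exprMn -expRM_natl.
set c := 1 - cos _; have c0 : 0 <= c by rewrite subr_ge0 cos_le1.
apply: (@le_trans _ _ ((1 + s) ^+ 2 * (1 + 2%:R * - (c / 4 * s)))); last first.
  by rewrite ler_wpM2l ?sqr_ge0// expR_ge1Dx.
have : 0 <= c * s * (1 - s) by rewrite !mulr_ge0// subr_ge0.
have : 0 <= c * s * s * (1 - s) by rewrite !mulr_ge0// subr_ge0.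
rewrite !expr2; lra.
Qed.

(* Each factor [1 + s e(t)] is smaller than [1 + s] by a factor [expR (- c s)] with
   [c] of the order of [||t|| ^ 2]. *)
Lemma qbinc_poly_bound r M t (a := r / (r ^+ 2) ^+ M)
  (w := fun k => qbinc (r ^+ 2) M.*2 k * a ^+ k) : 0 < r < 1 ->
  nc (\sum_(k < (M.*2).+1) (w k)%:C%C * ce t ^+ k) <=
  (\sum_(k < (M.*2).+1) w k) *
    expR (- ((1 - cos (2 * pi * t)) / 4 * \sum_(m < M) r ^+ (m.*2).+1)).
Proof.
move=> /andP[r0 r1]; rewrite -/a; set q := r ^+ 2 in a w *.
have q0 : 0 < q by rewrite exprn_gt0.
have q1 : q < 1 by rewrite exprn_ilt1 ?ltW.
have a0 : 0 < a by rewrite divr_gt0 ?exprn_gt0.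
have qa i : 0 <= q ^+ i * a by rewrite mulr_ge0 ?exprn_ge0 ?ltW.
have e1 (z : R[i]) : \sum_(k < (M.*2).+1) (w k)%:C%C * z ^+ k =
    \prod_(i < M.*2) (1 + (q ^+ i * a)%:C%C * z).
  under [RHS]eq_bigr do rewrite rmorphM -mulrA.
  rewrite prod_qbinc; apply: eq_bigr => k _.
  by rewrite exprMn /w rmorphM rmorphXn -mulrA.
have e2 : \sum_(k < (M.*2).+1) w k = \prod_(i < M.*2) (1 + q ^+ i * a).
  apply: complexI; rewrite rmorph_sum rmorph_prod /=.
  transitivity (\sum_(k < (M.*2).+1) (w k)%:C%C * 1 ^+ k).
    by apply: eq_bigr => k _; rewrite expr1n mulr1.
  by rewrite e1; apply: eq_bigr => i _; rewrite mulr1 rmorphD.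
(* The lower [M] factors are bounded trivially; the upper ones are [1 + r ^ (2 i + 1) e(t)], whose
   coefficient is at most 1 as [nc_1Dce_exp] requires. *)
rewrite e1 e2 nc_prod -addnn !big_split_ord /=.
rewrite mulr_sumr -sumrN expR_sum -mulrA -[X in _ <= _ * X]big_split /=.
apply: ler_pM; try by apply: prodr_ge0 => i _; rewrite nc_ge0.
  by apply: ler_prod => i _; rewrite nc_ge0 nc_1Dce_le.
apply: ler_prod => i _; rewrite nc_ge0 /=.
have qr : q ^+ (M + i) * a = r ^+ (i.*2).+1.
  rewrite /a -/q exprD exprSr -mul2n exprM -/q; field.
  by rewrite expf_neq0 ?gt_eqF.
rewrite qr; apply: nc_1Dce_exp.
by rewrite exprn_ge0 ?exprn_ile1 ?ltW.
Qed.

Definition gw (mu : R) (y : int) : R := expR (- (mu * y%:~R ^+ 2)).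

Lemma gw_ge0 mu y : 0 <= gw mu y. Proof. exact: expR_ge0. Qed.

Lemma gw_sum mu (s : seq int) : uniq s -> 0 < mu ->
  \sum_(y <- s) gw mu y <= gaussC * (1 + (Num.sqrt mu)^-1).
Proof.
move=> us mu0; have := gauss_sum 0 us mu0; congr (_ <= _).
by apply: eq_bigr => y _; rewrite addr0.
Qed.

Lemma gwE mu y : gw mu y = expR (- mu) ^+ (`|y| * `|y|).
Proof.
rewrite /gw -expRM_natl natrM -expr2 natr_absz intr_norm real_normK ?num_real//.
by congr expR; rewrite mulrN mulrC.
Qed.

(** Up to a factor of modulus 1, [w M] times this sum is the polynomial of [qbinc_poly_bound], and
    the total mass of that polynomial is at most [w M] times a Gaussian sum. *)
Lemma theta_damped mu M t (r := expR (- mu)) : 0 < mu ->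
  nc (\sum_(y <- zr M) (trd (r ^+ 2) M `|y| * gw mu y)%:C%C * ce (y%:~R * t)) <=
  gaussC * (1 + (Num.sqrt mu)^-1) *
    expR (- ((1 - cos (2 * pi * t)) / 4 * \sum_(m < M) r ^+ (m.*2).+1)).
Proof.
move=> mu0.
have r0 : 0 < r by exact: expR_gt0.
have r1 : r < 1 by rewrite expR_lt1 oppr_lt0.
have r01 : 0 < r < 1 by rewrite r0.
have q01 : 0 < r ^+ 2 < 1 by rewrite exprn_gt0// exprn_ilt1 ?ltW.
have := qbinc_poly_bound M t r01.
set a := r / _; pose w (k : nat) := qbinc (r ^+ 2) M.*2 k * a ^+ k.
rewrite -/w.
have wM : 0 < w M.
  rewrite /w mulr_gt0 ?qbinc_gt0 ?exprn_gt0 ?divr_gt0 ?exprn_gt0//.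
  by rewrite -addnn leq_addr.
have wE (i : 'I_(M.*2).+1) (y := i%:Z - M%:Z) :
    w i = w M * (trd (r ^+ 2) M `|y| * gw mu y).
  rewrite gwE -/r mulrA; have [iM|/ltnW iM] := leqP i M.
    have h : (`|y| <= M)%N by rewrite /y; lia.
    by rewrite -(trd_qbinc r01 h).2; congr w; rewrite /y; lia.
  have h : (`|y| <= M)%N by have := ltn_ord i; rewrite /y; lia.
  by rewrite -(trd_qbinc r01 h).1; congr w; rewrite /y; lia.
move=> h; rewrite -(@ler_pM2l _ (w M))//.
have e1 : w M * nc (\sum_(y <- zr M) (trd (r ^+ 2) M `|y| * gw mu y)%:C%C * ce (y%:~R * t))
   = nc (\sum_(k < (M.*2).+1) (w k)%:C%C * ce t ^+ k).
  rewrite -[X in X * _](ger0_norm (ltW wM)) -nc_real -ncM sum_zr_ord mulr_sumr.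
  rewrite -[LHS]mul1r -[X in X * _](nc_ce (M%:R * t)) -ncM mulr_sumr; congr nc.
  apply: eq_bigr => i _; rewrite wE (rmorphM _ (w M)) -ceMn /= -mulrA mulrCA.
  congr (_ * _); rewrite mulrCA; congr (_ * _); rewrite -ceD; congr ce.

  by rewrite -mulrDl; congr (_ * _); rewrite intrB addrC subrK.
rewrite e1; apply: (le_trans h); rewrite [leRHS]mulrA ler_pM2r ?expR_gt0//.
under eq_bigr => i _ do rewrite -/a -/(w i) wE.
rewrite -mulr_sumr ler_pM2l// -(sum_zr_ord M (fun y => trd (r ^+ 2) M `|y| * gw mu y)).
apply: le_trans (gw_sum (zr_uniq M) mu0).
apply: ler_sum => y _; rewrite ler_piMl ?gw_ge0//.
by have [/andP[]] := trd_bound M `|y| q01.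
Qed.

End triple_product.

(** * Decay of theta sums away from the integers *)

Section theta_bound.
Context {R : realType}.
Implicit Types (mu t : R).

Definition Kf mu M t : R[i] := \sum_(y <- zr M) (gw mu y)%:C%C * ce (y%:~R * t).

Lemma zr_split (V : nmodType) (M M' : nat) (F : int -> V) : (M <= M')%N ->
  \sum_(y <- zr M') F y = \sum_(y <- zr M) F y + \sum_(y <- zr M' | (M < `|y|)%N) F y.
Proof.
move=> MM'; rewrite (bigID (fun y => (`|y| <= M)%N)) /=; congr (_ + _); last first.
  by apply: eq_bigl => y; rewrite ltnNge.
rewrite -big_filter; apply: perm_big; apply: uniq_perm; rewrite ?filter_uniq ?zr_uniq//.
by move=> y; rewrite mem_filter !mem_zr; lia.
Qed.

Lemma gw_tail mu M (s : seq int) : uniq s -> 0 < mu ->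
  \sum_(y <- s | (M < `|y|)%N) gw mu y <=
    expR (- (mu / 2 * M%:R ^+ 2)) * (gaussC * (1 + (Num.sqrt (mu / 2))^-1)).
Proof.
move=> us mu0; have mu20 : 0 < mu / 2 by rewrite divr_gt0.
apply: le_trans (_ : \sum_(y <- s) expR (- (mu / 2 * M%:R ^+ 2)) * gw (mu / 2) y <= _).
  rewrite big_mkcond /=; apply: ler_sum => y _; case: ltnP => h; last first.
    by rewrite mulr_ge0 ?expR_ge0.
  rewrite /gw -expRD ler_expR.
  have : M%:R ^+ 2 <= y%:~R ^+ 2 :> R.
    rewrite -[y%:~R ^+ 2]real_normK ?num_real// -intr_norm -natr_absz.
    by rewrite lerXn2r ?nnegrE// ler_nat ltnW.
  nra.
by rewrite -mulr_sumr ler_pM2l ?expR_gt0// gw_sum.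
Qed.

Lemma invsqrt_le (c mu L : R) : 0 < c -> 0 < L -> c <= mu * L ^+ 2 ->
  (Num.sqrt mu)^-1 <= L / Num.sqrt c.
Proof.
move=> c0 L0 h.
have mu0 : 0 < mu by rewrite -(@pmulr_lgt0 _ (L ^+ 2)) ?exprn_gt0// (lt_le_trans c0).
have s1 : 0 < Num.sqrt mu by rewrite sqrtr_gt0.
have s2 : 0 < Num.sqrt c by rewrite sqrtr_gt0.
rewrite ler_pdivlMr// ler_pdivrMl//.
rewrite -[X in _ <= _ * X](ger0_norm (ltW L0)) -sqrtr_sqr -sqrtrM ?(ltW mu0)//.
by rewrite ler_sqrt// mulr_ge0 ?sqr_ge0// ltW.
Qed.

(** Damped sums at a level [M'] tending to infinity obey the bound by [theta_damped]. To pass to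
    [Kf], the terms beyond [M >= L ^ 2] are already as small as the bound, and on the remaining ones
    the factors [trd] tend to 1. *)
Lemma K_bound (c1 c2 : R) : 0 < c1 -> 0 < c2 ->
  exists C c : R, [/\ 0 < C, 0 < c & forall (L M : nat) mu t (k : int),
    (0 < L)%N -> (L ^ 2 <= M)%N ->
    c1 <= mu * L%:R ^+ 2 -> mu * L%:R ^+ 2 <= c2 -> `|t - k%:~R| <= 2^-1 ->
    nc (Kf mu M t) <= C * L%:R * expR (- (c * (L%:R * (t - k%:~R)) ^+ 2))].
Proof.
move=> c10 c20; have [cq cq0 hq] := @cos_quadratic R.
pose c3 := cq / 4 * expR (- (2 * c2)).
have c30 : 0 < c3 by rewrite mulr_gt0 ?expR_gt0// divr_gt0.
pose c := Num.min c3 (2 * c1).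
have c0 : 0 < c by rewrite lt_min c30 mulr_gt0.
pose C0 := gaussC * (1 + (Num.sqrt c1)^-1) + gaussC * (1 + (Num.sqrt (c1 / 2))^-1) : R.
have s10 : 0 < (Num.sqrt c1)^-1 by rewrite invr_gt0 sqrtr_gt0.
have s20 : 0 < (Num.sqrt (c1 / 2))^-1 by rewrite invr_gt0 sqrtr_gt0 divr_gt0.
have gC := @gaussC_gt0 R.
exists C0, c; split => //; first by rewrite addr_gt0// mulr_gt0// addr_gt0.
move=> L M mu t k L0 LM h1 h2 tk.
have L1 : 1 <= L%:R :> R by rewrite ler1n.
have Lp : 0 < L%:R :> R by rewrite ltr0n.
have mu0 : 0 < mu by rewrite -(@pmulr_lgt0 _ (L%:R ^+ 2)) ?exprn_gt0// (lt_le_trans c10).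
pose r := expR (- mu).
have r0 : 0 < r by exact: expR_gt0.
have r1 : r < 1 by rewrite expR_lt1 oppr_lt0.
have q01 : 0 < r ^+ 2 < 1 by rewrite exprn_gt0// exprn_ilt1 ?ltW.
set E := expR (- (c * _)).
have E0 : 0 < E by exact: expR_gt0.
have A M' : (M <= M')%N ->
    nc (\sum_(y <- zr M') (trd (r ^+ 2) M' `|y| * gw mu y)%:C%C * ce (y%:~R * t)) <=
    gaussC * (1 + (Num.sqrt c1)^-1) * L%:R * E.
  move=> MM'; apply: (le_trans (theta_damped M' t mu0)).
  apply: ler_pM; rewrite ?expR_ge0 ?mulr_ge0 ?addr_ge0 ?invr_ge0 ?sqrtr_ge0 ?(ltW gC)//.
    rewrite -mulrA ler_pM2l// mulrDl mul1r lerD// mulrC.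
    by apply: invsqrt_le.
  rewrite /E ler_expR lerN2.
  (* The first [L ^ 2] odd powers of [r] are at least [r ^ (2 L ^ 2) >= expR (- (2 c2))]; hence the
     factor in [c3]. *)
  have S : L%:R ^+ 2 * expR (- (2 * c2)) <= \sum_(m < M') r ^+ (m.*2).+1.
    rewrite -(subnKC (leq_trans LM MM')).
    rewrite big_split_ord /= -[leLHS]addr0 lerD//; last first.
      by apply: sumr_ge0 => i _; rewrite exprn_ge0 ?ltW.
    rewrite -natrX -[X in X%:R * _](card_ord (L ^ 2)) mulr_natl -sumr_const.
    apply: ler_sum => i _; apply: le_trans (_ : r ^+ (L ^ 2).*2 <= _).
      rewrite /r -expRM_natl ler_expR -mul2n natrM natrX; nra.
    rewrite ler_wiXn2l ?(ltW r0) ?(ltW r1)//.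
    by rewrite ltn_double; exact: ltn_ord.
  have := hq _ tk.
  have -> : cos (2 * pi * (t - k%:~R)) = cos (2 * pi * t).
    have := ceDint t (- k); rewrite intrN /ce /expi => /eqP.
    by rewrite eq_complex => /andP[/eqP].
  move=> hc; apply: le_trans (_ : c3 * (L%:R * (t - k%:~R)) ^+ 2 <= _).
    by rewrite ler_wpM2r ?sqr_ge0// ge_min lexx.
  apply: le_trans (_ : (cq * (t - k%:~R) ^+ 2) / 4 * (L%:R ^+ 2 * expR (- (2 * c2))) <= _).
    by rewrite /c3 exprMn; lra.
  apply: ler_pM => //; last by lra.
    by rewrite divr_ge0// mulr_ge0 ?sqr_ge0// ltW.
have B M' : (M <= M')%N -> \sum_(y <- zr M' | (M < `|y|)%N) gw mu y <=
    gaussC * (1 + (Num.sqrt (c1 / 2))^-1) * L%:R * E.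
  move=> MM'; apply: (le_trans (gw_tail M (zr_uniq M') mu0)).
  rewrite mulrC; apply: ler_pM; rewrite ?expR_ge0 ?mulr_ge0 ?addr_ge0 ?invr_ge0 ?sqrtr_ge0 ?(ltW gC)//.
    rewrite -mulrA ler_pM2l// mulrDl mul1r lerD// [leRHS]mulrC.
    by apply: invsqrt_le => //; [rewrite divr_gt0|lra].
  rewrite /E ler_expR lerN2.
  have M2 : (L%:R ^+ 2) ^+ 2 <= M%:R ^+ 2 :> R.
    by rewrite lerXn2r ?nnegrE// -natrX ler_nat.
  (* The tail is of order [expR (- (c1 / 2 L ^ 2))], which is enough because [|t - k| <= 1/2] and
     [c <= 2 c1]. *)
  have : (t - k%:~R) ^+ 2 <= 4^-1.
    rewrite -real_normK ?num_real//; move: tk (normr_ge0 (t - k%:~R)); nra.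
  set s2 := (_ - _) ^+ 2 => hs.
  have : c * (L%:R * (t - k%:~R)) ^+ 2 <= 2 * c1 * L%:R ^+ 2 * 4^-1.
    rewrite exprMn mulrA; apply: ler_pM => //; first by rewrite mulr_ge0 ?sqr_ge0 ?ltW.
      by rewrite sqr_ge0.
    by rewrite ler_wpM2r ?sqr_ge0// ge_min lexx orbT.
  have : mu / 2 * (L%:R ^+ 2) ^+ 2 <= mu / 2 * M%:R ^+ 2.
    by rewrite ler_wpM2l// divr_ge0 ?ltW.
  have : c1 / 2 * L%:R ^+ 2 <= mu / 2 * (L%:R ^+ 2) ^+ 2.
    rewrite [(_ ^+ 2) ^+ 2]expr2; move: (sqr_ge0 (L%:R : R)) h1.
    by set Q := L%:R ^+ 2 => q0 h1'; nra.
  lra.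
rewrite /C0 !mulrDl; apply/ler_addgt0Pr => e e0.
have [M' MM' hM'] : exists2 M', (M <= M')%N &
    ((M.*2).+1 * M)%:R * (r ^+ 2) ^+ (M' - M) <= e.
  have : ((M.*2).+1 * M)%:R * (r ^+ 2) ^+ m @[m --> \oo] --> (0 : R).
    rewrite -[X in _ --> X](mulr0 ((M.*2).+1 * M)%:R).
    apply: cvgZr || apply: cvgMl; apply: cvg_expr.
    by case/andP: q01 => q0 q1; rewrite ger0_norm ?ltW.
  move=> /cvgrPdist_le /(_ _ e0)[m _ /(_ m (leqnn m))].
  rewrite /= sub0r normrN => h; exists (M + m)%N; first exact: leq_addr.
  by rewrite addKn; apply: le_trans h; exact: ler_norm.
have -> : Kf mu M t = \sum_(y <- zr M') (trd (r ^+ 2) M' `|y| * gw mu y)%:C%C * ce (y%:~R * t)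
   - \sum_(y <- zr M' | (M < `|y|)%N) (trd (r ^+ 2) M' `|y| * gw mu y)%:C%C * ce (y%:~R * t)
   + \sum_(y <- zr M) ((1 - trd (r ^+ 2) M' `|y|) * gw mu y)%:C%C * ce (y%:~R * t).
  rewrite (zr_split _ MM') addrK -big_split; apply: eq_bigr => y _ /=.
  rewrite -mulrDl -rmorphD -mulrDl addrC subrK mul1r //.
apply: (le_trans (ncD _ _)); apply: lerD.
  apply: (le_trans (ncB _ _)); apply: lerD; first exact: A.
  apply: le_trans (B _ MM'); apply: (le_trans (nc_sum _ _ _)).
  apply: ler_sum => y _; rewrite ncM nc_ce mulr1 nc_real.
  have [/andP[d0 d1] _] := trd_bound M' `|y| q01.
  by rewrite ger0_norm ?mulr_ge0 ?gw_ge0// ler_piMl ?gw_ge0.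
apply: le_trans hM'; apply: (le_trans (nc_sum _ _ _)).
apply: le_trans (_ : \sum_(y <- zr M) (M%:R * (r ^+ 2) ^+ (M' - M)) <= _); last first.
  by rewrite sum_zr_ord sumr_const card_ord -[leLHS]mulr_natl mulrA natrM.
rewrite big_seq [leRHS]big_seq; apply: ler_sum => y; rewrite mem_zr => yM.
rewrite ncM nc_ce mulr1 nc_real.
have [/andP[d0 d1] /(_ (leq_trans yM MM')) d2] := trd_bound M' `|y| q01.
rewrite ger0_norm ?mulr_ge0 ?gw_ge0 ?subr_ge0//.
apply: le_trans (_ : 1 - trd (r ^+ 2) M' `|y| <= _).
  rewrite ler_piMr ?subr_ge0// /gw expR_le1 oppr_le0 mulr_ge0 ?sqr_ge0 ?ltW//.
apply: le_trans (_ : `|y|%:R * (r ^+ 2) ^+ (M' - `|y|) <= _); first by lra.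
apply: ler_pM; rewrite ?ler_nat//; first by rewrite !exprn_ge0// ltW.
by case/andP: q01 => /ltW q0 /ltW q1; rewrite ler_wiXn2l// leq_sub2l.
Qed.

End theta_bound.

(** * Bilinear sums in a unimodular basis *)

Section lattice.
Context {R : realType}.
Implicit Types (al lam mu u t : R) (q h l k x y : int).

Definition Zf al lam mu (X Y : nat) u : R[i] :=
  \sum_(x <- zr X) \sum_(y <- zr Y)
    (gw lam x * gw mu y)%:C%C * ce (x%:~R * al + x%:~R * y%:~R * u).

Lemma Zf_y al lam mu X Y u :
  Zf al lam mu X Y u = \sum_(y <- zr Y) (gw mu y)%:C%C * Kf lam X (al + y%:~R * u).
Proof.
rewrite /Zf exchange_big /=; apply: eq_bigr => y _; rewrite /Kf mulr_sumr.
apply: eq_bigr => x _; rewrite rmorphM mulrA [X in X * _ = _]mulrC; congr (_ * ce _).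
by ring.
Qed.

Lemma Zf_x al lam mu X Y u :
  Zf al lam mu X Y u =
  \sum_(x <- zr X) (gw lam x)%:C%C * ce (x%:~R * al) * Kf mu Y (x%:~R * u).
Proof.
apply: eq_bigr => x _; rewrite /Kf mulr_sumr; apply: eq_bigr => y _.
by rewrite rmorphM ceD mulrACA; congr (_ * (_ * ce _)); ring.
Qed.

Lemma Kf_period mu M t k : Kf mu M (t + k%:~R) = Kf mu M t.
Proof.
apply: eq_bigr => y _; congr (_ * _).
by rewrite mulrDr -intrM ceDint.
Qed.

Definition nz (t : R) : int := Num.floor (t + 2^-1).

Lemma nz_dist t : `|t - (nz t)%:~R| <= 2^-1.
Proof.
have /andP[] : ((nz t)%:~R <= t + 2^-1) && (t + 2^-1 < (nz t + 1)%:~R) by exact: floor_itv.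
by rewrite intrD ler_norml => ? ?; apply/andP; split; lra.
Qed.

Lemma nz_eq t k : `|t - k%:~R| < 2^-1 -> nz t = k.
Proof.
rewrite ltr_norml => /andP[h1 h2].
by apply: floor_def; rewrite intrD; apply/andP; split; lra.
Qed.

Section unimodular.
Variables (q h q' h' : int) (L u : R).
Hypotheses (det1 : h' * q - h * q' = 1) (L0 : 0 < L).
Let qR : R := q%:~R.
Let hR : R := h%:~R.
Let q'R : R := q'%:~R.
Let h'R : R := h'%:~R.

Lemma det1R : h'R * qR - hR * q'R = 1.
Proof. by rewrite /h'R /qR /hR /q'R -!intrM -intrB det1. Qed.

Lemma unimod_fst y k : (h' * y - q' * k) * q + (q * k - h * y) * q' = y.
Proof. by rewrite -[RHS]mulr1 -det1; ring. Qed.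

Lemma unimod_snd y k : (h' * y - q' * k) * h + (q * k - h * y) * h' = k.
Proof. by rewrite -[RHS]mulr1 -det1; ring. Qed.

(* The squared length of [(q / L, L (u q - h))], the first vector of a basis of the lattice
   of the [(y / L, L (y u - k))]; [vec_identity] is Lagrange's identity in the
   coordinates [(h' y - q' k, q k - h y)]. *)
Definition vec2 : R := (qR / L) ^+ 2 + (L * (u * qR - hR)) ^+ 2.

Lemma vec_identity (al : R) y k : 0 < vec2 ->
  (y%:~R / L) ^+ 2 + (L * (al + y%:~R * u - k%:~R)) ^+ 2 =
  vec2 * ((h' * y - q' * k)%:~R +
     ((q * k - h * y)%:~R * (qR * q'R / L ^+ 2 + L ^+ 2 * (u * qR - hR) * (u * q'R - h'R))
        + L ^+ 2 * (u * qR - hR) * al) / vec2) ^+ 2 +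
  ((q * k - h * y)%:~R - qR * al) ^+ 2 / vec2.
Proof.
move=> v0; have vn0 : vec2 != 0 by rewrite gt_eqF.
set l := h' * y - _; set l' := q * k - _.
have ey : y%:~R = l%:~R * qR + l'%:~R * q'R.
  by rewrite -[in LHS](unimod_fst y k) intrD !intrM.
have ek : k%:~R = l%:~R * hR + l'%:~R * h'R.
  by rewrite -[in LHS](unimod_snd y k) intrD !intrM.
have Ln0 : L != 0 by rewrite gt_eqF.
set b := qR * q'R / _ + _.
have e1 : vec2 * ((y%:~R / L) ^+ 2 + (L * (al + y%:~R * u - k%:~R)) ^+ 2) =
  (l'%:~R - qR * al) ^+ 2 + 
  (vec2 * l%:~R + (l'%:~R * b + L ^+ 2 * (u * qR - hR) * al)) ^+ 2.
  have -> : vec2 * l%:~R + (l'%:~R * b + L ^+ 2 * (u * qR - hR) * al) =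
     (qR / L) * (y%:~R / L) + (L * (u * qR - hR)) * (L * (al + y%:~R * u - k%:~R)).
    by rewrite ey ek /vec2 /b; field.
  have -> : l'%:~R - qR * al = (L * (u * qR - hR)) * (y%:~R / L)
       - (qR / L) * (L * (al + y%:~R * u - k%:~R)).
    have -> : l'%:~R = l'%:~R * (h'R * qR - hR * q'R) by rewrite det1R mulr1.
    by rewrite ey ek; field.
  by rewrite /vec2; ring.
apply: (mulfI vn0); rewrite e1; field; exact: vn0.
Qed.

(** [q k - h y] is, up to sign, the determinant of the basis vector and the lattice vector; this is
    Cauchy's inequality for it. *)
Lemma unimod_cauchy y k :
  (q * k - h * y)%:~R ^+ 2 <= vec2 * ((y%:~R / L) ^+ 2 + (L * (y%:~R * u - k%:~R)) ^+ 2).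
Proof.
have Ln0 : L != 0 by rewrite gt_eqF.
have -> : (q * k - h * y)%:~R = (L * (u * qR - hR)) * (y%:~R / L)
       - (qR / L) * (L * (y%:~R * u - k%:~R)).
  by rewrite intrB !intrM -/qR -/hR; field.
rewrite /vec2; set a := qR / L; set b := L * (u * qR - hR).
set c := y%:~R / L; set d := L * (_ - _).
rewrite -subr_ge0 (_ : _ - _ = (a * c + b * d) ^+ 2) ?sqr_ge0//; ring.
Qed.

End unimodular.

(** A term of [Zf_y] decays like a Gaussian in the length of the vector [(y / L, L (t - nz t))]: the
    weight controls the first coordinate, [K_bound] the second. *)
Lemma Zterm_bound (c1 c2 : R) : 0 < c1 -> 0 < c2 ->
  exists C c : R, [/\ 0 < C, 0 < c & forall (L M : nat) lam mu t y,
    (0 < L)%N -> (L ^ 2 <= M)%N ->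
    c1 <= lam * L%:R ^+ 2 -> lam * L%:R ^+ 2 <= c2 -> c1 <= mu * L%:R ^+ 2 ->
    gw mu y * nc (Kf lam M t) <= C * L%:R *
      expR (- (c * ((y%:~R / L%:R) ^+ 2 + (L%:R * (t - (nz t)%:~R)) ^+ 2)))].
Proof.
move=> c10 c20; have [C [c [C0 c0 hK]]] := K_bound c10 c20.
exists C, (Num.min c1 c); split => //; first by rewrite lt_min c10.
move=> L M lam mu t y L0 LM h1 h2 h3.
have Lp : 0 < L%:R :> R by rewrite ltr0n.
have := hK L M lam t (nz t) L0 LM h1 h2 (nz_dist t).
set d := L%:R * _ => hk.
apply: le_trans (_ : gw mu y * (C * L%:R * expR (- (c * d ^+ 2))) <= _).
  by rewrite ler_wpM2l ?gw_ge0.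
rewrite mulrCA ler_wpM2l ?mulr_ge0 ?(ltW C0)// /gw -expRD ler_expR.
set m := Num.min c1 c.
have m1 : m <= c1 by rewrite ge_min lexx.
have m2 : m <= c by rewrite ge_min lexx orbT.
have e1 : m * (y%:~R / L%:R) ^+ 2 <= mu * y%:~R ^+ 2.
  rewrite (_ : mu * _ = (mu * L%:R ^+ 2) * (y%:~R / L%:R) ^+ 2); last by field; rewrite gt_eqF.
  by rewrite ler_wpM2r ?sqr_ge0// (le_trans m1).
have e2 : m * d ^+ 2 <= c * d ^+ 2 by rewrite ler_wpM2r ?sqr_ge0.
lra.
Qed.

Lemma sqrtr_inv_le (c v : R) : 0 < c -> 0 < v ->
  (Num.sqrt (c * v))^-1 = (Num.sqrt c)^-1 / Num.sqrt v.
Proof. by move=> c0 v0; rewrite sqrtrM ?ltW// invfM. Qed.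

(** [y] and the integer nearest to [al + y u] form a lattice point; in its coordinates in the
    unimodular basis [vec_identity] makes the Gaussian of [Zterm_bound] triangular, with sum of
    order [1 / sqrt vec2]. Its last square is at least [eta ^ 2 / vec2], since [eta] bounds the
    distance of [q al] to the integers from below; half of it is set aside for the exponential
    factor. *)
Lemma Zf_bound (c1 c2 V : R) : 0 < c1 -> 0 < c2 -> 0 < V ->
  exists C c : R, [/\ 0 < C, 0 < c & forall (L X Y : nat) al lam mu u q h q' h' (eta : R),
    (0 < L)%N -> (L ^ 2 <= X)%N ->
    c1 <= lam * L%:R ^+ 2 -> lam * L%:R ^+ 2 <= c2 -> c1 <= mu * L%:R ^+ 2 ->
    h' * q - h * q' = 1 -> 0 <= eta -> (forall k, eta <= `|q%:~R * al - k%:~R|) ->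
    0 < vec2 q h L%:R u -> vec2 q h L%:R u <= V ^+ 2 ->
    nc (Zf al lam mu X Y u) <= C * L%:R / Num.sqrt (vec2 q h L%:R u) *
      expR (- (c * (eta ^+ 2 / vec2 q h L%:R u)))].
Proof.
move=> c10 c20 V0; have [C [c [C0 c0 hT]]] := Zterm_bound c10 c20.
have c20' : 0 < c / 2 by rewrite divr_gt0.
(* As [v <= V], the two factors that [gauss_sum2] produces are at most [A / v] and [B], up to
   [gaussC]. *)
pose A := V + (Num.sqrt c)^-1; pose B := 1 + (Num.sqrt (c / 2))^-1 * V.
have A0 : 0 < A by rewrite addr_gt0// invr_gt0 sqrtr_gt0.
have B0 : 0 < B by rewrite addr_gt0// mulr_gt0// invr_gt0 sqrtr_gt0.
have gC := @gaussC_gt0 R.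
exists (C * (gaussC * A) * (gaussC * B)), (c / 2); split => //.
  by rewrite !mulr_gt0.
move=> L X Y al lam mu u q h q' h' eta L0 LX h1 h2 h3 det eta0 heta v0 vV.
have Lp : 0 < L%:R :> R by rewrite ltr0n.
set v2 := vec2 _ _ _ _ in v0 vV *; set v := Num.sqrt v2.
have vp : 0 < v by rewrite sqrtr_gt0.
have vvV : v <= V by rewrite -(ger0_norm (ltW V0)) -sqrtr_sqr ler_sqrt ?sqr_ge0.
pose tau (l' : int) := (l'%:~R * (q%:~R * q'%:~R / L%:R ^+ 2 +
    L%:R ^+ 2 * (u * q%:~R - h%:~R) * (u * q'%:~R - h'%:~R))
        + L%:R ^+ 2 * (u * q%:~R - h%:~R) * al) / v2 : R.
pose f (y : int) := let k := nz (al + y%:~R * u) in (h' * y - q' * k, q * k - h * y).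
have finj : injective f.
  move=> y1 y2 [e1 e2]; rewrite -(unimod_fst det y1 (nz (al + y1%:~R * u))).
  by rewrite e1 e2 (unimod_fst det).
pose g (p : int * int) := expR (- (c * v2 * (p.1%:~R + tau p.2) ^+ 2)
   - c / 2 / v2 * (p.2%:~R + - (q%:~R * al)) ^+ 2).
have key y : gw mu y * nc (Kf lam X (al + y%:~R * u)) <=
    C * L%:R * expR (- (c / 2 * (eta ^+ 2 / v2))) * g (f y).
  apply: (le_trans (hT L X lam mu (al + y%:~R * u) y L0 LX h1 h2 h3)).
  rewrite -[leRHS]mulrA ler_wpM2l ?mulr_ge0 ?(ltW C0)// -expRD ler_expR.
  rewrite (vec_identity det Lp al _ _ v0) -/v2.
  rewrite /f /=; set k := nz _; rewrite -/(tau (q * k - h * y)).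
  set w := (q * k - h * y)%:~R - _.
  have : eta ^+ 2 <= w ^+ 2.
    rewrite -[w ^+ 2]real_normK ?num_real//.
    have : eta <= `|w| by rewrite /w distrC; exact: heta.
    by move=> ?; rewrite lerXn2r ?nnegrE.
  move=> hw; have : eta ^+ 2 / v2 <= w ^+ 2 / v2 by rewrite ler_pM2r ?invr_gt0.
  have -> : c / 2 / v2 * w ^+ 2 = c / 2 * (w ^+ 2 / v2) by ring.
  set a := _ ^+ 2 / v2; set b := w ^+ 2 / v2; set d := v2 * _ ^+ 2.
  rewrite (_ : c * v2 * _ = c * d); last by rewrite /d; ring.
  by move=> hab; nra.
rewrite Zf_y; apply: (le_trans (nc_sum _ _ _)).
apply: le_trans (_ : C * L%:R * expR (- (c / 2 * (eta ^+ 2 / v2))) *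
    ((gaussC * (1 + (Num.sqrt (c * v2))^-1)) * (gaussC * (1 + (Num.sqrt (c / 2 / v2))^-1))) <= _).
  apply: le_trans (_ : \sum_(y <- zr Y) C * L%:R * expR (- (c / 2 * (eta ^+ 2 / v2))) * g (f y) <= _).
    by apply: ler_sum => y _; rewrite ncM nc_real ger0_norm ?gw_ge0.
  rewrite -mulr_sumr ler_wpM2l ?mulr_ge0 ?expR_ge0 ?(ltW C0)//.
  rewrite -(big_map f xpredT g); apply: gauss_sum2; rewrite ?mulr_gt0 ?invr_gt0//.
  by rewrite map_inj_uniq// zr_uniq.
have hA : 1 + (Num.sqrt (c * v2))^-1 <= A / v.
  rewrite sqrtr_inv_le// -/v /A mulrDl lerD2r ler_pdivlMr// mul1r //.
have hB : 1 + (Num.sqrt (c / 2 / v2))^-1 <= B.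
  rewrite sqrtr_inv_le ?invr_gt0// sqrtrV ?(ltW v0)// invrK -/v /B lerD2l.
  by rewrite ler_wpM2l// invr_ge0 sqrtr_ge0.
rewrite [leRHS](_ : _ = C * L%:R * expR (- (c / 2 * (eta ^+ 2 / v2))) *
   ((gaussC * (A / v)) * (gaussC * B))); last by ring.
rewrite ler_wpM2l ?mulr_ge0 ?expR_ge0 ?(ltW C0)//.
have p1 : 0 <= 1 + (Num.sqrt (c * v2))^-1 by rewrite addr_ge0// invr_ge0 sqrtr_ge0.
have p2 : 0 <= 1 + (Num.sqrt (c / 2 / v2))^-1 by rewrite addr_ge0// invr_ge0 sqrtr_ge0.
by apply: ler_pM; rewrite ?mulr_ge0 ?(ltW gC)// ler_pM2l.
Qed.

End lattice.

Section truncation.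
Context {R : realType}.
Implicit Types (al lam mu u t : R) (q h l k x y : int).

(* The part of [Zf] where [x = l q + l' q'] with [l] and [l'] at most [T], the sum over [y]
   being written as [Kf]. *)
Definition Zbox al lam mu (Y T : nat) q q' (a b : R) : R[i] :=
  \sum_(p <- [seq (l, l') | l <- zr T, l' <- zr T])
    (gw lam (p.1 * q + p.2 * q'))%:C%C * ce ((p.1 * q + p.2 * q')%:~R * al) *
    Kf mu Y (p.1%:~R * a + p.2%:~R * b).

(** The coordinates [(l, l')] are those of [(x, k)], with [k] the integer nearest to [x u]. Outside
    the box, Cauchy's inequality against both basis vectors makes the lattice vector of length at
    least of order [T / V]. Inside, [4 T V < L] forces [k = l h + l' h'], so each point of the box
    occurs exactly once, and [2 T <= L] keeps [x] within [X]. *)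
Lemma Zf_trunc (c1 c2 V : R) : 0 < c1 -> 0 < c2 -> 0 < V ->
  exists C c : R, [/\ 0 < C, 0 < c &
    forall (L X Y T : nat) al lam mu u q h q' h',
    (0 < L)%N -> (L ^ 2 <= X)%N -> (L ^ 2 <= Y)%N -> (T.*2 <= L)%N ->
    T%:R * V * 4 < L%:R -> (`|q| <= L)%N -> (`|q'| <= L)%N ->
    c1 <= mu * L%:R ^+ 2 -> mu * L%:R ^+ 2 <= c2 -> c1 <= lam * L%:R ^+ 2 ->
    h' * q - h * q' = 1 ->
    vec2 q h L%:R u <= V ^+ 2 -> vec2 q' h' L%:R u <= V ^+ 2 ->
    nc (Zf al lam mu X Y u -
        Zbox al lam mu Y T q q' (u * q%:~R - h%:~R) (u * q'%:~R - h'%:~R))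
    <= C * L%:R * expR (- (c * T%:R ^+ 2))].
Proof.
move=> c10 c20 V0; have [C [c [C0 c0 hT]]] := Zterm_bound c10 c20.
(* Such that [c rho >= 2 d (l ^ 2 + l' ^ 2)] for the squared length [rho]: one half yields
   [d T ^ 2], the other is summed. *)
pose d := c / 4 / V ^+ 2.
have d0 : 0 < d by rewrite !divr_gt0 ?exprn_gt0.
have gC := @gaussC_gt0 R.
have s0 : 0 < (Num.sqrt d)^-1 by rewrite invr_gt0 sqrtr_gt0.
pose G := gaussC * (1 + (Num.sqrt d)^-1).
have G0 : 0 < G by rewrite mulr_gt0// addr_gt0.
exists (C * (G * G)), d; split => //; first by rewrite !mulr_gt0.
move=> L X Y T al lam mu u q h q' h' L0 LX LY TL TVL qL q'L h1 h2 h3 det vq vq'.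
have Lp : 0 < L%:R :> R by rewrite ltr0n.
pose f (y : int) := let k := nz (y%:~R * u) in (h' * y - q' * k, q * k - h * y).
have finj : injective f.
  move=> y1 y2 [e1 e2]; rewrite -(unimod_fst det y1 (nz (y1%:~R * u))).
  by rewrite e1 e2 (unimod_fst det).
pose box (p : int * int) := ((`|p.1| <= T) && (`|p.2| <= T))%N.
pose F x := (gw lam x)%:C%C * ce (x%:~R * al) * Kf mu Y (x%:~R * u).
have hsmall r (s : R) : 0 <= s -> r ^+ 2 <= s -> s <= V ^+ 2 -> `|r| <= V.
  move=> s0' rs sV; rewrite -(@ler_pXn2r _ 2) ?nnegrE ?(ltW V0)//.
  by rewrite real_normK ?num_real// (le_trans rs).
have ha : `|L%:R * (u * q%:~R - h%:~R)| <= V.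
  by apply: hsmall vq; rewrite /vec2 ?addr_ge0 ?sqr_ge0// lerDr sqr_ge0.
have hb : `|L%:R * (u * q'%:~R - h'%:~R)| <= V.
  by apply: hsmall vq'; rewrite /vec2 ?addr_ge0 ?sqr_ge0// lerDr sqr_ge0.
set a := u * q%:~R - h%:~R in ha *; set b := u * q'%:~R - h'%:~R in hb *.
have xu l l' : (l * q + l' * q')%:~R * u = l%:~R * a + l'%:~R * b + (l * h + l' * h')%:~R.
  by rewrite !intrD !intrM /a /b; ring.
have fK p : box p -> f (p.1 * q + p.2 * q') = p.
  case: p => l l' /andP[/= lT l'T].
  have e : nz ((l * q + l' * q')%:~R * u) = l * h + l' * h'.
    apply: nz_eq; rewrite xu addrK.
    rewrite -(@ltr_pM2l _ L%:R)// -[X in X * `|_|](ger0_norm (ltW Lp)) -normrM mulrDr.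
    apply: (le_lt_trans (ler_normD _ _)); rewrite !(mulrCA L%:R) !normrM.
    have [n1 n2] : `|l%:~R| <= T%:R :> R /\ `|l'%:~R| <= T%:R :> R.
      by rewrite -!intr_norm -!natr_absz !ler_nat.
    have m1 : `|l%:~R| * `|L%:R * a| <= T%:R * V by apply: ler_pM.
    have m2 : `|l'%:~R| * `|L%:R * b| <= T%:R * V by apply: ler_pM.
    by rewrite -!normrM in m1 m2 *; lra.
  rewrite /f e; congr (_, _).
    by rewrite -[RHS]mulr1 -[in RHS]det; ring.
  by rewrite -[RHS]mulr1 -[in RHS]det; ring.
have Zsplit : Zf al lam mu X Y u =
    \sum_(x <- zr X | box (f x)) F x + \sum_(x <- zr X | ~~ box (f x)) F x.
  by rewrite Zf_x (bigID (fun x => box (f x))).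
have Zb : Zbox al lam mu Y T q q' a b = \sum_(x <- zr X | box (f x)) F x.
  pose g (p : int * int) := p.1 * q + p.2 * q'.
  have boxP p : (p \in [seq (l, l') | l <- zr T, l' <- zr T]) = box p.
    case: p => l l'; apply/allpairsP/idP => [[[x x'] /= [h4 h5 [-> ->]]]|/andP[h4 h5]].
      by rewrite /box /=; move: h4 h5; rewrite !mem_zr => -> ->.
    by exists (l, l'); rewrite /= !mem_zr.
  suff pe : perm_eq [seq x <- zr X | box (f x)] (map g [seq (l, l') | l <- zr T, l' <- zr T]).
    rewrite -big_filter (perm_big _ pe) big_map /Zbox; apply: eq_bigr => p _.
    by rewrite /F /g xu Kf_period.
  have ug : {in [seq (l, l') | l <- zr T, l' <- zr T] &, injective g}.
    move=> p p'; rewrite !boxP => bp bp' e.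
    by rewrite -(fK _ bp) -(fK _ bp') -/(g p) e.
  rewrite perm_sym; apply: uniq_perm.
  - rewrite map_inj_in_uniq//; apply: allpairs_uniq; rewrite ?zr_uniq//.
    by move=> [? ?] [? ?] _ _ /= [-> ->].
  - by rewrite filter_uniq// zr_uniq.
  move=> x; rewrite mem_filter mem_zr; apply/mapP/andP => [[p]|[bx xX]].
    rewrite boxP => bp ->; rewrite /g fK//; split => //.
    have /andP[b1 b2] := bp; apply: leq_trans LX.
    apply: leq_trans (_ : `|p.1| * `|q| + `|p.2| * `|q'| <= _)%N.
      by rewrite -!abszM; move: (p.1 * q) (p.2 * q') => z z'; clear; lia.
    apply: leq_trans (_ : T * L + T * L <= _)%N; first by apply: leq_add; apply: leq_mul.
    by rewrite addnn doubleMl -mulnn leq_mul2r TL orbT.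
  by exists (f x); rewrite ?boxP// /g /f (unimod_fst det).
rewrite Zsplit Zb addrC addKr.
apply: (le_trans (nc_sum _ _ _)).
pose g (p : int * int) := expR (- (d * (p.1%:~R + 0) ^+ 2) - d * (p.2%:~R + 0) ^+ 2) : R.
have key x : ~~ box (f x) ->
    nc (F x) <= C * L%:R * expR (- (d * T%:R ^+ 2)) * g (f x).
  move=> nb; rewrite /F !ncM nc_ce mulr1 nc_real ger0_norm ?gw_ge0//.
  apply: (le_trans (hT L Y mu lam (x%:~R * u) x L0 LY h1 h2 h3)).
  rewrite -[leRHS]mulrA ler_wpM2l ?mulr_ge0 ?(ltW C0)// -expRD ler_expR.
  have := unimod_cauchy q h u Lp x (nz (x%:~R * u)).
  have := unimod_cauchy q' h' u Lp x (nz (x%:~R * u)).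
  set rho := (_ / _) ^+ 2 + _.
  have rho0 : 0 <= rho by rewrite addr_ge0 ?sqr_ge0.
  move: nb; rewrite /g /f /= /box /= !addr0.
  have -> : q' * nz (x%:~R * u) - h' * x = - (h' * x - q' * nz (x%:~R * u)).
    by rewrite opprB.
  rewrite intrN sqrrN; set l := h' * x - _; set l' := q * _ - _ => nb e1 e2.
  have {}e1 : l%:~R ^+ 2 <= V ^+ 2 * rho by apply: (le_trans e1); rewrite ler_wpM2r.
  have {}e2 : l'%:~R ^+ 2 <= V ^+ 2 * rho by apply: (le_trans e2); rewrite ler_wpM2r.
  have TT : T%:R ^+ 2 <= l%:~R ^+ 2 + l'%:~R ^+ 2 :> R.
    have sq z : (T < `|z|)%N -> T%:R ^+ 2 <= z%:~R ^+ 2 :> R.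
      move=> /ltnW hz; rewrite -[z%:~R ^+ 2]real_normK ?num_real// -intr_norm -natr_absz.
      by rewrite lerXn2r ?nnegrE// ler_nat.
    move: nb; rewrite negb_and -!ltnNge => /orP[/sq hz|/sq hz].
      by rewrite -[leLHS]addr0 lerD ?sqr_ge0.
    by rewrite -[leLHS]add0r lerD ?sqr_ge0.
  have e3 : d * (4 * V ^+ 2) = c by rewrite /d; field; rewrite gt_eqF.
  have : d * (l%:~R ^+ 2 + l'%:~R ^+ 2) <= d * (V ^+ 2 * rho + V ^+ 2 * rho).
    by rewrite ler_pM2l// lerD.
  have : d * T%:R ^+ 2 <= d * (l%:~R ^+ 2 + l'%:~R ^+ 2) by rewrite ler_pM2l.
  have -> : c * rho = 2 * (d * (V ^+ 2 * rho + V ^+ 2 * rho)) by rewrite -e3; ring.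
  by lra.
apply: (le_trans (ler_sum _ key)).
rewrite -mulr_sumr -[leRHS](_ : C * L%:R * expR (- (d * T%:R ^+ 2)) * (G * G) = _); last by ring.
rewrite ler_wpM2l ?mulr_ge0 ?expR_ge0 ?(ltW C0)//.
rewrite -big_filter -(big_map f xpredT g); apply: (gauss_sum2 0 (fun _ => 0)) => //.
by rewrite map_inj_uniq// filter_uniq// zr_uniq.
Qed.

End truncation.

Lemma powR_le {R : realType} (a b r : R) : 0 <= r -> 0 <= a -> a <= b -> a `^ r <= b `^ r.
Proof.
move=> r0 a0 ab; apply: ge0_ler_powR => //; rewrite nnegrE//.
exact: le_trans ab.
Qed.

Lemma half_bounds X (Y := (X.+1)./2) :
  [/\ (Y < X.+1)%N, (Y * 2 <= X.+1)%N & (X.+1 <= Y.+1 * 2)%N].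
Proof. by rewrite /Y; split; lia. Qed.

(** * Sums of negative powers of the distance to the integers *)

Section diophantine_sum.
Context {R : realType}.
Variable eta : nat -> R.
Hypothesis eta_sub : forall p q, (0 < p)%N -> (p < q)%N -> eta (q - p) <= eta p + eta q.

(* Two solutions of [eta q <= r] differ by a solution of [eta d <= 2 r], hence by at least
   [g]. *)
Lemma spaced_count (g r : R) X : 0 <= r -> 0 <= g ->
  (forall d, (0 < d)%N -> eta d <= 2 * r -> g <= d%:R) ->
  (\sum_(1 <= q < X.+1) ((eta q <= r)%R)%:R) * g <= X%:R.
Proof.
move=> r0 g0 hg.
(* The induction carries the last solution [l], with 0 for none. The first solution is itself at
   least [g], so the count has no boundary term. *)
suff : exists l, [/\ (l <= X)%N, (l == 0)%N || (eta l <= r) &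
    (\sum_(1 <= q < X.+1) ((eta q <= r)%R)%:R) * g <= l%:R].
  by case=> l [lX _ h]; apply: (le_trans h); rewrite ler_nat.
elim: X => [|X [l [lX hl IH]]]; first by exists 0%N; rewrite big_geq// mul0r.
rewrite big_nat_recr//=; have [hX|_] := boolP (eta X.+1 <= r); last first.
  by exists l; rewrite addr0 leqW.
exists X.+1; rewrite leqnn hX orbT; split => //.
rewrite mulrDl mul1r; case/orP: hl => [/eqP l0|hl].
  apply: (le_trans (lerD IH (lexx _))); rewrite l0 add0r; apply: hg => //; lra.
have l0 : l = 0%N \/ (0 < l)%N by lia.
case: l0 => [l0|l0].
  apply: (le_trans (lerD IH (lexx _))); rewrite l0 add0r; apply: hg => //; lra.
apply: (le_trans (lerD IH (lexx _))).
have : g <= (X.+1 - l)%:R.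
  by apply: hg; [rewrite subn_gt0 ltnS|apply: (le_trans (eta_sub l0 _)); rewrite ?ltnS//; lra].
by rewrite natrB ?leqW//; lra.
Qed.

Hypothesis eta_gt0 : forall q, (0 < q)%N -> 0 < eta q.
Hypothesis eta_le1 : forall q, eta q <= 1.
Variables c0 tau : R.
Hypotheses (c00 : 0 < c0) (tau0 : 0 < tau).
Hypothesis eta_dioph : forall q, (0 < q)%N -> c0 / q%:R `^ tau <= eta q.

(** Dyadic decomposition by the size of [eta q]. At most [X / g] indices have [eta q <= 2^-k], where
    [g] is of order [2^(k / tau)] by [eta_dioph]; so level [k] contributes a multiple of
    [2^((sigma - 1 / tau) k) X], and the geometric series converges. *)
Lemma eta_powsum (sigma : R) : 0 < sigma -> sigma * tau < 1 ->
  exists2 C : R, 0 < C & forall X : nat,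
    \sum_(1 <= q < X.+1) eta q `^ (- sigma) <= C * X%:R.
Proof.
move=> sg0 sgt.
have it0 : 0 < tau^-1 by rewrite invr_gt0.
have sgi : sigma < tau^-1 by rewrite -[tau^-1]mul1r ltr_pdivlMr.
pose x := 2 `^ (sigma - tau^-1) : R.
have x0 : 0 < x by rewrite powR_gt0.
have x1 : x < 1.
  rewrite /x /powR gt_eqF//= expR_lt1 nmulr_rlt0 ?subr_lt0//.
  by rewrite ln_gt0// ltr1n.
pose D := 2 `^ sigma * (c0 / 2) `^ (- tau^-1) : R.
have D0 : 0 < D by rewrite mulr_gt0// powR_gt0// divr_gt0.
exists (D / (1 - x)); first by rewrite divr_gt0// subr_gt0.
move=> X.
(* Finitely many levels suffice for the [q] up to [X]; the final bound is uniform in [K]. *)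
have [K hK] : exists K, forall q, (0 < q <= X)%N -> 2^-1 ^+ K < eta q.
  elim: (X) => [|Y [K hK]]; first by exists 0%N => -[|q].
  have : 2^-1 ^+ m @[m --> \oo] --> (0 : R).
    by apply: cvg_expr; rewrite ger0_norm ?invr_ge0// invf_lt1// ltr1n.
  move=> /cvgrPdist_lt /(_ _ (eta_gt0 (ltn0Sn Y)))[m _ /(_ m (leqnn m))].
  rewrite /= sub0r normrN ger0_norm ?exprn_ge0 ?invr_ge0// => hm.
  have mono i j : (i <= j)%N -> 2^-1 ^+ j <= 2^-1 ^+ i :> R.
    move=> ij; apply: ler_wiXn2l => //; rewrite ?invr_ge0// invf_le1 ?ler1n//.
  exists (maxn K m) => q /andP[q0]; rewrite leq_eqVlt => /orP[/eqP ->|qY].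
    by apply: le_lt_trans hm; apply: mono; exact: leq_maxr.
  by apply: le_lt_trans (hK q _); [apply: mono; exact: leq_maxl|rewrite q0].
have hq q : (0 < q <= X)%N ->
    eta q `^ (- sigma) <= \sum_(k < K) (2 `^ sigma) ^+ k.+1 * ((eta q <= 2^-1 ^+ k)%R)%:R.
  move=> qX; have q0 : (0 < q)%N by case/andP: qX.
  have ex : exists k, 2^-1 ^+ k < eta q by exists K; exact: hK.
  have := ex_minnP ex; case=> k hk kmin.
  have kK : (k <= K)%N by apply: kmin; exact: hK.
  case: k hk kmin kK => [|k] hk kmin kK; first by rewrite expr0 ltNge eta_le1 in hk.
  have hk' : eta q <= 2^-1 ^+ k.
    by rewrite leNgt; apply/negP => /kmin; rewrite ltnn.
  rewrite (bigD1 (Ordinal kK))//= hk' mulr1 -[leLHS]addr0; apply: lerD; last first.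
    by apply: sumr_ge0 => i _; rewrite mulr_ge0// exprn_ge0// powR_ge0.
  have -> : (2 `^ sigma) ^+ k.+1 = (2 ^+ k.+1) `^ sigma :> R.
    by rewrite -powR_mulrn ?powR_ge0// powRAC powR_mulrn.
  rewrite -mulN1r powRrM powR_inv1 ?(ltW (eta_gt0 q0))//.
  apply: powR_le; rewrite ?invr_ge0 ?(ltW sg0) ?(ltW (eta_gt0 q0))//.
  by rewrite -[leRHS]invrK lef_pV2 ?posrE ?eta_gt0 ?invr_gt0 ?exprn_gt0// -exprVn ltW.
rewrite big_nat; apply: (le_trans (ler_sum _ _)) => [q qX|]; first exact: hq.
rewrite -big_nat exchange_big /=.
apply: le_trans (_ : \sum_(k < K) (D * x ^+ k) * X%:R <= _); last first.
  rewrite -mulr_suml ler_wpM2r// -mulr_sumr ler_pM2l//.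
  have := @geometric_le _ x K; rewrite (ltW x0) x1 => /(_ isT).
  by rewrite -[N in iota _ N]subn0 -[iota _ _]/(index_iota 0 _) big_mkord.
apply: ler_sum => k _; rewrite -mulr_sumr.
set N := \sum_(_ <= _ < _) _.
pose g := (c0 / (2 * 2^-1 ^+ k)) `^ tau^-1 : R.
have h0 : 0 < 2^-1 ^+ k :> R by rewrite exprn_gt0// invr_gt0.
have g0 : 0 < g by rewrite powR_gt0// divr_gt0// mulr_gt0.
have : N * g <= X%:R.
  apply: spaced_count; [exact: ltW|exact: ltW|move=> d d0 hd].
  have dt : 0 < d%:R `^ tau by rewrite powR_gt0// ltr0n.
  have : c0 / (2 * 2^-1 ^+ k) <= d%:R `^ tau.
    have := le_trans (eta_dioph d0) hd.
    by rewrite !ler_pdivrMr ?mulr_gt0// mulrC.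
  have gg : 0 <= c0 / (2 * 2^-1 ^+ k) by rewrite divr_ge0 ?mulr_ge0 ?(ltW c00) ?(ltW h0).
  move=> /(powR_le (ltW it0) gg); rewrite -powRrM divff ?gt_eqF//.
  by rewrite powRr1.
rewrite -(ler_pdivlMr _ _ g0) => hN.
have -> : D * x ^+ k * X%:R = (2 `^ sigma) ^+ k.+1 * (X%:R / g); last first.
  by rewrite ler_wpM2l// exprn_ge0// powR_ge0.
have -> : g = (c0 / 2) `^ tau^-1 * (2 `^ tau^-1) ^+ k.
  rewrite -[in RHS]powR_mulrn ?powR_ge0// powRAC powR_mulrn// -powRM//; last first.
    by rewrite divr_ge0// ltW.
  by congr (_ `^ _); rewrite exprVn; field; rewrite expf_neq0.
rewrite /D /x powRB ?powRN; last by rewrite pnatr_eq0 implybT.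
rewrite expr_div_n exprS; field; rewrite expf_neq0 ?gt_eqF ?powR_gt0 ?divr_gt0//.
Qed.

(** The exponent [m] is split into [1 - nu], spent on [q / L], and [sigma = m - 1 + nu], spent on
    [eta q], with [nu > 0] small enough for [eta_powsum]. The saving [(E / L) ^ nu] is what makes
    small denominators negligible. *)
Lemma eta_weighted_sum (m : nat) : (0 < m)%N -> (m%:R - 1) * tau < 1 ->
  exists C nu : R, [/\ 0 < C, 0 < nu & forall L E : nat, (0 < L)%N ->
    \sum_(1 <= q < E.+1) (eta q + q%:R / L%:R) ^- m <= C * L%:R * (E%:R / L%:R) `^ nu].
Proof.
move=> m0 mtau; pose a := m%:R - 1 : R.
have a0 : 0 <= a by rewrite subr_ge0 ler1n.
have it0 : 0 < tau^-1 by rewrite invr_gt0.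
pose nu := Num.min 1 ((tau^-1 - a) / 2) : R.
have ta : 0 < tau^-1 - a by rewrite subr_gt0 -[tau^-1]mul1r ltr_pdivlMr.
have nu0 : 0 < nu by rewrite lt_min ltr01 divr_gt0.
have nu1 : nu <= 1 by rewrite ge_min lexx.
have nu2 : nu <= (tau^-1 - a) / 2 by rewrite ge_min lexx orbT.
pose sigma := a + nu.
have sg0 : 0 < sigma by rewrite ltr_wpDl.
have sgt : sigma * tau < 1 by rewrite -ltr_pdivlMr// mul1r /sigma; lra.
have [C C0 hC] := eta_powsum sg0 sgt.
have p2 : 2^-1 `^ nu < 1 :> R.
  rewrite /powR gt_eqF ?invr_gt0//= expR_lt1 pmulr_rlt0// ln_lt0//.
  by rewrite invr_gt0 ltr0n /= invf_lt1// ltr1n.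
(* The solution of [C' = C' 2^-nu + 2 C], the recursion that halving [X] gives in [hS]. *)
pose C' := 2 * C / (1 - 2^-1 `^ nu).
have C'0 : 0 < C' by rewrite divr_gt0 ?mulr_gt0// subr_gt0.
pose f q := q%:R `^ (- (1 - nu)) * eta q `^ (- sigma).
have hS X : \sum_(1 <= q < X.+1) f q <= C' * X%:R `^ nu.
  elim/ltn_ind: X => [[|X]] IH; first by rewrite big_geq// mulr_ge0 ?powR_ge0// ltW.
  have [] := half_bounds X; set Y := (X.+1)./2 => YX Y1 Y2.
  have YX2 : (Y.+1 <= X.+2)%N by exact: ltnW.
  rewrite (@big_cat_nat _ _ _ Y.+1)//=.
  have half : 0 < X.+1%:R / 2 :> R by rewrite divr_gt0// ltr0n.
  have hY : Y%:R `^ nu <= (X.+1%:R / 2) `^ nu.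
    apply: powR_le; rewrite ?(ltW nu0) ?(ltW half)//.
    by rewrite ler_pdivlMr// -natrM ler_nat.
  have h2 : \sum_(Y.+1 <= q < X.+2) f q <= (X.+1%:R / 2) `^ (- (1 - nu)) * (C * X.+1%:R).
    apply: le_trans (_ : (X.+1%:R / 2) `^ (- (1 - nu)) *
        \sum_(Y.+1 <= q < X.+2) eta q `^ (- sigma) <= _).
      rewrite mulr_sumr big_nat [leRHS]big_nat; apply: ler_sum => q /andP[hq1 hq2].
      rewrite ler_wpM2r ?powR_ge0// !powRN.
      have q0 : (0 < q)%N by exact: leq_trans hq1.
      rewrite lef_pV2 ?posrE ?powR_gt0 ?ltr0n//.
      apply: powR_le; rewrite ?(ltW half)//; first by rewrite subr_ge0.
      by rewrite ler_pdivrMr// -natrM ler_nat (leq_trans Y2)// leq_mul2r hq1.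
    rewrite ler_wpM2l ?powR_ge0//; apply: le_trans (hC X.+1).
    rewrite [leRHS](@big_cat_nat _ _ _ Y.+1)//=; apply: ler_wpDl => //.
    by apply: sumr_ge0 => i _; exact: powR_ge0.
  have e1 : (X.+1%:R / 2) `^ (- (1 - nu)) * (C * X.+1%:R) = 2 * C * (X.+1%:R / 2) `^ nu.
    rewrite opprB powRB; last by rewrite (gt_eqF half) implybT.
    rewrite powRr1 ?(ltW half)//; move: (X.+1%:R) (gt_eqF half) => z z0.
    by field; move: z0; apply: contraFN => /eqP ->; rewrite mul0r.
  have e2 : (X.+1%:R / 2) `^ nu <= X.+1%:R `^ nu * 2^-1 `^ nu by rewrite powRM.
  have e3 : (X.+1%:R / 2) `^ nu <= X.+1%:R `^ nu :> R.
    apply: powR_le; rewrite ?(ltW nu0) ?(ltW half)//.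
    by rewrite ler_pdivrMr// ler_peMr// ler1n.
  have e4 : C' * 2^-1 `^ nu + 2 * C = C'.
    by rewrite /C'; field; rewrite subr_eq0 eq_sym lt_eqF.
  apply: (le_trans (lerD (IH _ YX) h2)); rewrite e1.
  have := ler_wpM2l (ltW C'0) (le_trans hY e2).
  have : 2 * C * (X.+1%:R / 2) `^ nu <= 2 * C * X.+1%:R `^ nu.
    by rewrite ler_wpM2l// mulr_ge0// ltW.
  have : C' * X.+1%:R `^ nu = (C' * 2^-1 `^ nu + 2 * C) * X.+1%:R `^ nu by rewrite e4.
  move: (X.+1%:R `^ nu) => z; lra.
exists C', nu; split => // L E L0.
have Lp : 0 < L%:R :> R by rewrite ltr0n.
have e1 : C' * L%:R * (E%:R / L%:R) `^ nu = L%:R `^ (1 - nu) * (C' * E%:R `^ nu).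
  rewrite powRM ?invr_ge0// -[L%:R^-1]powR_inv1// -powRrM mulN1r powRN powRB.
    by rewrite powRr1//; ring.
  by rewrite (gt_eqF Lp) implybT.
rewrite e1; apply: le_trans (_ : L%:R `^ (1 - nu) * \sum_(1 <= q < E.+1) f q <= _); last first.
  by rewrite ler_wpM2l ?powR_ge0.
rewrite mulr_sumr big_nat [leRHS]big_nat; apply: ler_sum => q /andP[q0 _].
have eq0 := eta_gt0 q0; have qL : 0 < q%:R / L%:R :> R by rewrite divr_gt0// ltr0n.
set A := eta q + _; have A0 : 0 < A by rewrite addr_gt0.
have -> : A ^- m = A `^ (- (1 - nu)) * A `^ (- sigma).
  rewrite -powRD; last by rewrite (gt_eqF A0) implybT.
  by rewrite -powR_invn ?ltW//; congr (_ `^ _); rewrite /sigma /a; ring.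
rewrite /f mulrA; apply: ler_pM; rewrite ?powR_ge0//.
  have -> : L%:R `^ (1 - nu) * q%:R `^ (- (1 - nu)) = (q%:R / L%:R) `^ (- (1 - nu)) :> R.
    rewrite powRM ?invr_ge0// -[L%:R^-1]powR_inv1// -[in RHS]powRrM mulrC; congr (_ * _ `^ _).
    by ring.
  rewrite !powRN lef_pV2 ?posrE ?powR_gt0//.
  apply: powR_le; rewrite ?(ltW A0) ?(ltW qL) ?subr_ge0//.
  by rewrite lerDr ltW.
rewrite !powRN lef_pV2 ?posrE ?powR_gt0//.
apply: powR_le; rewrite ?(ltW A0) ?(ltW eq0) ?(ltW sg0)//.
by rewrite lerDl ltW.
Qed.
End diophantine_sum.

(** * Arcs with two large denominators *)

Section oscillation.
Context {R : realType}.

(** Multiplication by [1 - z ^ D] compares the sum with its translate by [D], which preserves [chi];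
    what is left is two end pieces of length [D] and the differences [g (k + D) - g k]. *)
Lemma periodic_abel (z : R[i]) (chi : pred nat) (g : nat -> R[i]) (D A B : nat) (G V : R) :
  nc z = 1 -> (forall k, chi (k + D)%N = chi k) -> 0 <= G -> 0 <= V ->
  (forall k, (A <= k < B)%N -> nc (g k) <= G) ->
  (forall k, (A <= k)%N -> (k + D < B)%N -> nc (g (k + D)%N - g k) <= V) ->
  nc (\sum_(A <= k < B | chi k) z ^+ k * g k) * nc (1 - z ^+ D)
    <= 2 * D%:R * G + (B - A)%:R * V.
Proof.
move=> z1 chiD G0 V0 hG hV.
have zk k : nc (z ^+ k) = 1 by rewrite ncX z1 expr1n.
have part (a b : nat) (f : nat -> R[i]) (M : R) : 0 <= M ->
    (forall k, (a <= k < b)%N -> nc (f k) <= M) ->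
    nc (\sum_(a <= k < b | chi k) f k) <= (b - a)%:R * M.
  move=> M0 hM; apply: (le_trans (nc_sum _ _ _)).
  rewrite big_mkcond /= mulr_natl -sumr_const_nat big_nat [leRHS]big_nat.
  by apply: ler_sum => k /hM h; case: ifP.
have [BA|BA] := leqP (B - A) D.
  apply: le_trans (_ : ((B - A)%:R * G) * 2 <= _).
    apply: ler_pM; rewrite ?nc_ge0//.
      by apply: part => // k hk; rewrite ncM zk mul1r hG.
    by apply: (le_trans (ncB _ _)); rewrite nc1 zk.
  have : (B - A)%:R * G <= D%:R * G by rewrite ler_wpM2r// ler_nat.
  have : 0 <= (B - A)%:R * V by rewrite mulr_ge0.
  lra.
have AB : (A + D <= B)%N by apply: ltnW; rewrite -ltn_subRL.
have DB : (D <= B)%N by apply: leq_trans AB; exact: leq_addl.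
have ABD : (A <= B - D)%N by rewrite -(leq_add2r D) subnK.
set S := \sum_(A <= k < B | chi k) _.
have e1 : S = \sum_(A <= k < A + D | chi k) z ^+ k * g k +
    \sum_(A <= k < B - D | chi k) z ^+ (k + D) * g (k + D)%N.
  rewrite /S (@big_cat_nat _ _ _ (A + D)%N) ?leq_addr//=; congr (_ + _).
  rewrite -{1}(subnK DB) big_addn addnK.
  by apply: eq_bigl => k; rewrite chiD.
have e2 : z ^+ D * S = \sum_(A <= k < B - D | chi k) z ^+ (k + D) * g k +
    \sum_(B - D <= k < B | chi k) z ^+ (k + D) * g k.
  rewrite /S (@big_cat_nat _ _ _ (B - D)%N) ?leq_subr//= mulrDr !mulr_sumr.
  by congr (_ + _); apply: eq_bigr => k _; rewrite mulrA -exprD addnC.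
rewrite -ncM mulrBr mulr1 [S * _]mulrC e2 {1}e1.
rewrite [X in nc X](_ : _ = (\sum_(A <= k < A + D | chi k) z ^+ k * g k
    - \sum_(B - D <= k < B | chi k) z ^+ (k + D) * g k)
    + \sum_(A <= k < B - D | chi k) z ^+ (k + D) * (g (k + D)%N - g k)); last first.
  under [X in _ = _ + X]eq_bigr do rewrite mulrBr.
  rewrite sumrB; ring.
apply: (le_trans (ncD _ _)); apply: lerD.
  apply: (le_trans (ncB _ _)).
  have : nc (\sum_(A <= k < A + D | chi k) z ^+ k * g k) <= D%:R * G.
    rewrite -{2}(addKn A D); apply: part => // k /andP[h1 h2].
    by rewrite ncM zk mul1r hG// h1 (leq_trans h2).
  have : nc (\sum_(B - D <= k < B | chi k) z ^+ (k + D) * g k) <= D%:R * G.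
    rewrite -{3}(subKn DB); apply: part => // k /andP[h1 h2].
    by rewrite ncM zk mul1r hG// h2 (leq_trans ABD).
  lra.
apply: (@le_trans _ _ ((B - D - A)%:R * V)).
  apply: part => // k /andP[h1 h2]; rewrite ncM zk mul1r hV//.
  by rewrite addnC -ltn_subRL.
by rewrite ler_wpM2r// ler_nat subnAC leq_subr.
Qed.

Lemma ce_eq1 (t : R) : ce t = 1 -> exists k : int, t = k%:~R.
Proof.
move=> h; exists (nz t); have [c c0 hc] := @cos_quadratic R.
have := hc _ (nz_dist t).
have -> : cos (2 * pi * (t - (nz t)%:~R)) = 1.
  have := ceDint t (- nz t); rewrite intrN h /ce /expi => /eqP.
  by rewrite eq_complex => /andP[/eqP].
rewrite subrr pmulr_rle0// => h2.
have : (t - (nz t)%:~R) ^+ 2 == 0 by rewrite eq_le h2 sqr_ge0.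
by rewrite sqrf_eq0 subr_eq0 => /eqP.
Qed.

Lemma expR_lip (a b : R) : 0 <= a -> 0 <= b -> `|expR (- a) - expR (- b)| <= `|a - b|.
Proof.
wlog ab : a b / a <= b => [H a0 b0|a0 b0].
  have [/H->//|/ltW/H h] := leP a b.
  by rewrite distrC [leRHS]distrC h.
rewrite ger0_norm; last by rewrite subr_ge0 ler_expR lerN2.
rewrite distrC ger0_norm ?subr_ge0//.
have -> : - b = - a - (b - a) by ring.
have e1 : expR (- a) <= 1 by rewrite expR_le1 oppr_le0.
have := expR_ge1Dx (- (b - a)); rewrite expRD.
have := expR_ge0 (- a); nra.
Qed.

Lemma Kf_le (c1 mu t : R) (L Y : nat) : 0 < c1 -> (0 < L)%N -> c1 <= mu * L%:R ^+ 2 ->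
  nc (Kf mu Y t) <= gaussC * (1 + (Num.sqrt c1)^-1) * L%:R.
Proof.
move=> c10 L0 h1; have Lp : 0 < L%:R :> R by rewrite ltr0n.
have L1 : 1 <= L%:R :> R by rewrite ler1n.
have mu0 : 0 < mu by rewrite -(@pmulr_lgt0 _ (L%:R ^+ 2)) ?exprn_gt0// (lt_le_trans c10).
apply: (le_trans (nc_sum _ _ _)).
apply: le_trans (_ : \sum_(y <- zr Y) gw mu y <= _).
  by apply: ler_sum => y _; rewrite ncM nc_ce mulr1 nc_real ger0_norm ?gw_ge0.
apply: (le_trans (gw_sum (zr_uniq Y) mu0)).
rewrite -mulrA ler_pM2l ?gaussC_gt0// mulrDl mul1r lerD// mulrC.
exact: invsqrt_le.
Qed.

(** Differentiation brings down a factor [y], which half of the Gaussian absorbs through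
    [w <= expR (w ^ 2 / 2)] for [w = sqrt mu |y|]; this costs one [L], and the remaining Gaussian
    sum another. *)
Lemma Kf_lip (c1 : R) : 0 < c1 -> exists2 C : R, 0 < C &
  forall (L Y : nat) (mu t t' : R), (0 < L)%N -> c1 <= mu * L%:R ^+ 2 ->
  nc (Kf mu Y t - Kf mu Y t') <= C * L%:R ^+ 2 * `|t - t'|.
Proof.
move=> c10; have c20 : 0 < c1 / 2 by rewrite divr_gt0.
have gC := @gaussC_gt0 R.
have s1 : 0 < (Num.sqrt c1)^-1 by rewrite invr_gt0 sqrtr_gt0.
have s2 : 0 < (Num.sqrt (c1 / 2))^-1 by rewrite invr_gt0 sqrtr_gt0.
exists (2 * pi * ((Num.sqrt c1)^-1 * (gaussC * (1 + (Num.sqrt (c1 / 2))^-1)))).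
  by rewrite !mulr_gt0 ?pi_gt0// addr_gt0.
move=> L Y mu t t' L0 h1; have Lp : 0 < L%:R :> R by rewrite ltr0n.
have L1 : 1 <= L%:R :> R by rewrite ler1n.
have mu0 : 0 < mu by rewrite -(@pmulr_lgt0 _ (L%:R ^+ 2)) ?exprn_gt0// (lt_le_trans c10).
have m0 : 0 < Num.sqrt mu by rewrite sqrtr_gt0.
have key (y : int) : gw mu y * `|y%:~R| <= (Num.sqrt mu)^-1 * gw (mu / 2) y.
  rewrite ler_pdivlMl// mulrCA /gw.
  have -> : - (mu * y%:~R ^+ 2) = - (mu / 2 * y%:~R ^+ 2) - (mu / 2 * y%:~R ^+ 2) by lra.
  rewrite expRD; set E := expR _; rewrite -mulrA ler_piMr ?expR_ge0//.
  rewrite mulrC /E expRN ler_pdivrMr ?expR_gt0// mul1r.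
  apply: le_trans (expR_ge1Dx _).
  have -> : mu / 2 * y%:~R ^+ 2 = (Num.sqrt mu * `|y%:~R|) ^+ 2 / 2.
    by rewrite exprMn sqr_sqrtr ?(ltW mu0)// real_normK ?num_real//; ring.
  set w := _ * _; have := sqr_ge0 (w - 1); lra.
rewrite /Kf -sumrB; apply: (le_trans (nc_sum _ _ _)).
apply: le_trans (_ : \sum_(y <- zr Y) (2 * pi * `|t - t'|) * ((Num.sqrt mu)^-1 * gw (mu / 2) y) <= _).
  apply: ler_sum => y _; rewrite -mulrBr ncM nc_real ger0_norm ?gw_ge0//.
  apply: le_trans (_ : gw mu y * (2 * pi * `|y%:~R * t - y%:~R * t'|) <= _).
    by rewrite ler_wpM2l ?gw_ge0 ?ce_lip.
  rewrite -mulrBr normrM [X in X <= _](_ : _ = (2 * pi * `|t - t'|) * (gw mu y * `|y%:~R|)); last by ring.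
  by rewrite ler_wpM2l ?mulr_ge0 ?pi_ge0.
rewrite -mulr_sumr -mulr_sumr.
set S := \sum_(_ <- _) _.
have hS : S <= gaussC * (1 + (Num.sqrt (c1 / 2))^-1) * L%:R.
  have mu20 : 0 < mu / 2 by rewrite divr_gt0.
  apply: (le_trans (gw_sum (zr_uniq Y) mu20)).
  rewrite -mulrA ler_pM2l// mulrDl mul1r lerD// [leRHS]mulrC.
  by apply: invsqrt_le => //; lra.
have S0 : 0 <= S by apply: sumr_ge0 => y _; exact: gw_ge0.
have hm : (Num.sqrt mu)^-1 <= (Num.sqrt c1)^-1 * L%:R by rewrite mulrC; exact: invsqrt_le.
have : (Num.sqrt mu)^-1 * S <= (Num.sqrt c1)^-1 * L%:R * (gaussC * (1 + (Num.sqrt (c1 / 2))^-1) * L%:R).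
  by apply: ler_pM => //; rewrite invr_ge0 sqrtr_ge0.
move=> h; rewrite [leRHS](_ : _ = (2 * pi * `|t - t'|) * ((Num.sqrt c1)^-1 * L%:R * (gaussC * (1 + (Num.sqrt (c1 / 2))^-1) * L%:R))); last by ring.
by rewrite ler_wpM2l ?mulr_ge0 ?pi_ge0.
Qed.

Lemma nc_prod_diff n (u v : 'I_n -> R[i]) (B d : R) : 0 <= B -> 0 <= d ->
  (forall j, nc (u j) <= B) -> (forall j, nc (v j) <= B) ->
  (forall j, nc (u j - v j) <= d) ->
  nc (\prod_j u j - \prod_j v j) <= n%:R * B ^+ n.-1 * d.
Proof.
move=> B0 d0; elim: n u v => [|n IH] u v hu hv hd.
  by rewrite !big_ord0 subrr nc0 !mul0r.
rewrite !big_ord_recl.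
set U := \prod_(i < n) u _; set W := \prod_(i < n) v _.
have -> : u ord0 * U - v ord0 * W = (u ord0 - v ord0) * U + v ord0 * (U - W) by ring.
have hU : nc U <= B ^+ n.
  rewrite nc_prod -[X in B ^+ X](card_ord n) -prodr_const.
  by apply: ler_prod => i _; rewrite nc_ge0 hu.
apply: (le_trans (ncD _ _)); rewrite !ncM.
have h1 : nc (u ord0 - v ord0) * nc U <= d * B ^+ n by apply: ler_pM; rewrite ?nc_ge0.
have h2 : nc (v ord0) * nc (U - W) <= B * (n%:R * B ^+ n.-1 * d).
  by apply: ler_pM; rewrite ?nc_ge0// IH.
apply: (le_trans (lerD h1 h2)) => /=.
case: n {IH u v hu hv hd U W hU h1 h2} => [|n] /=; first by rewrite !mul0r mulr0 addr0; lra.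
by rewrite -[in leRHS]natr1 exprS; lra.
Qed.

End oscillation.

Section compact_part.
Context {R : realType}.

(** The amplitude of an oscillating term, with the phases in [al] removed; it varies slowly with [x]
    and [t]. *)
Definition oscW n (lam mu : 'I_n -> R) (Y : 'I_n -> nat) (x : 'I_n -> int)
    (t : 'I_n -> R) : R[i] :=
  \prod_j ((gw (lam j) (x j))%:C%C * Kf (mu j) (Y j) (t j)).

Definition scaled n (c1 c2 : R) (L : nat) (lam : 'I_n -> R) :=
  forall j, c1 <= lam j * L%:R ^+ 2 <= c2.

Lemma scaled_gt0 n c1 c2 L (lam : 'I_n -> R) j : 0 < c1 -> (0 < L)%N ->
  scaled c1 c2 L lam -> 0 < lam j.
Proof.
move=> c10 L0 /(_ j)/andP[h _].
by rewrite -(@pmulr_lgt0 _ (L%:R ^+ 2)) ?exprn_gt0 ?ltr0n// (lt_le_trans c10).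
Qed.

Lemma gw_le1 (lam : R) x : 0 <= lam -> gw lam x <= 1.
Proof. by move=> l0; rewrite /gw expR_le1 oppr_le0 mulr_ge0// sqr_ge0. Qed.

Lemma osc_factor_le (c1 c2 lam mu t : R) (L Y : nat) x : 0 < c1 -> (0 < L)%N ->
  c1 <= lam * L%:R ^+ 2 -> c1 <= mu * L%:R ^+ 2 ->
  nc ((gw lam x)%:C%C * Kf mu Y t) <= gaussC * (1 + (Num.sqrt c1)^-1) * L%:R.
Proof.
move=> c10 L0 h1 h2.
have lam0 : 0 < lam.
  by rewrite -(@pmulr_lgt0 _ (L%:R ^+ 2)) ?exprn_gt0 ?ltr0n// (lt_le_trans c10).
rewrite ncM nc_real ger0_norm ?gw_ge0// -[leRHS]mul1r.
apply: ler_pM; rewrite ?gw_ge0 ?nc_ge0//; first exact: gw_le1 (ltW lam0).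
exact: Kf_le.
Qed.

Lemma oscW_le n (c1 c2 : R) (L : nat) (lam mu : 'I_n -> R) Y x t : 0 < c1 -> (0 < L)%N ->
  scaled c1 c2 L lam -> scaled c1 c2 L mu ->
  nc (oscW lam mu Y x t) <= (gaussC * (1 + (Num.sqrt c1)^-1) * L%:R) ^+ n.
Proof.
move=> c10 L0 hl hm; rewrite /oscW nc_prod -[X in _ ^+ X](card_ord n) -prodr_const.
apply: ler_prod => j _; rewrite nc_ge0 /=.
by have /andP[h1 _] := hl j; have /andP[h2 _] := hm j; exact: osc_factor_le h2.
Qed.

(** When a denominator moves by [D], each factor changes by [O(D)] and the product, of size [L ^ n],
    by [O(D L ^ (n - 1))]. Summation by parts lives on this gain of one [L] over [oscW_le]. *)
Lemma oscW_lip n (c1 c2 : R) (T e0 : nat) : 0 < c1 -> 0 < c2 ->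
  exists2 C : R, 0 < C & forall (L D : nat) (lam mu : 'I_n -> R) Y x x' t t',
  (0 < L)%N -> scaled c1 c2 L lam -> scaled c1 c2 L mu ->
  (forall j, `|x j| <= 2 * T * L)%N -> (forall j, `|x' j| <= 2 * T * L)%N ->
  (forall j, `|x j - x' j| <= T * D)%N ->
  (forall j, `|t j - t' j| <= (T * D * e0 ^ 2)%:R / L%:R ^+ 2) ->
  nc (oscW lam mu Y x t - oscW lam mu Y x' t') <= C * D%:R * L%:R ^+ n.-1.
Proof.
move=> c10 c20; have [Cl Cl0 hKl] := Kf_lip c10.
have s1 : 0 < (Num.sqrt c1)^-1 by rewrite invr_gt0 sqrtr_gt0.
pose CK := gaussC * (1 + (Num.sqrt c1)^-1) : R.
have CK0 : 0 < CK by rewrite mulr_gt0 ?gaussC_gt0// addr_gt0.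
pose d : R := 4 * T%:R ^+ 2 * c2 * CK + Cl * T%:R * e0%:R ^+ 2.
have d0 : 0 <= d.
  by rewrite addr_ge0// !mulr_ge0// ?sqr_ge0 ?(ltW c20) ?(ltW CK0) ?(ltW Cl0).
exists (n%:R * CK ^+ n.-1 * d + 1).
  by rewrite ltr_wpDl// !mulr_ge0// exprn_ge0// ltW.
move=> L D lam mu Y x x' t t' L0 hl hm hx hx' hxx htt.
have Lp : 0 < L%:R :> R by rewrite ltr0n.
apply: le_trans (_ : n%:R * (CK * L%:R) ^+ n.-1 * (d * D%:R) <= _); last first.
  rewrite exprMn [leRHS](_ : _ = n%:R * (CK ^+ n.-1 * L%:R ^+ n.-1) * (d * D%:R) +
    D%:R * L%:R ^+ n.-1); last by ring.
  by rewrite lerDl mulr_ge0// exprn_ge0.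
apply: nc_prod_diff; rewrite ?mulr_ge0 ?(ltW CK0)// => j.
- by have /andP[h1 _] := hl j; have /andP[h2 _] := hm j; exact: osc_factor_le h2.
- by have /andP[h1 _] := hl j; have /andP[h2 _] := hm j; exact: osc_factor_le h2.
have /andP[h1 h1'] := hl j; have /andP[h2 _] := hm j.
have l0 := scaled_gt0 j c10 L0 hl.
set g := gw _ (x j); set g' := gw _ (x' j).
set k := Kf _ _ (t j); set k' := Kf _ _ (t' j).
have -> : g%:C%C * k - g'%:C%C * k' = (g - g')%:C%C * k + g'%:C%C * (k - k').
  by rewrite rmorphB /=; ring.
apply: (le_trans (ncD _ _)); rewrite !ncM !nc_real (ger0_norm (gw_ge0 _ _)).
have hk : nc k <= CK * L%:R by exact: Kf_le.
have hg' : g' <= 1 by exact: gw_le1 (ltW l0).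
have hkk : nc (k - k') <= Cl * T%:R * e0%:R ^+ 2 * D%:R.
  apply: (le_trans (hKl L (Y j) (mu j) (t j) (t' j) L0 h2)).
  apply: le_trans (_ : Cl * L%:R ^+ 2 * ((T * D * e0 ^ 2)%:R / L%:R ^+ 2) <= _).
    by rewrite ler_wpM2l// mulr_ge0 ?sqr_ge0// ltW.
  by rewrite !natrM le_eqVlt; apply/orP; left; apply/eqP; field; rewrite gt_eqF.
have hgg : `|g - g'| <= 4 * T%:R ^+ 2 * c2 * D%:R / L%:R.
  have nn z : 0 <= lam j * z ^+ 2 by rewrite pmulr_rge0// sqr_ge0.
  apply: (le_trans (expR_lip (nn _) (nn _))).
  rewrite -mulrBr normrM (gtr0_norm l0) subr_sqr normrM.
  have n1 : `|(x j)%:~R - (x' j)%:~R| <= (T * D)%:R :> R.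
    by rewrite -intrB -intr_norm -natr_absz ler_nat.
  have n2 : `|(x j)%:~R + (x' j)%:~R| <= (4 * T * L)%:R :> R.
    apply: le_trans (ler_normD _ _) _; rewrite -!intr_norm -!natr_absz -natrD ler_nat.
    by apply: leq_trans (leq_add (hx j) (hx' j)) _; rewrite -!mulnA -mulnDl.
  apply: le_trans (_ : (c2 / L%:R ^+ 2) * ((T * D)%:R * (4 * T * L)%:R) <= _).
    apply: ler_pM; rewrite ?(ltW l0) ?mulr_ge0//; last exact: ler_pM.
    by rewrite ler_pdivlMr ?exprn_gt0.
  by rewrite !natrM le_eqVlt; apply/orP; left; apply/eqP; field; rewrite gt_eqF.
rewrite [d * _]mulrDl; apply: lerD.
  apply: le_trans (ler_pM _ _ hgg hk) _; rewrite ?nc_ge0//.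
  by rewrite le_eqVlt; apply/orP; left; apply/eqP; field; rewrite gt_eqF.
apply: le_trans hkk; rewrite ler_piMl ?nc_ge0//.
Qed.

Lemma sum_ord_nat (V : nmodType) (N A B : nat) (chi : pred nat) (F : nat -> V) :
  (B <= N)%N ->
  \sum_(q < N | chi q && (A <= q < B)%N) F q = \sum_(A <= q < B | chi q) F q.
Proof.
move=> BN; rewrite -(big_mkord (fun q => chi q && (A <= q < B)%N) F).
have [AB|/ltnW BA] := leqP A B; last first.
  rewrite [RHS]big_geq// big1// => q /andP[_ /andP[h1 h2]].
  by have := leq_trans h2 BA; rewrite ltnNge h1.
rewrite (@big_cat_nat _ _ _ A) ?(leq_trans AB)//=.
rewrite big_nat_cond big1 ?add0r; last first.
  by move=> q /andP[/andP[_ h1] /andP[_ /andP[h2 _]]]; move: h1; rewrite ltnNge h2.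
rewrite (@big_cat_nat _ _ _ B)//= [X in _ + X]big_nat_cond [X in _ + X]big1 ?addr0; last first.
  by move=> q /andP[/andP[h1 _] /andP[_ /andP[_ h2]]]; move: h2; rewrite ltnNge h1.
rewrite big_nat_cond [RHS]big_nat_cond; apply: eq_bigl => q.
by case: (chi q); case: (A <= q)%N; case: (q < B)%N.
Qed.

(** For fixed [q] and grid index [i] the admissible [q'] fill an interval, because [i < P / (q q')]
    reads [(i + 1) q q' <= P]. As both denominators exceed [L / e0], an arc has at most [I] grid
    points. *)
Lemma triple_sum_bound (f : nat -> nat -> nat -> R[i]) (chi : nat -> pred nat)
    (L P e0 : nat) (M : R) (E := (L %/ e0)%N) (I := (P * e0 ^ 2 %/ L ^ 2)%N) :
  (0 < L)%N -> (0 < e0)%N -> 0 <= M ->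
  (forall q i A B, (E < q <= L)%N -> (i < I)%N -> (E < A)%N -> (B <= L.+1)%N ->
     (forall q', (A <= q' < B)%N -> (i.+1 * (q * q') <= P)%N) ->
     nc (\sum_(A <= q' < B | chi q q') f q q' i) <= M) ->
  nc (\sum_(q < L.+1) \sum_(q' < L.+1 | [&& E < q, E < q', L < q + q' & chi q q']%N)
     \sum_(i < P %/ (q * q')) f q q' i) <= L.+1%:R * I%:R * M.
Proof.
move=> L0 e00 M0 hf.
have I0 : 0 <= I%:R * M by rewrite mulr_ge0.
apply: (le_trans (nc_sum _ _ _)).
apply: le_trans (_ : \sum_(q < L.+1) I%:R * M <= _); last first.
  by rewrite sumr_const card_ord -[leLHS]mulr_natl mulrA.
apply: ler_sum => q _; have qL : (q <= L)%N by rewrite -ltnS.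
have [Eq|Eq] := ltnP E q; last by rewrite big1 ?nc0// => q' /and4P[]; rewrite ltnNge Eq.
have small k : (E < k)%N -> (L <= k * e0)%N.
  by move=> h; apply: ltnW; rewrite -ltn_divLR.
rewrite (eq_bigr (fun q' : 'I_L.+1 => \sum_(i < I | (i < P %/ (q * q'))%N) f q q' i)); last first.
  move=> q' /and4P[_ Eq' _ _]; apply: (big_ord_widen I (fun i => f q q' i)).
  apply: leq_trans (_ : P * e0 ^ 2 %/ (q * q' * e0 ^ 2) <= _)%N.
    by rewrite divnMr ?expn_gt0 ?e00.
  apply: leq_div2l; first by rewrite expn_gt0 L0.
  have -> : (q * q' * e0 ^ 2 = (q * e0) * (q' * e0))%N by rewrite -mulnn mulnACA.
  by rewrite -mulnn leq_mul ?small.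
rewrite (exchange_big_dep xpredT)//=.
apply: (le_trans (nc_sum _ _ _)).
apply: le_trans (_ : \sum_(i < I) M <= _); last first.
  by rewrite sumr_const card_ord -[leLHS]mulr_natl.
apply: ler_sum => i _.
have q0 : (0 < q)%N by apply: leq_ltn_trans Eq.
pose A := maxn E.+1 (L.+1 - q); pose B := (minn L (P %/ (i.+1 * q))).+1.
rewrite (eq_bigl (fun q' : 'I_L.+1 => chi q q' && (A <= q' < B)%N)); last first.
  move=> q'; rewrite /A /B ltnS leq_min geq_max.
  have -> : (q' <= L)%N by rewrite -ltnS.
  have [Eq'|] := ltnP E q' => /=; last by rewrite andbF.
  rewrite !leq_divRL ?muln_gt0 ?q0 ?(leq_ltn_trans _ Eq')//= leq_subLR.
  rewrite [(q' * _)%N]mulnC -mulnA.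
  by case: (chi q q'); case: (L < q + q')%N; rewrite ?andbT ?andbF.
rewrite (@sum_ord_nat _ L.+1 A B (chi q) (fun q' => f q q' i)); last first.
  by rewrite ltnS geq_minl.
apply: hf; rewrite ?Eq ?qL ?ltn_ord//; first by rewrite leq_max ltnSn.
  by rewrite ltnS geq_minl.
move=> q' /andP[_]; rewrite /B ltnS leq_min leq_divRL ?muln_gt0 ?q0// => /andP[_].
by rewrite [(q' * _)%N]mulnC -mulnA.
Qed.

End compact_part.

Section compact_oscillation.
Context {R : realType}.

(** When one denominator [k] moves, [x] and [t] run through arithmetic progressions;
    [s L ^ 2 <= e0 ^ 2] makes the steps of [t] short enough for [oscW_lip]. The gain is a factor [L]
    over the trivial bound [L ^ (n + 1)]. *)
Lemma osc_inner n (c1 c2 : R) (T e0 : nat) : (0 < n)%N -> 0 < c1 -> 0 < c2 ->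
  exists2 C : R, 0 < C & forall (L D A B : nat) (lam mu : 'I_n -> R) Y
    (c d : 'I_n -> int) (g : 'I_n -> R) (s : R) (chi : pred nat) (z w : R[i]),
  (0 < L)%N -> (0 < D)%N -> (B <= L.+1)%N ->
  scaled c1 c2 L lam -> scaled c1 c2 L mu ->
  (forall k j, (A <= k < B)%N -> (`|(c j + d j * k%:Z)%R| <= 2 * T * L)%N) ->
  (forall j, `|d j| <= T)%N ->
  0 <= s -> s * L%:R ^+ 2 <= (e0 ^ 2)%:R ->
  nc z = 1 -> nc w = 1 -> (forall k, chi (k + D)%N = chi k) ->
  nc (\sum_(A <= k < B | chi k) w * z ^+ k *
     oscW lam mu Y (fun j => c j + d j * k%:Z) (fun j => g j + (d j)%:~R * (k%:R * s)))
    * nc (1 - z ^+ D) <= C * D%:R * L%:R ^+ n.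
Proof.
move=> n0 c10 c20; have [C C0 hC] := oscW_lip n T e0 c10 c20.
have s1 : 0 < (Num.sqrt c1)^-1 by rewrite invr_gt0 sqrtr_gt0.
pose CK := gaussC * (1 + (Num.sqrt c1)^-1) : R.
have CK0 : 0 < CK by rewrite mulr_gt0 ?gaussC_gt0// addr_gt0.
exists (2 * CK ^+ n + 2 * C); first by rewrite addr_gt0// mulr_gt0// exprn_gt0.
move=> L D A B lam mu Y c d g s chi z w L0 D0 BL hl hm hx hd s0 hs z1 w1 chiD.
have Lp : 0 < L%:R :> R by rewrite ltr0n.
under eq_bigr do rewrite -mulrA.
rewrite -mulr_sumr ncM w1 mul1r.
apply: le_trans (periodic_abel (G := (CK * L%:R) ^+ n) (V := C * D%:R * L%:R ^+ n.-1)
   z1 chiD _ _ _ _) _.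
- by rewrite exprn_ge0// mulr_ge0// ltW.
- by rewrite !mulr_ge0 ?exprn_ge0// ltW.
- by move=> k _; exact: oscW_le.
- move=> k hk1 hk2; apply: hC => // j.
  + by apply: hx; rewrite hk2 (leq_trans hk1)// leq_addr.
  + by apply: hx; rewrite hk1 (leq_ltn_trans _ hk2)// leq_addr.
  + rewrite (_ : _ - _ = d j * D%:Z); last by rewrite PoszD; ring.
    by rewrite abszM leq_mul.
  + rewrite (_ : _ - _ = (d j)%:~R * D%:R * s); last by rewrite natrD; ring.
    rewrite ler_pdivlMr ?exprn_gt0// !normrM (ger0_norm s0) normr_nat.
    rewrite [leRHS]natrM -[leLHS]mulrA; apply: ler_pM => //.
    * by rewrite mulr_ge0// sqr_ge0.
    * rewrite natrM; apply: ler_pM => //.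
      by rewrite -intr_norm -natr_absz ler_nat.
have eL : L%:R ^+ n = L%:R * L%:R ^+ n.-1 :> R by rewrite -exprS prednK.
have e1 : (B - A)%:R <= 2 * L%:R :> R.
  rewrite -natrM ler_nat; apply: leq_trans (leq_subr _ _) _; apply: leq_trans BL _.
  by rewrite mul2n -addnn -addn1 leq_add2l.
have e2 : (B - A)%:R * (C * D%:R * L%:R ^+ n.-1) <= 2 * L%:R * (C * D%:R * L%:R ^+ n.-1).
  by rewrite ler_wpM2r// !mulr_ge0 ?exprn_ge0// ltW.
apply: (le_trans (lerD (lexx _) e2)).
rewrite exprMn le_eqVlt; apply/orP; left; apply/eqP; rewrite eL; ring.
Qed.

Lemma count_multiples L d : (0 < d)%N ->
  (\sum_(q < L.+1) ((0 < q)%N && (d %| q)) = L %/ d)%N.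
Proof.
move=> d0; elim: L => [|L IH]; first by rewrite big_ord1 div0n.
by rewrite big_ord_recr /= IH divnS// addnC.
Qed.

(** Telescoping, from [1 / d ^ 2 <= 1 / (d - 1) - 1 / d]. *)
Lemma sum_inv_squares (D L : nat) : (0 < D)%N ->
  \sum_(d < L.+1 | (D < d)%N) (d%:R ^+ 2)^-1 <= D%:R^-1 :> R.
Proof.
move=> D0; have Dp : 0 < D%:R :> R by rewrite ltr0n.
suff : \sum_(d < L.+1 | (D < d)%N) (d%:R ^+ 2)^-1 <=
    (if (L <= D)%N then 0 else D%:R^-1 - L%:R^-1) :> R.
  move=> h; apply: (le_trans h); case: ifP => _; first by rewrite invr_ge0.
  by rewrite gerBl invr_ge0.
elim: L => [|L IH]; first by rewrite big_mkcond big_ord1.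
rewrite big_mkcond big_ord_recr -big_mkcond /=; move: IH.
have [LD|LD] := leqP L D => IH.
  have [DL|DL] := ltnP D L.+1; last by rewrite addr0.
  have eLD : L = D by apply/eqP; rewrite eqn_leq LD.
  rewrite eLD in IH *.
  rewrite -[leRHS]add0r; apply: lerD; first by rewrite (le_trans IH).
  have e : D.+1%:R = D%:R + 1 :> R by rewrite natr1.
  rewrite e -subr_ge0 (_ : _ - _ = (D%:R * (D%:R + 1) ^+ 2)^-1); last first.
    by field; rewrite !gt_eqF// addr_gt0.
  by rewrite invr_ge0 mulr_ge0// sqr_ge0.
have -> : (L.+1 <= D)%N = false by apply/negbTE; rewrite -ltnNge leqW.
have -> : (D < L.+1)%N by exact: leqW.
apply: (le_trans (lerD IH (lexx _))).
have Lp : 0 < L%:R :> R by rewrite ltr0n (leq_trans _ LD).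
have e : L.+1%:R = L%:R + 1 :> R by rewrite natr1.
rewrite e -subr_ge0 (_ : _ - _ = (L%:R * (L%:R + 1) ^+ 2)^-1); last first.
  by field; rewrite !gt_eqF// addr_gt0.
by rewrite invr_ge0 mulr_ge0// sqr_ge0.
Qed.

(* A periodic substitute for coprimality, to which summation by parts applies; [bad_pairs]
   counts the error. *)
Definition no_small_div (D q q' : nat) := all (fun d => ~~ ((d %| q) && (d %| q'))%N) (iota 2 D).

Lemma coprime_no_small_div D q q' : coprime q q' -> no_small_div D q q'.
Proof.
move=> cq; apply/allP => d; rewrite mem_iota => /andP[d2 _]; apply/negP => /andP[h1 h2].
have : (d %| gcdn q q')%N by rewrite dvdn_gcd h1.
by rewrite (eqP cq) dvdn1 => /eqP d1; rewrite d1 in d2.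
Qed.

Lemma no_small_div_sym D q q' : no_small_div D q q' = no_small_div D q' q.
Proof. by apply: eq_all => d; rewrite andbC. Qed.

Lemma no_small_div_period D q q' : no_small_div D q (q' + (D.+1)`!) = no_small_div D q q'.
Proof.
apply: eq_in_all => d; rewrite mem_iota => /andP[d2 dD].
by rewrite dvdn_addl// dvdn_fact// (leq_trans _ d2) /=.
Qed.

(** Such a pair has a common divisor [d > D + 1], and at most [(L / d)^2] pairs share a given
    [d]. *)
Lemma bad_pairs (D L E : nat) :
  \sum_(q < L.+1) \sum_(q' < L.+1 |
     [&& (E < q)%N, (E < q')%N, no_small_div D q q' & ~~ coprime q q']) 1 <=
  L%:R ^+ 2 / D.+1%:R :> R.
Proof.
pose m (d q : nat) := ((0 < q) && (d %| q))%N%:R : R.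
have m0 d q : 0 <= m d q by rewrite /m.
apply: le_trans (_ : \sum_(q < L.+1) \sum_(q' < L.+1) \sum_(d < L.+1 | (D.+1 < d)%N) m d q * m d q' <= _).
  apply: ler_sum => q _; rewrite big_mkcond; apply: ler_sum => q' _.
  case: ifP => [/and4P[Eq Eq' ns nc']|_]; last first.
    by apply: sumr_ge0 => d _; rewrite mulr_ge0.
  have q0 : (0 < q)%N by apply: leq_ltn_trans Eq.
  have q'0 : (0 < q')%N by apply: leq_ltn_trans Eq'.
  pose d := gcdn q q'.
  have dL : (d < L.+1)%N by apply: leq_ltn_trans (ltn_ord q); apply: dvdn_leq => //; exact: dvdn_gcdl.
  have dD : (D.+1 < d)%N.
    rewrite ltnNge; apply/negP => dD; move/allP: ns => /(_ d).
    have d0 : (0 < d)%N by rewrite gcdn_gt0 q0.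
    have d1 : (1 < d)%N by rewrite ltn_neqAle d0 eq_sym andbT.
    by rewrite mem_iota d1 !addSn add0n ltnS dD dvdn_gcdl dvdn_gcdr => /(_ isT).
  rewrite (bigD1 (Ordinal dL))//= /m q0 q'0 dvdn_gcdl dvdn_gcdr mulr1 lerDl.
  by apply: sumr_ge0 => i _; rewrite mulr_ge0.
under eq_bigr => q _ do rewrite exchange_big /=.
rewrite exchange_big /=.
have msum d : (D.+1 < d)%N -> \sum_(q < L.+1) m d q <= L%:R / d%:R.
  move=> dD; have d0 : (0 < d)%N by apply: leq_ltn_trans dD.
  rewrite /m -natr_sum count_multiples// ler_pdivlMr ?ltr0n// -natrM ler_nat.
  exact: leq_trunc_div.
apply: le_trans (_ : \sum_(d < L.+1 | (D.+1 < d)%N) L%:R ^+ 2 * (d%:R ^+ 2)^-1 <= _); last first.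
  by rewrite -mulr_sumr ler_wpM2l ?sqr_ge0// sum_inv_squares.
apply: ler_sum => d dD.
under eq_bigr do rewrite -mulr_sumr.
rewrite -mulr_suml -exprVn -exprMn expr2.
by apply: ler_pM; rewrite ?sumr_ge0// ?msum.
Qed.

End compact_oscillation.

Section oscillating_terms.
Context {R : realType}.

(** The term with coordinates [l], [l'] in the expanded product of the [Zbox], at the [i]-th grid
    point of an arc; there [u q - h = q i / P] and [u q' - h' = q' i / P - 1 / q]. *)
Definition oscF n (al lam mu : 'I_n -> R) (Y : 'I_n -> nat) (l l' : 'I_n -> int) (P : nat)
    (q q' i : nat) : R[i] :=
  (\prod_j ce ((l j * q%:Z + l' j * q'%:Z)%:~R * al j)) *
  oscW lam mu Y (fun j => l j * q%:Z + l' j * q'%:Z)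
    (fun j => (l j)%:~R * (q%:R * (i%:R / P%:R)) +
              (l' j)%:~R * (q'%:R * (i%:R / P%:R) - q%:R^-1)).

Definition no_relation n (al : 'I_n -> R) := forall (c : 'I_n -> int) (d : int),
  \sum_j (c j)%:~R * al j = d%:~R -> forall j, c j = 0.

Lemma oscF_phase n (al : 'I_n -> R) (l l' : 'I_n -> int) q q' :
  \prod_j ce ((l j * q%:Z + l' j * q'%:Z)%:~R * al j) =
  ce (\sum_j (l j)%:~R * al j) ^+ q * ce (\sum_j (l' j)%:~R * al j) ^+ q'.
Proof.
rewrite -ce_sum -!ceMn -ceD !mulr_sumr -big_split /=; congr ce.
by apply: eq_bigr => j _; rewrite intrD !intrM -!pmulrn; ring.
Qed.

Lemma small_index (P L e0 i : nat) : (0 < P)%N -> (0 < L)%N ->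
  (i < P * e0 ^ 2 %/ L ^ 2)%N -> i%:R / P%:R * L%:R ^+ 2 <= (e0 ^ 2)%:R :> R.
Proof.
move=> P0 L0 hi; have Pp : 0 < P%:R :> R by rewrite ltr0n.
rewrite mulrAC ler_pdivrMr// -natrX -!natrM ler_nat [leqRHS]mulnC.
by apply: leq_trans (leq_trunc_div (P * e0 ^ 2) (L ^ 2)); rewrite leq_mul2r ltnW ?orbT.
Qed.

Lemma nc_1Bce_gt0 n (al : 'I_n -> R) (c : 'I_n -> int) (D : nat) :
  no_relation al -> (exists j, c j != 0) -> (0 < D)%N ->
  0 < nc (1 - ce (\sum_j (c j)%:~R * al j) ^+ D).
Proof.
move=> hal [j cj] D0; rewrite lt0r nc_ge0 andbT nc_eq0 subr_eq0 -ceMn.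
apply/eqP => /esym/ce_eq1[k hk].
have := hal (fun j => D%:Z * c j) k; move=> /(_ _ j) h.
have /eqP : D%:Z * c j = 0.
  apply: h; rewrite -hk mulr_sumr; apply: eq_bigr => i _.
  by rewrite intrM mulrA.
by rewrite mulf_eq0 (negbTE cj) orbF; case: D D0 {hk h}.
Qed.

Lemma index_count_le (X M : R) (L P e0 : nat) : (0 < L)%N -> 0 <= M ->
  X <= L.+1%:R * (P * e0 ^ 2 %/ L ^ 2)%:R * M -> X * L%:R <= 2 * e0%:R ^+ 2 * P%:R * M.
Proof.
move=> L0 M0 hX; have Lp : 0 < L%:R :> R by rewrite ltr0n.
set I := (P * _ %/ _)%N in hX.
have hI : I%:R * L%:R ^+ 2 <= P%:R * e0%:R ^+ 2 :> R.
  by rewrite -!natrX -!natrM ler_nat; exact: leq_trunc_div.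
have hL : L.+1%:R <= 2 * L%:R :> R.
  by rewrite -natrM ler_nat mul2n -addnn -addn1 leq_add2l.
have hh : L.+1%:R * I%:R * L%:R <= 2 * e0%:R ^+ 2 * P%:R :> R.
  apply: le_trans (_ : (2 * L%:R) * I%:R * L%:R <= _); last by lra.
  by rewrite ler_pM2r// ler_wpM2r.
apply: le_trans (_ : (L.+1%:R * I%:R * M) * L%:R <= _); first by rewrite ler_pM2r.
by rewrite mulrAC ler_wpM2r.
Qed.

(** If [l'] is not 0, the inner sum runs over [q'] with phase [z ^ q'], and [z ^ Pi] differs from 1
    by independence. If [l' = 0], it runs over [q] instead: then [1 / q], which is not linear in
    [q], has dropped out of the arguments of the theta sums. *)
Lemma compact_osc_chi n (al : 'I_n -> R) (c1 c2 : R) (T e0 D : nat) (l l' : 'I_n -> int) :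
  (0 < n)%N -> (0 < e0)%N -> 0 < c1 -> 0 < c2 -> no_relation al ->
  (forall j, `|l j| <= T)%N -> (forall j, `|l' j| <= T)%N ->
  (exists j, (l j != 0) || (l' j != 0)) ->
  exists2 C : R, 0 < C & forall (L P : nat) (lam mu : 'I_n -> R) Y,
  (0 < L)%N -> (0 < P)%N -> scaled c1 c2 L lam -> scaled c1 c2 L mu ->
  nc (\sum_(q < L.+1) \sum_(q' < L.+1 | [&& L %/ e0 < q, L %/ e0 < q', L < q + q' & no_small_div D q q']%N)
     \sum_(i < P %/ (q * q')) oscF al lam mu Y l l' P q q' i) * L%:R <= C * P%:R * L%:R ^+ n.
Proof.
move=> n0 e00 c10 c20 hal hl hl' ex.
have [C C0 hC] := osc_inner T e0 n0 c10 c20.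
(* A period of [no_small_div D q], which tests the divisors from 2 to [D + 1]. *)
pose Pi := (D.+1)`!.
have Pi0 : (0 < Pi)%N by exact: fact_gt0.
have wide (a b : int) (q q' L : nat) : (`|a| <= T)%N -> (`|b| <= T)%N ->
    (q <= L)%N -> (q' <= L)%N -> (`|(a * q%:Z + b * q'%:Z)%R| <= 2 * T * L)%N.
  move=> ha hb hq hq'; apply: leq_trans (_ : `|a| * q + `|b| * q' <= _)%N.
    rewrite -[X in (_ * X + _)%N]/(`|q%:Z|%N) -[X in (_ + _ * X)%N]/(`|q'%:Z|%N) -!abszM.
    by move: (a * q%:Z) (b * q'%:Z) => z z'; clear; lia.
  by rewrite -mulnA mul2n -addnn; apply: leq_add; apply: leq_mul.
have [hl'0|hl'0] := pselect (exists j, l' j != 0); last first.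
- have {}hl'0 j : l' j = 0 by apply/eqP/negPn/negP => h; apply: hl'0; exists j.
  have exl : exists j, l j != 0 by case: ex => j; rewrite hl'0 eqxx orbF; exists j.
  set z := ce (\sum_j (l j)%:~R * al j).
  have dz : 0 < nc (1 - z ^+ Pi) by exact: nc_1Bce_gt0.
  exists (2 * e0%:R ^+ 2 * (C * Pi%:R / nc (1 - z ^+ Pi))).
    by rewrite !mulr_gt0 ?exprn_gt0 ?invr_gt0 ?ltr0n.
  move=> L P lam mu Y L0 P0 sl sm.
  have Lp : 0 < L%:R :> R by rewrite ltr0n.
  rewrite (exchange_big_dep xpredT)//=.
  rewrite (eq_bigr (fun q' : 'I_L.+1 => \sum_(q < L.+1 | [&& L %/ e0 < q', L %/ e0 < q, L < q' + q & no_small_div D q' q]%N)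
     \sum_(i < P %/ (q' * q)) oscF al lam mu Y l l' P q q' i)); last first.
    move=> q' _; apply: eq_big => [q|q _]; last by rewrite mulnC.
    by rewrite addnC no_small_div_sym; case: (_ < _)%N; case: (_ < _)%N.
  set X := nc _; pose M := C * Pi%:R * L%:R ^+ n / nc (1 - z ^+ Pi).
  have M0 : 0 <= M by rewrite divr_ge0 ?nc_ge0// !mulr_ge0 ?exprn_ge0// ltW.
  have hX : X <= L.+1%:R * (P * e0 ^ 2 %/ L ^ 2)%:R * M.
    apply: (@triple_sum_bound R (fun q' q i => oscF al lam mu Y l l' P q q' i)
     (fun q' q => no_small_div D q' q)) => //.
    move=> q' i A B q'L iI EA BL hB; rewrite /M ler_pdivlMr//.
    have := hC L Pi A B lam mu Y (fun=> 0) l (fun=> 0) (i%:R / P%:R)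
      (no_small_div D q') z 1 L0 Pi0 BL sl sm.
    rewrite (_ : \sum_(A <= q < B | _) _ =
       \sum_(A <= q < B | no_small_div D q' q) oscF al lam mu Y l l' P q q' i); last first.
      apply: eq_bigr => q _; rewrite /oscF oscF_phase -/z mul1r.
      rewrite (_ : ce (\sum_j (l' j)%:~R * al j) = 1) ?expr1n ?mulr1; last first.
        by rewrite big1 ?ce0// => j _; rewrite hl'0 mul0r.
      congr (_ * _); rewrite /oscW; apply: eq_bigr => j _.
      by rewrite hl'0 !mul0r !addr0 !add0r.
    apply => //.
    - move=> k j /andP[_ kB]; rewrite add0r -[X in `|X|%N]addr0 -(mul0r (0%N%:Z)).
      by apply: wide => //; rewrite -ltnS (leq_trans kB).
    - exact: small_index.
    - exact: nc_ce.
    - exact: nc1.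
    - by move=> k; exact: no_small_div_period.
  rewrite [leRHS](_ : _ = 2 * e0%:R ^+ 2 * P%:R * M); last by rewrite /M; ring.
  exact: index_count_le.
- set z := ce (\sum_j (l' j)%:~R * al j).
  have dz : 0 < nc (1 - z ^+ Pi) by exact: nc_1Bce_gt0.
  exists (2 * e0%:R ^+ 2 * (C * Pi%:R / nc (1 - z ^+ Pi))).
    by rewrite !mulr_gt0 ?exprn_gt0 ?invr_gt0 ?ltr0n.
  move=> L P lam mu Y L0 P0 sl sm.
  have Lp : 0 < L%:R :> R by rewrite ltr0n.
  set X := nc _; pose M := C * Pi%:R * L%:R ^+ n / nc (1 - z ^+ Pi).
  have M0 : 0 <= M by rewrite divr_ge0 ?nc_ge0// !mulr_ge0 ?exprn_ge0// ltW.
  have hX : X <= L.+1%:R * (P * e0 ^ 2 %/ L ^ 2)%:R * M.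
    apply: (@triple_sum_bound R (fun q q' i => oscF al lam mu Y l l' P q q' i)
     (fun q q' => no_small_div D q q')) => //.
    move=> q i A B /andP[_ qL] iI EA BL hB; rewrite /M ler_pdivlMr//.
    have := hC L Pi A B lam mu Y (fun j => l j * q%:Z) l'
      (fun j => (l j)%:~R * (q%:R * (i%:R / P%:R)) - (l' j)%:~R * q%:R^-1) (i%:R / P%:R)
      (no_small_div D q) z (ce (\sum_j (l j)%:~R * al j) ^+ q) L0 Pi0 BL sl sm.
    rewrite (_ : \sum_(A <= q' < B | _) _ =
       \sum_(A <= q' < B | no_small_div D q q') oscF al lam mu Y l l' P q q' i); last first.
      apply: eq_bigr => q' _; rewrite /oscF oscF_phase -/z.
      by congr (_ * _); rewrite /oscW; apply: eq_bigr => j _; congr (_ * Kf _ _ _); ring.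
    apply => //.
    - by move=> k j /andP[_ kB]; apply: wide => //; rewrite -ltnS (leq_trans kB).
    - exact: small_index.
    - exact: nc_ce.
    - by rewrite ncX nc_ce expr1n.
    - by move=> k; exact: no_small_div_period.
  rewrite [leRHS](_ : _ = 2 * e0%:R ^+ 2 * P%:R * M); last by rewrite /M; ring.
  exact: index_count_le.
Qed.

End oscillating_terms.

Section coprime_oscillation.
Context {R : realType}.

Lemma nc_oscF n (al lam mu : 'I_n -> R) Y l l' (c1 c2 : R) L P q q' i : 0 < c1 -> (0 < L)%N ->
  scaled c1 c2 L lam -> scaled c1 c2 L mu ->
  nc (oscF al lam mu Y l l' P q q' i) <= (gaussC * (1 + (Num.sqrt c1)^-1) * L%:R) ^+ n.
Proof.
move=> c10 L0 sl sm; rewrite /oscF ncM nc_prod big1 ?mul1r; last by move=> j _; exact: nc_ce.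
exact: oscW_le sl sm.
Qed.

Lemma natr_unbounded (x : R) : exists k : nat, x < k.+1%:R.
Proof.
exists (Num.truncn x); have [x0|x0] := leP 0 x.
  by have /andP[] := truncn_itv x0.
by apply: lt_trans x0 _; rewrite ltr0n.
Qed.

Lemma compact_cell_count (P L e0 q q' : nat) : (0 < L)%N -> (0 < e0)%N ->
  (L %/ e0 < q)%N -> (L %/ e0 < q')%N ->
  (P %/ (q * q'))%:R <= P%:R * e0%:R ^+ 2 / L%:R ^+ 2 :> R.
Proof.
move=> L0 e00 Eq Eq'; rewrite ler_pdivlMr ?exprn_gt0 ?ltr0n// -!natrX -!natrM ler_nat.
have small k : (L %/ e0 < k)%N -> (L <= k * e0)%N by move=> h; apply: ltnW; rewrite -ltn_divLR.
apply: leq_trans (_ : P %/ (q * q') * (q * q' * e0 ^ 2) <= _)%N.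
  rewrite leq_mul2l; apply/orP; right.
  have -> : (q * q' * e0 ^ 2 = (q * e0) * (q' * e0))%N by rewrite -mulnn mulnACA.
  by rewrite -mulnn leq_mul ?small.
by rewrite mulnA leq_mul2r leq_trunc_div orbT.
Qed.

(** [D] is chosen before [L], so that the non-coprime pairs without a small common divisor cost at
    most [eps / 2]; a large [L] then beats the constant of [compact_osc_chi], which depends on
    [D]. *)
Lemma compact_osc n (al : 'I_n -> R) (c1 c2 eps : R) (T e0 : nat) (l l' : 'I_n -> int) :
  (0 < n)%N -> (0 < e0)%N -> 0 < c1 -> 0 < c2 -> no_relation al ->
  (forall j, `|l j| <= T)%N -> (forall j, `|l' j| <= T)%N ->
  (exists j, (l j != 0) || (l' j != 0)) -> 0 < eps ->
  exists L0 : nat, forall (L P : nat) (lam mu : 'I_n -> R) Y,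
  (L0 < L)%N -> (0 < P)%N -> scaled c1 c2 L lam -> scaled c1 c2 L mu ->
  nc (\sum_(q < L.+1) \sum_(q' < L.+1 | [&& L %/ e0 < q, L %/ e0 < q', L < q + q' & coprime q q']%N)
     \sum_(i < P %/ (q * q')) oscF al lam mu Y l l' P q q' i) <= eps * P%:R * L%:R ^+ n.
Proof.
move=> n0 e00 c10 c20 hal hl hl' ex eps0.
pose CK := gaussC * (1 + (Num.sqrt c1)^-1) : R.
have CK0 : 0 < CK by rewrite mulr_gt0 ?gaussC_gt0// addr_gt0// invr_gt0 sqrtr_gt0.
have [D hD] := natr_unbounded (2 * CK ^+ n * e0%:R ^+ 2 / eps).
have [C C0 hC] := compact_osc_chi D n0 e00 c10 c20 hal hl hl' ex.
have [L0 hL0] := natr_unbounded (2 * C / eps).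
exists L0 => L P lam mu Y LL P0 sl sm.
have L_gt0 : (0 < L)%N by exact: leq_ltn_trans LL.
have Lp : 0 < L%:R :> R by rewrite ltr0n.
have := hC L P lam mu Y L_gt0 P0 sl sm.
set S := nc _ => hS.
pose bad (q q' : nat) := [&& L %/ e0 < q, L %/ e0 < q', no_small_div D q q' & ~~ coprime q q']%N.
have hcop : \sum_(q < L.+1) \sum_(q' < L.+1 | [&& L %/ e0 < q, L %/ e0 < q', L < q + q' & coprime q q']%N)
     \sum_(i < P %/ (q * q')) oscF al lam mu Y l l' P q q' i =
   \sum_(q < L.+1) \sum_(q' < L.+1 | [&& L %/ e0 < q, L %/ e0 < q', L < q + q' & no_small_div D q q']%N)
     \sum_(i < P %/ (q * q')) oscF al lam mu Y l l' P q q' i -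
   \sum_(q < L.+1) \sum_(q' < L.+1 | bad q q' && (L < q + q')%N)
     \sum_(i < P %/ (q * q')) oscF al lam mu Y l l' P q q' i.
  apply/eqP; rewrite eq_sym subr_eq -big_split /=; apply/eqP; apply: eq_bigr => q _.
  rewrite (bigID (fun q' : 'I_L.+1 => coprime q q')) /=; congr (_ + _).
    apply: eq_bigl => q'; case cq : (coprime q q'); rewrite ?andbF//.
    by rewrite coprime_no_small_div// !andbT.
  by apply: eq_bigl => q'; rewrite /bad; case: (L %/ e0 < q)%N; case: (L %/ e0 < q')%N; case: (L < q + q')%N;
    case: no_small_div; case: coprime.
rewrite hcop; apply: (le_trans (ncB _ _)).
have S1 : S <= eps / 2 * P%:R * L%:R ^+ n.
  rewrite -(ler_pM2r Lp); apply: (le_trans hS).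
  rewrite -!mulrA [L%:R ^+ n * _]mulrC !mulrA ler_pM2r ?exprn_gt0// [leRHS]mulrAC.
  rewrite ler_pM2r ?ltr0n//.
  have : 2 * C / eps <= L%:R by rewrite (le_trans (ltW hL0))// ler_nat.
  by rewrite ler_pdivrMr//; lra.
have S2 : nc (\sum_(q < L.+1) \sum_(q' < L.+1 | bad q q' && (L < q + q')%N)
     \sum_(i < P %/ (q * q')) oscF al lam mu Y l l' P q q' i) <= eps / 2 * P%:R * L%:R ^+ n.
  pose M := P%:R * e0%:R ^+ 2 / L%:R ^+ 2 * (CK * L%:R) ^+ n.
  have M0 : 0 <= M.
    rewrite mulr_ge0 ?exprn_ge0// ?mulr_ge0 ?(ltW CK0)// ?invr_ge0 ?sqr_ge0//.
  apply: le_trans (_ : \sum_(q < L.+1) \sum_(q' < L.+1 | bad q q') M <= _).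
    apply: (le_trans (nc_sum _ _ _)); apply: ler_sum => q _.
    apply: (le_trans (nc_sum _ _ _)).
    rewrite big_mkcond [leRHS]big_mkcond; apply: ler_sum => q' _ /=.
    case hb : (bad q q') => //=; case: ifP => // _.
    have /and4P[Eq Eq' _ _] := hb.
    apply: (le_trans (nc_sum _ _ _)).
    apply: le_trans (_ : \sum_(i < P %/ (q * q')) (CK * L%:R) ^+ n <= _).
      by apply: ler_sum => i _; exact: nc_oscF sl sm.
    rewrite sumr_const card_ord -[leLHS]mulr_natl /M ler_wpM2r//.
      by rewrite exprn_ge0// mulr_ge0// ltW.
    exact: compact_cell_count.
  have -> : \sum_(q < L.+1) \sum_(q' < L.+1 | bad q q') M =
      M * \sum_(q < L.+1) \sum_(q' < L.+1 | bad q q') 1.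
    by rewrite mulr_sumr; apply: eq_bigr => q _; rewrite mulr_sumr mulr1.
  apply: le_trans (_ : M * (L%:R ^+ 2 / D.+1%:R) <= _).
    by rewrite ler_wpM2l// bad_pairs.
  rewrite /M exprMn [leLHS](_ : _ = (CK ^+ n * e0%:R ^+ 2 / D.+1%:R) * P%:R * L%:R ^+ n); last first.
    by field; rewrite nat1r pnatr_eq0 /= gt_eqF.
  rewrite ler_pM2r ?exprn_gt0// ler_pM2r ?ltr0n// ler_pdivrMr ?ltr0n//.
  move: (ltW hD); rewrite ler_pdivrMr//; lra.
by apply: (le_trans (lerD S1 S2)); lra.
Qed.

End coprime_oscillation.

(** * Arcs with a small denominator *)

Section cusp.
Context {R : realType}.

(** Comparison with the integral of [(A + B t)^-(m + 1)], in telescoping form; [B <= A] absorbs the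
    term [i = 0]. *)
Lemma inv_pow_sum (A B : R) (m N : nat) : 0 < B -> B <= A -> (0 < m)%N ->
  \sum_(i < N) (A + B * i%:R) ^- m.+1 <= 2 * A ^- m / B.
Proof.
move=> B0 BA m0; have A0 : 0 < A by exact: lt_le_trans BA.
pose x (i : nat) := A + B * i%:R.
have x0 i : 0 < x i by rewrite ltr_wpDr// mulr_ge0// ltW.
have xS i : x i.+1 = x i + B by rewrite /x -natr1; ring.
have step i : B * x i.+1 ^- m.+1 <= x i ^- m - x i.+1 ^- m.
  rewrite -!exprVn exprS; set a := (x i)^-1; set b := (x i.+1)^-1.
  have a0 : 0 < a by rewrite invr_gt0.
  have b0 : 0 < b by rewrite invr_gt0.
  have ba : b <= a by rewrite lef_pV2 ?posrE// xS lerDl ltW.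
  have ab : a - b = B * a * b.
    by rewrite /a /b xS; field; rewrite -xS !gt_eqF.
  case: m m0 => // m _; rewrite !exprS.
  have h : b ^+ m <= a ^+ m by rewrite lerXn2r ?nnegrE ?(ltW a0) ?(ltW b0).
  have h0 : 0 <= b ^+ m by rewrite exprn_ge0 ?ltW.
  have h1 : a * b ^+ m <= a * a ^+ m by rewrite ler_pM2l.
  have h2 : B * (b * (b * b ^+ m)) <= B * a * b * b ^+ m.
    rewrite -!mulrA ler_pM2l// ler_wpM2r//.
    by rewrite mulr_ge0// ltW.
  by rewrite -ab in h2; lra.
case: N => [|N]; first by rewrite big_ord0 divr_ge0 ?mulr_ge0 ?invr_ge0 ?exprn_ge0 ?ltW.
rewrite big_ord_recl /= mulr0 addr0.
have tele : \sum_(i < N) B * x i.+1 ^- m.+1 <= A ^- m.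
  apply: le_trans (_ : \sum_(i < N) (x i ^- m - x i.+1 ^- m) <= _).
    by apply: ler_sum => i _; exact: step.
  rewrite (_ : \sum_(i < N) _ = x 0%N ^- m - x N ^- m); last first.
    elim: N => [|N IH]; first by rewrite big_ord0 subrr.
    by rewrite big_ord_recr /= IH addrA subrK.
  by rewrite {1}/x mulr0 addr0 gerBl invr_ge0 exprn_ge0// (ltW (x0 N)).
rewrite -mulr_sumr in tele.
have e0 : A ^- m.+1 <= A ^- m / B.
  rewrite -!exprVn exprSr; apply: ler_wpM2l; first by rewrite exprn_ge0// invr_ge0 ltW.
  by rewrite lef_pV2 ?posrE.
have -> : 2 * A ^- m / B = A ^- m / B + A ^- m / B by ring.
by apply: lerD => //; rewrite ler_pdivlMr// mulrC.
Qed.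

Lemma exp_beats_pow (n : nat) (c : R) : (0 < n)%N -> 0 < c -> exists2 K : R, 0 < K &
  forall x, 0 <= x -> (1 + x) ^+ n <= K * expR (c * x ^+ 2).
Proof.
move=> n0 c0; have np : 0 < n%:R :> R by rewrite ltr0n.
pose a := c / n%:R; have a0 : 0 < a by rewrite divr_gt0.
pose k := 1 + (4 * a)^-1; have k0 : 0 < k by rewrite addr_gt0// invr_gt0 mulr_gt0.
exists (k ^+ n); first by rewrite exprn_gt0.
move=> x x0; have -> : c * x ^+ 2 = n%:R * (a * x ^+ 2) by rewrite /a; field; rewrite gt_eqF.
rewrite expRM_natl -exprMn lerXn2r ?nnegrE ?addr_ge0 ?mulr_ge0 ?expR_ge0 ?(ltW k0)//.
apply: le_trans (_ : k * (1 + a * x ^+ 2) <= _); last by rewrite ler_pM2l// expR_ge1Dx.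
have h : 0 <= a * (x - (2 * a)^-1) ^+ 2 by rewrite mulr_ge0 ?sqr_ge0// ltW.
have e : a * (x - (2 * a)^-1) ^+ 2 = a * x ^+ 2 - x + (4 * a)^-1 by field; rewrite gt_eqF.
have h2 : 0 <= (4 * a)^-1 * (a * x ^+ 2).
  by rewrite mulr_ge0 ?invr_ge0 ?mulr_ge0 ?sqr_ge0// ltW.
by rewrite e in h; rewrite /k; lra.
Qed.

Lemma nz_min (t : R) (k : int) : `|t - (nz t)%:~R| <= `|t - k%:~R|.
Proof.
have [->//|kn] := eqVneq k (nz t).
apply: (le_trans (nz_dist t)).
have h : 1 <= `|(k - nz t)%:~R| :> R.
  by rewrite -intr_norm ler1z; move: kn; rewrite -subr_eq0; lia.
have := nz_dist t.
have : `|(k - nz t)%:~R : R| <= `|t - k%:~R| + `|t - (nz t)%:~R|.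
  rewrite [`|t - k%:~R|]distrC intrB.
  by apply: le_trans (ler_normD _ _); rewrite addrA subrK.
lra.
Qed.

(** [||q al||]: the distance of [q al] to the integer vectors in the maximum norm. *)
Definition etaf n (al : 'I_n -> R) (q : nat) : R :=
  \big[Num.max/0]_j `|q%:R * al j - (nz (q%:R * al j))%:~R|.

Lemma etaf_ge n (al : 'I_n -> R) q j : `|q%:R * al j - (nz (q%:R * al j))%:~R| <= etaf al q.
Proof. exact: le_bigmax. Qed.

Lemma etaf_ge0 n (al : 'I_n -> R) q : 0 <= etaf al q.
Proof. exact: bigmax_ge_id. Qed.

Lemma etaf_le1 n (al : 'I_n -> R) q : etaf al q <= 1.
Proof.
apply: bigmax_le => // j _; apply: (le_trans (nz_dist _)).
by rewrite invf_le1// ler1n.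
Qed.

Lemma etaf_attained n (al : 'I_n -> R) q : (0 < n)%N ->
  exists j, forall k : int, etaf al q <= `|q%:R * al j - k%:~R|.
Proof.
case: n al => // n al _.
pose F j : R := `|q%:R * al j - (nz (q%:R * al j))%:~R|.
have [j _ hj] := eq_bigmax ord0 xpredT F isT (fun i _ => normr_ge0 _).
by exists j => k; rewrite /etaf hj; exact: nz_min.
Qed.

Lemma etaf_sub n (al : 'I_n -> R) p q : (0 < n)%N -> (0 < p)%N -> (p < q)%N ->
  etaf al (q - p) <= etaf al p + etaf al q.
Proof.
move=> n0 p0 pq; apply: bigmax_le => [|j _]; first by rewrite addr_ge0 ?etaf_ge0.
apply: (le_trans (nz_min _ (nz (q%:R * al j) - nz (p%:R * al j)))).
apply: le_trans (lerD (etaf_ge al p j) (etaf_ge al q j)).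
rewrite natrB ?(ltnW pq)// intrB [X in _ <= X + _]distrC.
apply: le_trans (ler_normD _ _).
by rewrite le_eqVlt; apply/orP; left; apply/eqP; congr Num.norm; ring.
Qed.

(** Summation over the grid points of an arc turns the power [-n] into [-(n - 1)] and brings a
    factor [P / (L q)]; the at most [q] values of [q'] in [(L - q, L]] cancel the [q]. *)
Lemma cusp_sum (G : nat -> nat -> nat -> R) (eta : nat -> R) (M : R) (L P E n : nat) :
  (1 < n)%N -> (0 < L)%N -> (L ^ 2 <= P)%N -> (E <= L)%N -> 0 <= M ->
  (forall q, 0 <= eta q) ->
  (forall q q' i, fpair q q' -> (L < q + q')%N -> (q <= E)%N -> (q' <= L)%N ->
    (i < P %/ (q * q'))%N ->
    G q q' i <= M * (eta q + q%:R / L%:R + L%:R * q%:R / P%:R * i%:R) ^- n) ->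
  \sum_(q < L.+1) \sum_(q' < L.+1 | [&& fpair q q', L < q + q' & q <= E]%N)
    \sum_(i < P %/ (q * q')) G q q' i <=
  2 * M * (P%:R / L%:R) * \sum_(1 <= q < E.+1) (eta q + q%:R / L%:R) ^- n.-1.
Proof.
move=> n1 L0 LP EL M0 eta0 hG.
have Lp : 0 < L%:R :> R by rewrite ltr0n.
have P0 : (0 < P)%N by apply: leq_trans LP; rewrite expn_gt0 L0.
have Pp : 0 < P%:R :> R by rewrite ltr0n.
have en : n = n.-1.+1 by rewrite prednK// ltnW.
rewrite mulr_sumr -(big_mkord xpredT (fun q => \sum_(q' < L.+1 | [&& fpair q q', L < q + q' & q <= E]%N)
    \sum_(i < P %/ (q * q')) G q q' i)).
rewrite (@big_cat_nat _ _ _ E.+1)//= [X in _ + X]big_nat_cond [X in _ + X]big1 ?addr0; last first.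
  move=> q /andP[/andP[Eq _] _]; apply: big1 => q' /and3P[_ _].
  by rewrite leqNgt Eq.
rewrite big_nat_recl//= big1 ?add0r; last by move=> q'; rewrite /fpair.
rewrite [leRHS]big_add1 /= big_nat [leRHS]big_nat; apply: ler_sum => q /andP[_ qE].
have Ap : 0 < eta q.+1 + q.+1%:R / L%:R by rewrite ltr_wpDl// divr_gt0// ltr0n.
have Bp : 0 < L%:R * q.+1%:R / P%:R :> R by rewrite divr_gt0// mulr_gt0// ltr0n.
have BA : L%:R * q.+1%:R / P%:R <= eta q.+1 + q.+1%:R / L%:R.
  apply: le_trans (_ : q.+1%:R / L%:R <= _); last by rewrite lerDr.
  rewrite ler_pdivrMr// mulrAC ler_pdivlMr// -!natrM ler_nat mulnAC mulnC leq_mul2l.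
  by rewrite mulnn LP orbT.
apply: le_trans (_ : \sum_(q' < L.+1 | (L < q.+1 + q')%N)
   (M * (2 * (eta q.+1 + q.+1%:R / L%:R) ^- n.-1 / (L%:R * q.+1%:R / P%:R))) <= _).
  rewrite big_mkcond [leRHS]big_mkcond; apply: ler_sum => q' _ /=.
  have pos : 0 <= M * (2 * (eta q.+1 + q.+1%:R / L%:R) ^- n.-1 / (L%:R * q.+1%:R / P%:R)).
    by rewrite mulr_ge0// divr_ge0 ?mulr_ge0 ?invr_ge0 ?exprn_ge0// ltW.
  case: ifP => [/and3P[fq Lq _]|_]; last by case: ifP.
  rewrite Lq; apply: le_trans (_ : \sum_(i < P %/ (q.+1 * q')) M *
      (eta q.+1 + q.+1%:R / L%:R + L%:R * q.+1%:R / P%:R * i%:R) ^- n <= _).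
    by apply: ler_sum => i _; apply: hG => //; rewrite -ltnS.
  rewrite -mulr_sumr ler_wpM2l// {1}en.
  by apply: inv_pow_sum => //; rewrite -ltnS -en.
have qL : (q.+1 <= L)%N by exact: leq_trans EL.
set K := M * _.
rewrite (eq_bigl (fun q' : 'I_L.+1 => predT (q' : nat) && (L - q <= q' < L.+1)%N)); last first.
  by move=> q'; rewrite ltn_ord andbT /= leq_subLR addSn ltnS.
rewrite (@sum_ord_nat _ L.+1 (L - q) L.+1 predT (fun=> K))// sumr_const_nat.
have -> : (L.+1 - (L - q) = q.+1)%N by rewrite subSn ?leq_subr// subKn// ltnW.
rewrite /K -[leLHS]mulr_natl le_eqVlt; apply/orP; left; apply/eqP.
move: (_ ^- n.-1) => W; field.
by rewrite !gt_eqF// ltr0n.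
Qed.

End cusp.

Section cells.
Context {R : realType}.

Definition Zprod n (al lam mu : 'I_n -> R) (X Y : 'I_n -> nat) (u : R) : R[i] :=
  \prod_j Zf (al j) (lam j) (mu j) (X j) (Y j) u.

Definition Kprod n (mu : 'I_n -> R) (Y : 'I_n -> nat) : R[i] := \prod_j Kf (mu j) (Y j) 0.

Lemma nc_Kprod n (mu : 'I_n -> R) (Y : 'I_n -> nat) (c1 c2 : R) L : 0 < c1 -> (0 < L)%N ->
  scaled c1 c2 L mu -> nc (Kprod mu Y) <= (gaussC * (1 + (Num.sqrt c1)^-1) * L%:R) ^+ n.
Proof.
move=> c10 L0 sm; rewrite nc_prod -[X in _ ^+ X](card_ord n) -prodr_const.
apply: ler_prod => j _; rewrite nc_ge0 /=.
by have /andP[h _] := sm j; exact: Kf_le.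
Qed.

(** The coordinate at which [||q al||] is attained supplies the exponential decay; the others are
    bounded by [L / v], with [v] the length of the first basis vector. Then
    [v^-n expR (- c (eta / v)^2)] is [O((v + eta)^-n)], and [w <= 2 v]. Subtracting [Kprod] is
    harmless because [eta + w <= 1 + 6]. *)
Lemma point_bound n (al : 'I_n -> R) (c1 c2 : R) : (0 < n)%N -> 0 < c1 -> 0 < c2 ->
  exists2 C : R, 0 < C & forall (L : nat) (lam mu : 'I_n -> R) (X Y : 'I_n -> nat) (u w : R)
    (q : nat) (h q' h' : int),
  (0 < L)%N -> scaled c1 c2 L lam -> scaled c1 c2 L mu -> (forall j, (L ^ 2 <= X j)%N) ->
  h' * q%:Z - h * q' = 1 -> vec2 q%:Z h L%:R u <= 3 ^+ 2 -> 0 < w ->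
  w ^+ 2 <= 4 * vec2 q%:Z h L%:R u ->
  nc (Zprod al lam mu X Y u - Kprod mu Y) <= C * L%:R ^+ n * (etaf al q + w) ^- n.
Proof.
move=> n0 c10 c20.
have [C [c [C0 c0 hZ]]] := Zf_bound c10 c20 (ltr0Sn R 2).
have [K K0 hK] := exp_beats_pow n0 c0.
have s1 : 0 < (Num.sqrt c1)^-1 by rewrite invr_gt0 sqrtr_gt0.
pose CK := gaussC * (1 + (Num.sqrt c1)^-1) : R.
have CK0 : 0 < CK by rewrite mulr_gt0 ?gaussC_gt0// addr_gt0.
exists (C ^+ n * K * 2 ^+ n + CK ^+ n * 7 ^+ n).
  by rewrite addr_gt0 ?mulr_gt0 ?exprn_gt0.
move=> L lam mu X Y u w q h q' h' L0 sl sm hX det v9 w0 wv.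
have Lp : 0 < L%:R :> R by rewrite ltr0n.
set v2 := vec2 _ _ _ _ in v9 wv *; pose v := Num.sqrt v2.
have v20 : 0 < v2.
  by rewrite -(@pmulr_rgt0 _ 4)//; apply: lt_le_trans wv; rewrite exprn_gt0.
have v0 : 0 < v by rewrite sqrtr_gt0.
have vv : v ^+ 2 = v2 by rewrite sqr_sqrtr// ltW.
have v3 : v <= 3.
  by rewrite -(@ler_pXn2r _ 2) ?nnegrE ?(ltW v0)// vv.
have wv2 : w <= 2 * v.
  rewrite -(@ler_pXn2r _ 2) ?nnegrE ?(ltW w0) ?mulr_ge0 ?(ltW v0)// exprMn vv.
  by apply: (le_trans wv); rewrite ler_pM2r// -natrX.
set eta := etaf al q; have eta0 : 0 <= eta by exact: etaf_ge0.
have eta1 : eta <= 1 by exact: etaf_le1.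
have ew0 : 0 < eta + w by rewrite ltr_wpDl.
have ev0 : 0 < v + eta by rewrite ltr_wpDr.
have [j0 hj0] := etaf_attained al q n0.
have hz j : nc (Zf (al j) (lam j) (mu j) (X j) (Y j) u) <= C * L%:R / v *
    (if j == j0 then expR (- (c * (eta ^+ 2 / v2))) else 1).
  have /andP[l1 l2] := sl j; have /andP[m1 _] := sm j.
  case: eqP => [->|_].
    have /andP[l1' l2'] := sl j0; have /andP[m1' _] := sm j0.
    apply: hZ det eta0 _ v20 v9 => // k; exact: hj0.
  have := hZ L (X j) (Y j) (al j) (lam j) (mu j) u q h q' h' 0 L0 (hX j) l1 l2 m1 det (lexx _)
    (fun k => normr_ge0 _) v20 v9.
  by rewrite expr0n mul0r mulr0 oppr0 expR0.
have Zle : nc (Zprod al lam mu X Y u) <= C ^+ n * K * 2 ^+ n * L%:R ^+ n * (eta + w) ^- n.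
  apply: le_trans (_ : (C * L%:R / v) ^+ n * expR (- (c * (eta ^+ 2 / v2))) <= _).
    rewrite nc_prod; apply: le_trans (_ : \prod_(j < n) (C * L%:R / v *
      (if j == j0 then expR (- (c * (eta ^+ 2 / v2))) else 1)) <= _).
      by apply: ler_prod => j _; rewrite nc_ge0 hz.
    rewrite big_split /= prodr_const card_ord ler_pM2l ?exprn_gt0 ?divr_gt0 ?mulr_gt0//.
    by rewrite (bigD1 j0)//= eqxx big1 ?mulr1// => j /negPf ->.
  have x0 : 0 <= eta / v by rewrite divr_ge0 ?(ltW v0).
  have := hK _ x0; rewrite expr_div_n vv => hk.
  have -> : (C * L%:R / v) ^+ n = C ^+ n * L%:R ^+ n * v ^- n.
    by rewrite !exprMn exprVn.
  have e1 : v ^- n * expR (- (c * (eta ^+ 2 / v2))) <= K * (v + eta) ^- n.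
    rewrite expRN ler_pdivrMr ?expR_gt0// mulrAC ler_pdivlMr ?exprn_gt0//.
    rewrite -!exprVn mulrC -exprMn.
    by have -> : (v + eta) * v^-1 = 1 + eta / v by field; rewrite gt_eqF.
  have e2 : (v + eta) ^- n <= 2 ^+ n * (eta + w) ^- n.
    rewrite -!exprVn -exprMn lerXn2r ?nnegrE ?mulr_ge0 ?invr_ge0 ?(ltW ev0) ?(ltW ew0)//.
    by rewrite -[leLHS]mul1r ler_pdivrMr// mulrAC ler_pdivlMr//; lra.
  apply: le_trans (_ : C ^+ n * L%:R ^+ n * (K * (2 ^+ n * (eta + w) ^- n)) <= _); last first.
    by rewrite le_eqVlt; apply/orP; left; apply/eqP; ring.
  rewrite -[leLHS]mulrA ler_pM2l ?mulr_gt0 ?exprn_gt0//.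
  by apply: (le_trans e1); rewrite ler_pM2l.
have Kle : nc (Kprod mu Y) <= CK ^+ n * 7 ^+ n * L%:R ^+ n * (eta + w) ^- n.
  apply: (le_trans (nc_Kprod Y c10 L0 sm)); rewrite -/CK exprMn.
  rewrite [leRHS](_ : _ = CK ^+ n * L%:R ^+ n * (7 ^+ n * (eta + w) ^- n)); last by ring.
  rewrite ler_peMr ?mulr_ge0 ?exprn_ge0 ?(ltW CK0)//.
  rewrite -exprVn -exprMn exprn_ege1// ler_pdivlMr// mul1r; lra.
by apply: (le_trans (ncB _ _)); rewrite mulrDl mulrDl; exact: lerD.
Qed.

Lemma farey_cell (P q q' : nat) (i : nat) (u : R) : fpair q q' -> (0 < P)%N -> (q %| P)%N ->
  u = (P %/ q * fnum q q' + i)%:R / P%:R ->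
  let h := (fnum q q')%:Z in let h' := ((fnum q q' * q' + 1) %/ q)%:Z in
  [/\ h' * q%:Z - h * q'%:Z = 1,
      u * q%:R - h%:~R = q%:R * (i%:R / P%:R) &
      u * q'%:R - h'%:~R = q'%:R * (i%:R / P%:R) - q%:R^-1].
Proof.
move=> fq P0 qP ->; have [hq dh] := fnumP fq; have /and3P[q0 q'0 _] := fq.
set h0 := fnum q q' in hq dh *; set h'0 := (_ %/ q)%N.
have Pn0 : P%:R != 0 :> R by rewrite pnatr_eq0 -lt0n.
have qn0 : q%:R != 0 :> R by rewrite pnatr_eq0 -lt0n.
have eP : (P %/ q)%:R = P%:R / q%:R :> R.
  by apply: (mulIf qn0); rewrite -natrM divnK// mulfVK.
have eh : (h'0 * q = h0 * q' + 1)%N by rewrite /h'0 divnK.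
have ehR : h'0%:R = (h0%:R * q'%:R + 1) / q%:R :> R.
  have := congr1 (fun k => k%:R : R) eh; rewrite natrM natrD natrM => <-.
  by rewrite mulfK.
split => /=.
- by rewrite -!PoszM eh PoszD addrC addKr.
- by rewrite natrD natrM eP -pmulrn; field; rewrite Pn0 qn0.
- by rewrite natrD natrM eP -pmulrn ehR; field; rewrite Pn0 qn0.
Qed.

End cells.

Section cusp_total.
Context {R : realType}.

Definition badly n (al : 'I_n -> R) (c0 tau : R) := forall q : nat, (0 < q)%N ->
  exists j, forall k : int, c0 / q%:R `^ tau <= `|q%:R * al j - k%:~R|.

Definition Zdiff n (al lam mu : 'I_n -> R) (X Y : 'I_n -> nat) (P b : nat) : R[i] :=
  Zprod al lam mu X Y (b%:R / P%:R) - Kprod mu Y.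

Lemma sqr_ge_half (a b : R) : 0 <= a -> 0 <= b -> (a + b) ^+ 2 <= 4 * (a ^+ 2 + b ^+ 2).
Proof. by move=> a0 b0; have := sqr_ge0 (a - b); have := sqr_ge0 a; have := sqr_ge0 b; nra. Qed.

(** The two estimates are mirror images. For small [q'] the arc is read from its right end: the
    basis starts with [(q', h')] and is completed by [(- q, - h)], and the grid points are numbered
    backwards. *)
Lemma cusp_total n (al : 'I_n -> R) (c1 c2 c0 tau : R) : (1 < n)%N -> 0 < c1 -> 0 < c2 ->
  0 < c0 -> 0 < tau -> (n.-1%:R - 1) * tau < 1 -> badly al c0 tau ->
  exists C nu : R, [/\ 0 < C, 0 < nu & forall (L P e0 : nat) (lam mu : 'I_n -> R) (X Y : 'I_n -> nat),
  (0 < L)%N -> (L ^ 2 <= P)%N -> (forall q, (0 < q <= L)%N -> (q %| P)%N) -> (1 < e0)%N ->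
  scaled c1 c2 L lam -> scaled c1 c2 L mu -> (forall j, (L ^ 2 <= X j)%N) ->
  \sum_(q < L.+1) \sum_(q' < L.+1 | [&& fpair q q', L < q + q' & q <= L %/ e0]%N)
    \sum_(i < P %/ (q * q')) nc (Zdiff al lam mu X Y P (P %/ q * fnum q q' + i)) <=
    C * P%:R * L%:R ^+ n * ((L %/ e0)%:R / L%:R) `^ nu /\
  \sum_(q < L.+1) \sum_(q' < L.+1 | [&& fpair q q', L < q + q' & q' <= L %/ e0]%N)
    \sum_(i < P %/ (q * q')) nc (Zdiff al lam mu X Y P (P %/ q * fnum q q' + i)) <=
    C * P%:R * L%:R ^+ n * ((L %/ e0)%:R / L%:R) `^ nu].
Proof.
move=> n1 c10 c20 c00 tau0 ht hb; have n0 : (0 < n)%N by exact: ltnW.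
have [C C0 hC] := point_bound al n0 c10 c20.
have eta_d q : (0 < q)%N -> c0 / q%:R `^ tau <= etaf al q.
  move=> /hb[j hj]; exact: le_trans (hj _) (etaf_ge al q j).
have eta_p q : (0 < q)%N -> 0 < etaf al q.
  by move=> q0; apply: lt_le_trans (eta_d _ q0); rewrite divr_gt0// powR_gt0// ltr0n.
have nn1 : (0 < n.-1)%N by rewrite -ltnS prednK.
have [C' [nu [C'0 nu0 hS]]] := eta_weighted_sum (fun p q p0 pq => etaf_sub al n0 p0 pq)
   eta_p (etaf_le1 al) c00 tau0 eta_d nn1 ht.
exists (2 * C * C'), nu; split => //; first by rewrite !mulr_gt0.
move=> L P e0 lam mu X Y L0 LP hP e01 sl sm hX.
have Lp : 0 < L%:R :> R by rewrite ltr0n.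
have P0 : (0 < P)%N by apply: leq_trans LP; rewrite expn_gt0 L0.
have Pp : 0 < P%:R :> R by rewrite ltr0n.
set E := (L %/ e0)%N.
have EL : (E <= L)%N by exact: leq_div.
have E2 : (E * 2 <= L)%N.
  by apply: leq_trans (leq_trunc_div L e0); rewrite leq_mul2l e01 orbT.
(* A small [q] forces [q' >= L / 2], hence [L q (i + 1) <= 2 q q' (i + 1) <= 2 P]; this keeps [vec2]
   below [3 ^ 2]. *)
have small q q' i : (0 < q)%N -> (0 < q')%N -> (L < q + q')%N -> (q <= E)%N ->
    (i < P %/ (q * q'))%N -> L%:R * q%:R * i.+1%:R / P%:R <= 2 :> R.
  move=> q0 q'0 Lqq qE; rewrite leq_divRL ?muln_gt0 ?q0// => hi.
  have Lq' : (L <= 2 * q')%N.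
    rewrite -(leq_add2r L); apply: leq_trans (_ : (q + q') * 2 <= _)%N.
      by rewrite addnn -muln2 leq_mul2r ltnW ?orbT.
    by rewrite mulnDl addnC [(q' * 2)%N]mulnC leq_add2l (leq_trans _ E2)// leq_mul2r qE orbT.
  rewrite ler_pdivrMr// -!natrM ler_nat.
  apply: leq_trans (_ : 2 * q' * q * i.+1 <= _)%N.
    by rewrite leq_mul2r leq_mul2r Lq' !orbT.
  rewrite -!mulnA leq_mul2l /=.
  by have -> : (q' * (q * i.+1) = i.+1 * (q * q'))%N by rewrite mulnC (mulnC q) -mulnA.
have small0 q : (q <= E)%N -> q%:R / L%:R <= 1 :> R.
  by move=> qE; rewrite ler_pdivrMr// mul1r ler_nat (leq_trans qE).
have fin : 2 * (C * L%:R ^+ n) * (P%:R / L%:R) * \sum_(1 <= q < E.+1) (etaf al q + q%:R / L%:R) ^- n.-1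
    <= 2 * C * C' * P%:R * L%:R ^+ n * (E%:R / L%:R) `^ nu.
  apply: le_trans (_ : 2 * (C * L%:R ^+ n) * (P%:R / L%:R) * (C' * L%:R * (E%:R / L%:R) `^ nu) <= _).
    by rewrite ler_wpM2l ?hS// !mulr_ge0 ?exprn_ge0 ?invr_ge0// ltW.
  rewrite le_eqVlt; apply/orP; left; apply/eqP.
  by move: (_ `^ nu) (_ ^+ n) => a b; field; rewrite gt_eqF.
have CL0 : 0 <= C * L%:R ^+ n by rewrite mulr_ge0 ?exprn_ge0// ltW.
have i1 (i : nat) : i%:R <= i.+1%:R :> R by rewrite ler_nat.
split; apply: le_trans fin.
- apply: (cusp_sum n1 L0 LP EL CL0 (etaf_ge0 al)
    (G := fun q q' i => nc (Zdiff al lam mu X Y P (P %/ q * fnum q q' + i)))).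
  move=> q q' i fq Lqq qE q'L iN; have /and3P[q0 q'0 _] := fq.
  have [det eu _] := farey_cell fq P0 (hP q ltac:(by rewrite q0 (leq_trans qE))) (erefl _ :
    _ = (P %/ q * fnum q q' + i)%:R / P%:R :> R).
  set u := _ / P%:R in eu.
  have ve : vec2 q%:Z (fnum q q')%:Z L%:R u = (q%:R / L%:R) ^+ 2 + (L%:R * q%:R / P%:R * i%:R) ^+ 2.
    rewrite /vec2 -!pmulrn in eu *; rewrite eu; congr (_ + _ ^+ 2); ring.
  have w1 : 0 < q%:R / L%:R :> R by rewrite divr_gt0// ltr0n.
  have w2 : 0 <= L%:R * q%:R / P%:R * i%:R :> R by rewrite mulr_ge0// divr_ge0.
  have := small q q' i q0 q'0 Lqq qE iN; have := small0 q qE => h1 h2.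
  have h3 : L%:R * q%:R / P%:R * i%:R <= 2 :> R.
    apply: le_trans h2; rewrite mulrAC ler_wpM2r ?invr_ge0// ler_wpM2l// mulr_ge0//.
  rewrite -addrA; apply: (hC L lam mu X Y u _ q _ q' _ L0 sl sm hX det).
  + by rewrite ve; nra.
  + by rewrite ltr_pwDl.
  + by rewrite ve; apply: sqr_ge_half => //; exact: ltW.
- rewrite (exchange_big_dep xpredT)//=.
  rewrite (eq_bigr (fun q' : 'I_L.+1 => \sum_(q < L.+1 | [&& fpair q' q, L < q' + q & q' <= E]%N)
     \sum_(i < P %/ (q' * q)) nc (Zdiff al lam mu X Y P (P %/ q * fnum q q' + (P %/ (q' * q) - i.+1))))); last first.
    move=> q' _; apply: eq_big => [q|q _].
      rewrite addnC /fpair [coprime q q']coprime_sym; congr (_ && _).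
      by rewrite andbCA.
    by rewrite [(q * q')%N]mulnC (reindex_inj rev_ord_inj).
  apply: (cusp_sum n1 L0 LP EL CL0 (etaf_ge0 al)
    (G := fun q' q i => nc (Zdiff al lam mu X Y P (P %/ q * fnum q q' + (P %/ (q' * q) - i.+1))))).
  move=> q' q i fq' Lqq qE qL iN.
  have fq : fpair q q' by move: fq'; rewrite /fpair coprime_sym andbCA.
  have /and3P[q0 q'0 cq] := fq.
  have dq : (q %| P)%N by apply: hP; rewrite q0 qL.
  have dq' : (q' %| P)%N by apply: hP; rewrite q'0 (leq_trans qE).
  have dqq : (q' * q %| P)%N by rewrite Gauss_dvd 1?coprime_sym// dq' dq.
  set k := (P %/ (q' * q) - i.+1)%N.
  have [det _ eu] := farey_cell fq P0 dq (erefl _ : _ = (P %/ q * fnum q q' + k)%:R / P%:R :> R).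
  set u := _ / P%:R in eu.
  have qn0 : q%:R != 0 :> R by rewrite pnatr_eq0 -lt0n.
  have q'n0 : q'%:R != 0 :> R by rewrite pnatr_eq0 -lt0n.
  have Pn0 : P%:R != 0 :> R by rewrite gt_eqF.
  have kR : k%:R = P%:R / (q'%:R * q%:R) - i.+1%:R :> R.
    rewrite /k natrB//; congr (_ - _); apply: (mulIf (mulf_neq0 q'n0 qn0)).
    by rewrite -natrM -natrM divnK// natrM mulfVK// mulf_neq0.
  set h' := Posz _ in det eu.
  have ve : vec2 q'%:Z h' L%:R u = (q'%:R / L%:R) ^+ 2 + (L%:R * q'%:R / P%:R * i.+1%:R) ^+ 2.
    rewrite /vec2 -[q'%:~R]/(q'%:R) eu kR; congr (_ + _).
    rewrite -[RHS]sqrrN; congr (_ ^+ 2).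
    by move: (i.+1%:R : R) => z; field; rewrite Pn0 qn0 q'n0.
  have w1 : 0 < q'%:R / L%:R :> R by rewrite divr_gt0// ltr0n.
  have c0' : 0 <= L%:R * q'%:R / P%:R :> R by rewrite divr_ge0.
  have w2 : 0 <= L%:R * q'%:R / P%:R * i%:R :> R by rewrite mulr_ge0.
  have := small q' q i q'0 q0 Lqq qE iN; have := small0 q' qE => h1.
  rewrite mulrAC => h3.
  rewrite -addrA.
  have det' : (- (fnum q q')%:Z) * q'%:Z - h' * (- q%:Z) = 1.
    by rewrite -det; ring.
  (* From the right end the distances are multiples [i + 1] of the step; using [i] only lowers [w],
     which [point_bound] allows. *)
  have w3 : L%:R * q'%:R / P%:R * i%:R <= L%:R * q'%:R / P%:R * i.+1%:R :> R by rewrite ler_wpM2l.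
  apply: (hC L lam mu X Y u _ q' _ _ _ L0 sl sm hX det').
  + by rewrite ve; nra.
  + by rewrite ltr_pwDl.
  + rewrite ve; apply: le_trans (sqr_ge_half (ltW w1) (le_trans w2 w3)).
    by rewrite lerXn2r ?nnegrE ?addr_ge0 ?(ltW w1) ?(le_trans w2 w3)// lerD2l.
Qed.

End cusp_total.

(** * Total of the arcs with two large denominators *)

Section compact_total.
Context {R : realType}.

Lemma expN_sqr_small (c d : R) : 0 < c -> 0 < d -> exists T : nat, expR (- (c * T%:R ^+ 2)) <= d.
Proof.
move=> c0 d0; have [T hT] := natr_unbounded (d^-1 / c).
exists T.+1; rewrite expRN -[leRHS]invrK lef_pV2 ?posrE ?invr_gt0 ?expR_gt0//.
apply: le_trans (_ : 1 + c * T.+1%:R ^+ 2 <= _); last exact: expR_ge1Dx.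
move: hT; rewrite ltr_pdivrMr// => hT.
have : c * T.+1%:R <= c * T.+1%:R ^+ 2.
  by rewrite ler_pM2l// expr2 ler_peMl// ler1n.
by lra.
Qed.

(** Expanding the product over [j] turns choice functions into pairs of vectors [l], [l'] with
    entries of size at most [T], stored as offsets. *)
Lemma Zbox_prod n (al lam mu : 'I_n -> R) (Y : 'I_n -> nat) (T P q q' i : nat) :
  \prod_j Zbox (al j) (lam j) (mu j) (Y j) T q%:Z q'%:Z (q%:R * (i%:R / P%:R))
     (q'%:R * (i%:R / P%:R) - q%:R^-1) =
  \sum_(f : {ffun 'I_n -> 'I_(T.*2).+1 * 'I_(T.*2).+1})
    oscF al lam mu Y (fun j => (f j).1%:Z - T%:Z) (fun j => (f j).2%:Z - T%:Z) P q q' i.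
Proof.
pose G j (p : 'I_(T.*2).+1 * 'I_(T.*2).+1) :=
  let l := p.1%:Z - T%:Z in let l' := p.2%:Z - T%:Z in
  (gw (lam j) (l * q%:Z + l' * q'%:Z))%:C%C * ce ((l * q%:Z + l' * q'%:Z)%:~R * al j) *
  Kf (mu j) (Y j) (l%:~R * (q%:R * (i%:R / P%:R)) + l'%:~R * (q'%:R * (i%:R / P%:R) - q%:R^-1)).
rewrite (eq_bigr (fun j => \sum_p G j p)); last first.
  move=> j _; rewrite /Zbox big_allpairs_dep /= sum_zr_ord.
  rewrite (eq_bigr (fun l : 'I_(T.*2).+1 => \sum_l' G j (l, l'))); last first.
    by move=> l _; rewrite sum_zr_ord.
  by rewrite pair_bigA; apply: eq_bigr => -[].
rewrite bigA_distr_bigA; apply: eq_bigr => f _.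
rewrite /oscF /oscW -big_split; apply: eq_bigr => j _; rewrite /G /=.
by rewrite [X in X * _ = _]mulrC -mulrA.
Qed.

Lemma oscF0 n (al lam mu : 'I_n -> R) (Y : 'I_n -> nat) (l l' : 'I_n -> int) P q q' i :
  (forall j, l j = 0) -> (forall j, l' j = 0) ->
  oscF al lam mu Y l l' P q q' i = Kprod mu Y.
Proof.
move=> h h'.
have e j : l j * q%:Z + l' j * q'%:Z = 0 by rewrite h h' !mul0r.
rewrite /oscF big1 ?mul1r => [|j _]; last by rewrite e mul0r ce0.
apply: eq_bigr => j _; rewrite e h h' !mul0r /gw expr0n mulr0 oppr0 expR0 mul1r.
by rewrite addr0.
Qed.

Lemma centered_le (T a : nat) : (a < (T.*2).+1)%N -> (`|(a%:Z - T%:Z)%R| <= T)%N.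
Proof. by lia. Qed.

Lemma centered_eq0 (T a : nat) : a%:Z - T%:Z == 0 -> a = T.
Proof. by rewrite subr_eq0 => /eqP[]. Qed.

(** Both basis vectors have length at most [e0 + 1], so each [Zf] may be replaced by its box at a
    cost of order [L expR (- (ct T ^ 2))]. In the expanded boxes the central function [f0] gives
    exactly [Kprod], and [compact_osc] treats the others one by one, their number being independent
    of [L]. *)
Lemma compact_total n (al : 'I_n -> R) (c1 c2 eps : R) (e0 : nat) : (0 < n)%N -> (0 < e0)%N ->
  0 < c1 -> 0 < c2 -> 0 < eps -> no_relation al ->
  exists L0 : nat, forall (L P : nat) (lam mu : 'I_n -> R) (X Y : 'I_n -> nat),
  (L0 < L)%N -> (0 < P)%N -> (forall q, (0 < q <= L)%N -> (q %| P)%N) ->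
  scaled c1 c2 L lam -> scaled c1 c2 L mu ->
  (forall j, (L ^ 2 <= X j)%N) -> (forall j, (L ^ 2 <= Y j)%N) ->
  nc (\sum_(q < L.+1) \sum_(q' < L.+1 | [&& L %/ e0 < q, L %/ e0 < q', L < q + q' & coprime q q']%N)
    \sum_(i < P %/ (q * q')) Zdiff al lam mu X Y P (P %/ q * fnum q q' + i))
   <= eps * P%:R * L%:R ^+ n.
Proof.
move=> n0 e00 c10 c20 eps0 hal.
pose V : R := e0.+1%:R; have V0 : 0 < V by rewrite ltr0n.
have [Cz [cz [Cz0 cz0 hZ]]] := Zf_bound c10 c20 V0.
have [Ct [ct [Ct0 ct0 hT]]] := Zf_trunc c10 c20 V0.
pose B := Cz * e0%:R + Ct; have B0 : 0 < B by rewrite addr_gt0// mulr_gt0// ltr0n.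
pose K := n%:R * B ^+ n.-1 * Ct; have K0 : 0 < K by rewrite !mulr_gt0 ?exprn_gt0// ltr0n.
have [T hTs] := expN_sqr_small ct0 (divr_gt0 eps0 (mulr_gt0 (ltr0Sn R 1) K0)).
pose FT := {ffun 'I_n -> 'I_(T.*2).+1 * 'I_(T.*2).+1}.
pose lf (f : FT) (j : 'I_n) := (f j).1%:Z - T%:Z : int.
pose lf' (f : FT) (j : 'I_n) := (f j).2%:Z - T%:Z : int.
pose N : R := #|FT|%:R.
have mid : (T < (T.*2).+1)%N by rewrite ltnS -addnn leq_addr.
pose f0 : FT := [ffun=> (Ordinal mid, Ordinal mid)].
have N0 : 0 < N by rewrite ltr0n; apply/card_gt0P; exists f0.
have hosc (f : FT) : exists L0 : nat, f != f0 ->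
    forall (L P : nat) (lam mu : 'I_n -> R) Y, (L0 < L)%N -> (0 < P)%N ->
    scaled c1 c2 L lam -> scaled c1 c2 L mu ->
    nc (\sum_(q < L.+1) \sum_(q' < L.+1 | [&& L %/ e0 < q, L %/ e0 < q', L < q + q' & coprime q q']%N)
     \sum_(i < P %/ (q * q')) oscF al lam mu Y (lf f) (lf' f) P q q' i) <= eps / 2 / N * P%:R * L%:R ^+ n.
  have [->|fn] := eqVneq f f0; first by exists 0%N.
  have [||||L0 hL0] := @compact_osc R n al c1 c2 (eps / 2 / N) T e0 (lf f) (lf' f) n0 e00 c10 c20 hal.
  - by move=> j; apply: centered_le.
  - by move=> j; apply: centered_le.
  - apply: contrapT => hne; move/eqP: fn; apply; apply/ffunP => j; rewrite ffunE.
    have : ~~ ((lf f j != 0) || (lf' f j != 0)) by apply/negP => h; apply: hne; exists j.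
    rewrite negb_or !negbK /lf /lf' => /andP[].
    case: (f j) => [a b] /= /centered_eq0 ha /centered_eq0 hb.
    by congr (_, _); apply: val_inj.
  - by rewrite !divr_gt0.
  by exists L0 => _.
have [Lf hLf] := choice hosc.
exists (maxn (T * e0.+1 * 4) (\max_f Lf f)) => L P lam mu X Y.
rewrite gtn_max => /andP[LT LF] P0 hP sl sm hX hY.
have L0 : (0 < L)%N by exact: leq_ltn_trans LT.
have Lp : 0 < L%:R :> R by rewrite ltr0n.
have Pp : 0 < P%:R :> R by rewrite ltr0n.
pose cond (q q' : nat) := [&& L %/ e0 < q, L %/ e0 < q', L < q + q' & coprime q q']%N.
pose Bx q q' i := \prod_j Zbox (al j) (lam j) (mu j) (Y j) T q%:Z q'%:Z (q%:R * (i%:R / P%:R))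
     (q'%:R * (i%:R / P%:R) - q%:R^-1).
have cell q q' i : cond q q' -> (q <= L)%N -> (q' <= L)%N -> (i < P %/ (q * q'))%N ->
    nc (Zprod al lam mu X Y ((P %/ q * fnum q q' + i)%:R / P%:R) - Bx q q' i) <=
    K * L%:R ^+ n * expR (- (ct * T%:R ^+ 2)).
  move=> /and4P[Eq Eq' Lqq cq] qL q'L iN.
  have q0 : (0 < q)%N by exact: leq_ltn_trans Eq.
  have q'0 : (0 < q')%N by exact: leq_ltn_trans Eq'.
  have fq : fpair q q' by rewrite /fpair q0 q'0.
  have [det eu eu'] := farey_cell fq P0 (hP q ltac:(by rewrite q0 qL)) (erefl _ :
    _ = (P %/ q * fnum q q' + i)%:R / P%:R :> R).
  set u := _ / P%:R in eu eu' *; set h := Posz (fnum q q') in det eu; set h' := Posz _ in det eu'.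
  have qp : 0 < q%:R :> R by rewrite ltr0n.
  have q'p : 0 < q'%:R :> R by rewrite ltr0n.
  have big k : (L %/ e0 < k)%N -> L%:R <= e0%:R * k%:R :> R.
    by move=> hk; rewrite -natrM ler_nat mulnC ltnW// -ltn_divLR.
  have bq := big _ Eq; have bq' := big _ Eq'.
  have ii : i.+1%:R / P%:R * (q%:R * q'%:R) <= 1 :> R.
    rewrite mulrAC ler_pdivrMr// mul1r -!natrM ler_nat.
    by move: iN; rewrite leq_divRL ?muln_gt0 ?q0.
  have s0 : 0 <= i%:R / P%:R :> R by rewrite divr_ge0.
  have ss : i%:R / P%:R * (q%:R * q'%:R) <= 1 :> R.
    by apply: le_trans ii; rewrite ler_pM2r ?mulr_gt0// ler_pM2r ?invr_gt0// ler_nat.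
  set s := i%:R / P%:R in eu eu' s0 ss *.
  have bnd (r d : R) : 0 <= r -> 0 < d -> L%:R <= e0%:R * d -> r * d <= 1 -> L%:R * r <= e0%:R.
    move=> r0 d0 Ld rd; apply: le_trans (_ : e0%:R * d * r <= _); first by rewrite ler_wpM2r.
    by rewrite -mulrA ler_piMr// mulrC.
  have a0 : 0 <= q%:R * s by rewrite mulr_ge0.
  have a1 : L%:R * (q%:R * s) <= e0%:R by apply: (bnd _ q'%:R); rewrite // mulrAC mulrC.
  have b0 : 0 <= q%:R^-1 - q'%:R * s.
    by rewrite subr_ge0 -[q%:R^-1]mul1r ler_pdivlMr// mulrC mulrA [_ * s]mulrC.
  have b1 : L%:R * (q%:R^-1 - q'%:R * s) <= e0%:R.
    apply: (bnd _ q%:R) => //.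
    rewrite mulrBl mulVf ?gt_eqF// gerBl !mulr_ge0//.
  have qL1 : q%:R / L%:R <= 1 :> R by rewrite ler_pdivrMr// mul1r ler_nat.
  have q'L1 : q'%:R / L%:R <= 1 :> R by rewrite ler_pdivrMr// mul1r ler_nat.
  have VE : V = e0%:R + 1 by rewrite /V -natr1.
  have sumsq (x y : R) : 0 <= x -> x <= 1 -> 0 <= y -> y <= e0%:R ->
      x ^+ 2 + y ^+ 2 <= (e0%:R + 1) ^+ 2.
    move=> x0 x1 y0 y1; have h1 : x ^+ 2 <= 1 by rewrite exprn_ile1.
    have h2 : y ^+ 2 <= e0%:R ^+ 2 by rewrite lerXn2r ?nnegrE.
    by move: h1 h2 (ler0n R e0); clear; nra.
  have v1 : vec2 q%:Z h L%:R u <= V ^+ 2.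
    rewrite /vec2 -[q%:~R]/(q%:R) eu VE.
    by apply: sumsq; rewrite ?divr_ge0 ?mulr_ge0.
  have v2 : vec2 q'%:Z h' L%:R u <= V ^+ 2.
    rewrite /vec2 -[q'%:~R]/(q'%:R) eu' VE -(sqrrN (L%:R * _)) -mulrN opprB.
    by apply: sumsq; rewrite ?divr_ge0 ?mulr_ge0.
  (* [q > L / e0] keeps the basis vector away from 0, so [Zf_bound] with [eta = 0] gives [O(L)]. *)
  have w1 : (e0%:R^-1) ^+ 2 <= vec2 q%:Z h L%:R u.
    rewrite /vec2 -[leLHS]addr0; apply: lerD; last exact: sqr_ge0.
    rewrite lerXn2r ?nnegrE ?invr_ge0 ?divr_ge0//.
    by rewrite -[leLHS]mul1r ler_pdivrMr ?ltr0n// mulrAC ler_pdivlMr// mul1r mulrC.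
  have e0p : 0 < e0%:R :> R by rewrite ltr0n.
  have vp : 0 < vec2 q%:Z h L%:R u by apply: lt_le_trans w1; rewrite exprn_gt0 ?invr_gt0.
  have TL : T%:R * V * 4 < L%:R by rewrite /V -!natrM ltr_nat.
  have TL2 : (T.*2 <= L)%N.
    apply: leq_trans (ltnW LT); rewrite -mulnA -muln2 leq_mul2l; apply/orP; right.
    by rewrite mulSn.
  have nZ j : nc (Zf (al j) (lam j) (mu j) (X j) (Y j) u) <= Cz * e0%:R * L%:R.
    have /andP[l1 l2] := sl j; have /andP[m1 _] := sm j.
    have := hZ L (X j) (Y j) (al j) (lam j) (mu j) u q h q' h' 0 L0 (hX j) l1 l2 m1 det (lexx _)
      (fun k => normr_ge0 _) vp v1.
    rewrite expr0n mul0r mulr0 oppr0 expR0 mulr1 => hh; apply: (le_trans hh).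
    rewrite -[leRHS]mulrA [e0%:R * _]mulrC mulrA ler_wpM2l ?mulr_ge0 ?(ltW Cz0)//.
    rewrite -[leRHS]invrK lef_pV2 ?posrE ?sqrtr_gt0 ?invr_gt0//.
    by rewrite -(ger0_norm (_ : 0 <= e0%:R^-1)) ?invr_ge0// -sqrtr_sqr ler_sqrt// ltW.
  have nd j : nc (Zf (al j) (lam j) (mu j) (X j) (Y j) u -
      Zbox (al j) (lam j) (mu j) (Y j) T q%:Z q'%:Z (q%:R * s) (q'%:R * s - q%:R^-1))
      <= Ct * L%:R * expR (- (ct * T%:R ^+ 2)).
    have /andP[l1 _] := sl j; have /andP[m1 m2] := sm j.
    rewrite -eu -eu'; apply: (hT L (X j) (Y j) T (al j) (lam j) (mu j) u q h q' h') => //.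
  have e1 : expR (- (ct * T%:R ^+ 2)) <= 1.
    by rewrite expR_le1 oppr_le0 mulr_ge0 ?(ltW ct0)// exprn_ge0.
  have CtL : 0 <= Ct * L%:R by rewrite mulr_ge0// ltW.
  apply: le_trans (_ : n%:R * (B * L%:R) ^+ n.-1 * (Ct * L%:R * expR (- (ct * T%:R ^+ 2))) <= _).
    apply: nc_prod_diff => [||j|j|j]; last exact: nd.
    - by rewrite mulr_ge0// ltW.
    - by rewrite mulr_ge0 ?expR_ge0.
    - by apply: (le_trans (nZ j)); rewrite ler_pM2r// lerDl ltW.
    - set z := Zbox _ _ _ _ _ _ _ _ _.
      rewrite -[z](subKr (Zf (al j) (lam j) (mu j) (X j) (Y j) u)).
      apply: (le_trans (ncB _ _)); rewrite /B mulrDl; apply: lerD => //.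
      by apply: (le_trans (nd j)); rewrite ler_piMr.
  rewrite le_eqVlt; apply/orP; left; apply/eqP.
  have -> : L%:R ^+ n = L%:R * L%:R ^+ n.-1 :> R by rewrite -exprS prednK.
  by rewrite exprMn /K; ring.
rewrite (eq_bigr (fun q : 'I_L.+1 => \sum_(q' < L.+1 | cond q q') \sum_(i < P %/ (q * q'))
   (Zprod al lam mu X Y ((P %/ q * fnum q q' + i)%:R / P%:R) - Bx q q' i) +
   \sum_(q' < L.+1 | cond q q') \sum_(i < P %/ (q * q')) (Bx q q' i - Kprod mu Y))); last first.
  move=> q _; rewrite -big_split; apply: eq_bigr => q' _; rewrite -big_split.
  by apply: eq_bigr => i _ /=; rewrite addrA subrK.
rewrite big_split /=; apply: (le_trans (ncD _ _)).
have -> : eps * P%:R * L%:R ^+ n = eps / 2 * P%:R * L%:R ^+ n + eps / 2 * P%:R * L%:R ^+ n by lra.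
apply: lerD.
  apply: le_trans (_ : \sum_(q < L.+1) \sum_(q' < L.+1 | fpair q q' && (L < q + q')%N)
      \sum_(i < P %/ (q * q')) K * L%:R ^+ n * expR (- (ct * T%:R ^+ 2)) <= _).
    apply: (le_trans (nc_sum _ _ _)); apply: ler_sum => q _.
    apply: (le_trans (nc_sum _ _ _)).
    rewrite big_mkcond [leRHS]big_mkcond; apply: ler_sum => q' _ /=.
    case: ifP => [hc|_]; last first.
      case: ifP => // _; apply: sumr_ge0 => i _.
      by rewrite mulr_ge0 ?expR_ge0// mulr_ge0 ?exprn_ge0// ltW.
    have /and4P[Eq Eq' Lqq cq] := hc.
    rewrite /fpair cq Lqq (leq_ltn_trans _ Eq)// (leq_ltn_trans _ Eq')//=.
    apply: (le_trans (nc_sum _ _ _)); apply: ler_sum => i _; apply: cell => //.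
    - by rewrite -ltnS.
    - by rewrite -ltnS.
  rewrite -(farey_grid (fun=> K * L%:R ^+ n * expR (- (ct * T%:R ^+ 2))) P0 L0 hP).
  rewrite sumr_const card_ord -[leLHS]mulr_natl.
  have : K * expR (- (ct * T%:R ^+ 2)) <= eps / 2.
    by rewrite mulrC -ler_pdivlMr//; apply: (le_trans hTs); rewrite invfM mulrA.
  move=> hh; rewrite [leLHS](_ : _ = K * expR (- (ct * T%:R ^+ 2)) * (P%:R * L%:R ^+ n)); last by ring.
  by rewrite -[leRHS]mulrA ler_wpM2r// mulr_ge0// exprn_ge0.
have -> : \sum_(q < L.+1) \sum_(q' < L.+1 | cond q q') \sum_(i < P %/ (q * q')) (Bx q q' i - Kprod mu Y) =
  \sum_(f | f != f0) \sum_(q < L.+1) \sum_(q' < L.+1 | cond q q') \sum_(i < P %/ (q * q'))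
     oscF al lam mu Y (lf f) (lf' f) P q q' i.
  rewrite exchange_big /=; apply: eq_bigr => q _.
  rewrite exchange_big /=; apply: eq_bigr => q' _.
  rewrite exchange_big /=; apply: eq_bigr => i _.
  have e0' : oscF al lam mu Y (lf f0) (lf' f0) P q q' i = Kprod mu Y.
    by apply: oscF0 => j; rewrite /lf /lf' ffunE /= subrr.
  by rewrite /Bx Zbox_prod (bigD1 f0)//= e0' addrAC subrr add0r.
apply: (le_trans (nc_sum _ _ _)).
apply: le_trans (_ : \sum_(f : FT) (eps / 2 / N * P%:R * L%:R ^+ n) <= _).
  rewrite big_mkcond; apply: ler_sum => f _; case: ifP => fn.
    apply: hLf => //; apply: leq_ltn_trans LF; exact: leq_bigmax.
  by rewrite !mulr_ge0 ?exprn_ge0 ?invr_ge0// ltW.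
rewrite sumr_const -[leLHS]mulr_natl -/N le_eqVlt; apply/orP; left; apply/eqP.
by field; rewrite gt_eqF.
Qed.

End compact_total.

(** * Average over the whole grid *)

Section core.
Context {R : realType}.

Lemma inv_powR_small (nu d : R) : 0 < nu -> 0 < d ->
  exists2 e0 : nat, (1 < e0)%N & e0%:R^-1 `^ nu <= d.
Proof.
move=> nu0 d0; have [k hk] := natr_unbounded (d `^ (- nu^-1)).
exists k.+2 => //.
have p0 : 0 < d `^ (- nu^-1) by exact: powR_gt0.
have h : d `^ (- nu^-1) <= k.+2%:R by rewrite (le_trans (ltW hk))// ler_nat.
have e : (d `^ (- nu^-1))^-1 `^ nu = d.
  by rewrite -powRN opprK -powRrM mulVf ?gt_eqF// powRr1// ltW.
rewrite -[leRHS]e; apply: powR_le; rewrite ?invr_ge0//; first exact: ltW.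
by rewrite lef_pV2 ?posrE.
Qed.

(** [e0] is taken so large that [e0^-nu <= eps / (4 C)], and only afterwards does [compact_total]
    provide [L0]. An arc with a small denominator is charged to one or both of the sums in
    [cusp_total]. *)
Lemma avg_Zprod n (al : 'I_n -> R) (c1 c2 c0 tau eps : R) : (1 < n)%N -> 0 < c1 -> 0 < c2 ->
  0 < c0 -> 0 < tau -> (n.-1%:R - 1) * tau < 1 -> badly al c0 tau -> no_relation al ->
  0 < eps ->
  exists L0 : nat, forall (L P : nat) (lam mu : 'I_n -> R) (X Y : 'I_n -> nat),
  (L0 < L)%N -> (L ^ 2 <= P)%N -> (forall q, (0 < q <= L)%N -> (q %| P)%N) ->
  scaled c1 c2 L lam -> scaled c1 c2 L mu ->
  (forall j, (L ^ 2 <= X j)%N) -> (forall j, (L ^ 2 <= Y j)%N) ->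
  nc (\sum_(b < P) Zprod al lam mu X Y (b%:R / P%:R) - Kprod mu Y *+ P)
    <= eps * P%:R * L%:R ^+ n.
Proof.
move=> n1 c10 c20 c00 tau0 ht hb hal eps0.
have n0 : (0 < n)%N by exact: ltnW.
have [C [nu [C0 nu0 hC]]] := cusp_total n1 c10 c20 c00 tau0 ht hb.
have [e0 e01 he0] := inv_powR_small nu0 (divr_gt0 eps0 (mulr_gt0 (ltr0Sn R 3) C0)).
have e00 : (0 < e0)%N by exact: ltnW.
have [L0 hL0] := compact_total n0 e00 c10 c20 (divr_gt0 eps0 (ltr0Sn R 1)) hal.
exists L0 => L P lam mu X Y LL LP hP sl sm hX hY.
have L_gt0 : (0 < L)%N by exact: leq_ltn_trans LL.
have P0 : (0 < P)%N by apply: leq_trans LP; rewrite expn_gt0 L_gt0.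
have Lp : 0 < L%:R :> R by rewrite ltr0n.
have [A1 A2] := hC L P e0 lam mu X Y L_gt0 LP hP e01 sl sm hX.
have A3 := hL0 L P lam mu X Y LL P0 hP sl sm hX hY.
have Enu : ((L %/ e0)%:R / L%:R) `^ nu <= eps / (4 * C).
  apply: le_trans he0; apply: powR_le; rewrite ?(ltW nu0) ?divr_ge0//.
  rewrite ler_pdivrMr// ler_pdivlMl ?ltr0n// -natrM ler_nat mulnC.
  exact: leq_trunc_div.
have hcusp : C * P%:R * L%:R ^+ n * ((L %/ e0)%:R / L%:R) `^ nu <= eps / 4 * P%:R * L%:R ^+ n.
  apply: le_trans (_ : C * P%:R * L%:R ^+ n * (eps / (4 * C)) <= _).
    by rewrite ler_wpM2l// !mulr_ge0 ?exprn_ge0// ltW.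
  by rewrite le_eqVlt; apply/orP; left; apply/eqP; field; rewrite gt_eqF.
have -> : \sum_(b < P) Zprod al lam mu X Y (b%:R / P%:R) - Kprod mu Y *+ P =
    \sum_(b < P) Zdiff al lam mu X Y P b.
  by rewrite sumrB sumr_const card_ord.
rewrite (farey_grid (Zdiff al lam mu X Y P) P0 L_gt0 hP).
pose S q q' := \sum_(i < P %/ (q * q')) Zdiff al lam mu X Y P (P %/ q * fnum q q' + i).
rewrite (eq_bigr (fun q : 'I_L.+1 =>
   \sum_(q' < L.+1 | [&& L %/ e0 < q, L %/ e0 < q', L < q + q' & coprime q q']%N) S q q' +
   \sum_(q' < L.+1 | [&& fpair q q', L < q + q' & ~~ ((L %/ e0 < q) && (L %/ e0 < q'))]%N) S q q')); last first.
  move=> q _; rewrite (bigID (fun q' : 'I_L.+1 => (L %/ e0 < q) && (L %/ e0 < q'))%N) /=; congr (_ + _).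
    apply: eq_bigl => q'; rewrite /fpair.
    have [Eq|] := ltnP (L %/ e0) q => /=; last by rewrite andbF.
    have [Eq'|] := ltnP (L %/ e0) q' => /=; last by rewrite andbF.
    by rewrite (leq_ltn_trans _ Eq)// (leq_ltn_trans _ Eq')//= andbT andbC.
  by apply: eq_bigl => q'; rewrite andbA.
rewrite big_split /=; apply: (le_trans (ncD _ _)).
have -> : eps * P%:R * L%:R ^+ n = eps / 2 * P%:R * L%:R ^+ n +
   (eps / 4 * P%:R * L%:R ^+ n + eps / 4 * P%:R * L%:R ^+ n) by lra.
apply: lerD; first exact: A3.
apply: le_trans (lerD (le_trans A1 hcusp) (le_trans A2 hcusp)).
rewrite -big_split /=; apply: (le_trans (nc_sum _ _ _)); apply: ler_sum => q _.
apply: (le_trans (nc_sum _ _ _)).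
rewrite big_mkcond [X in _ <= X + _]big_mkcond [X in _ <= _ + X]big_mkcond -big_split /=.
apply: ler_sum => q' _.
have t0 : 0 <= \sum_(i < P %/ (q * q')) nc (Zdiff al lam mu X Y P (P %/ q * fnum q q' + i)).
  by apply: sumr_ge0 => i _; exact: nc_ge0.
have hS : nc (S q q') <= \sum_(i < P %/ (q * q')) nc (Zdiff al lam mu X Y P (P %/ q * fnum q q' + i)).
  exact: nc_sum.
case: (fpair q q') => /=; last by rewrite addr0.
case: (L < q + q')%N => /=; last by rewrite addr0.
rewrite negb_and -!leqNgt.
case: (q <= L %/ e0)%N => /=; first by apply: (le_trans hS); rewrite lerDl; case: ifP.
by case: (q' <= L %/ e0)%N; rewrite /= ?add0r.
Qed.

End core.

(** * From theta sums to bilinear sums *)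

Section characters.
Context {R : realType}.

Lemma char_orth (b : nat) (x : int) : (0 < b)%N ->
  \sum_(c < b) ce (x%:~R * (c%:R / b%:R)) = (if (b%:Z %| x)%Z then b%:R else 0) :> R[i].
Proof.
move=> b0; have bn0 : b%:R != 0 :> R by rewrite pnatr_eq0 -lt0n.
under eq_bigr => c _ do rewrite mulrCA ceMn.
case: ifP => [/dvdzP[k ->]|nd].
  rewrite (eq_bigr (fun=> 1)) ?sumr_const ?card_ord// => c _.
  by rewrite intrM -pmulrn mulfK// ce_int expr1n.
have zn1 : ce (x%:~R / b%:R : R) != 1.
  apply/eqP => /ce_eq1[k hk]; move/negP: nd; apply; apply/dvdzP; exists k.
  by apply: (@intr_inj R); rewrite intrM -hk -pmulrn divfK.
have := subrX1 (ce (x%:~R / b%:R : R)) b.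
rewrite -ceMn mulrC divfK// ce_int subrr => /esym/eqP.
by rewrite mulf_eq0 subr_eq0 (negbTE zn1) /= => /eqP.
Qed.

(** Since all values [Q i] are below [P], two of them congruent modulo [P] are equal, and the grid
    average separates the values exactly. *)
Lemma parseval (I : finType) (Q : I -> nat) (w : I -> R[i]) (P : nat) :
  (forall i, (Q i < P)%N) ->
  \sum_(b < P) (nc (\sum_i w i * ce ((Q i)%:R * (b%:R / P%:R))) ^+ 2) =
  P%:R * \sum_(p < P) (nc (\sum_(i | Q i == p) w i) ^+ 2) :> R.
Proof.
move=> hQ; have [P0|P0] := posnP P.
  by rewrite P0 !big_ord0 mulr0.
apply: complexI; rewrite rmorphM rmorph_nat !rmorph_sum /=.
have conjs (J : finType) (pr : pred J) (F : J -> R[i]) :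
    (\sum_(i | pr i) F i)^*%C = \sum_(i | pr i) (F i)^*%C by exact: (rmorph_sum (@conjc R)).
have conjM (z1 z2 : R[i]) : (z1 * z2)^*%C = z1^*%C * z2^*%C by exact: (rmorphM (@conjc R)).
transitivity (\sum_(b < P) \sum_i \sum_j w i * (w j)^*%C *
    ce (((Q i)%:Z - (Q j)%:Z)%:~R * (b%:R / P%:R))).
  apply: eq_bigr => b _; rewrite nc_sqr conjs mulr_suml; apply: eq_bigr => i _.
  rewrite mulr_sumr; apply: eq_bigr => j _.
  rewrite conjM -ceNconj mulrACA -ceD; congr (_ * ce _).
  by rewrite intrB -!pmulrn; ring.
rewrite exchange_big /=; under eq_bigr do rewrite exchange_big /=.
transitivity (\sum_i \sum_j (if Q i == Q j then P%:R * (w i * (w j)^*%C) else 0)).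
  apply: eq_bigr => i _; apply: eq_bigr => j _; rewrite -mulr_sumr char_orth//.
  have -> : (P%:Z %| (Q i)%:Z - (Q j)%:Z)%Z = (Q i == Q j).
    have hi := hQ i; have hj := hQ j.
    apply/idP/eqP => [/dvdzP[k hk]|->]; last by rewrite subrr dvdz0.
    have : k = 0 by move: (Q i) (Q j) hi hj hk; nia.
    by move=> k0; move: hk; rewrite k0 mul0r => /eqP; rewrite subr_eq0 => /eqP[].
  by case: ifP => _; rewrite ?mulr0// mulrC.
rewrite mulr_sumr.
transitivity (\sum_(p < P) \sum_(i | Q i == p) \sum_j (if Q i == Q j then P%:R * (w i * (w j)^*%C) else 0)).
  by rewrite (partition_big (fun i => Ordinal (hQ i)) xpredT).
apply: eq_bigr => p _; rewrite nc_sqr conjs mulr_suml mulr_sumr; apply: eq_bigr => i /eqP qi.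
rewrite !mulr_sumr -big_mkcond /=; apply: eq_bigl => j; by rewrite qi eq_sym.
Qed.

Definition Sxy (be lam mu : R) (b X Y : nat) (u : R) : R[i] :=
  \sum_(x <- zr X) \sum_(y <- zr Y)
    (gw lam x * gw mu y)%:C%C * ce (x%:~R * be + b%:R * x%:~R * y%:~R * u).

Lemma zr_multiples (V : nmodType) (b X : nat) (F : int -> V) : (0 < b)%N ->
  \sum_(x <- zr (b * X) | (b%:Z %| x)%Z) F x = \sum_(x <- zr X) F (b%:Z * x).
Proof.
move=> b0.
suff pe : perm_eq [seq x <- zr (b * X) | (b%:Z %| x)%Z] [seq b%:Z * x | x <- zr X].
  by rewrite -big_filter (perm_big _ pe) big_map.
apply: uniq_perm.
- by rewrite filter_uniq// zr_uniq.
- rewrite map_inj_uniq ?zr_uniq// => x y; apply: mulfI.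
  by case: b b0.
move=> x; rewrite mem_filter mem_zr; apply/andP/mapP => [[/dvdzP[k ->] h]|[k hk ->]].
  exists k; last by rewrite mulrC.
  by move: h; rewrite mem_zr abszM mulnC leq_pmul2l.
split; first by apply/dvdzP; exists k; rewrite mulrC.
by rewrite abszM leq_pmul2l// -mem_zr.
Qed.

(** [b x] runs through the multiples of [b], which the characters modulo [b] detect; each of them
    shifts the linear phase by [c / b]. *)
Lemma Sxy_Zf (be lam mu : R) (b X Y : nat) u : (0 < b)%N ->
  Sxy be lam mu b X Y u =
  \sum_(c < b) (b%:R^-1)%:C%C * Zf ((be + c%:R) / b%:R) (lam / b%:R ^+ 2) mu (b * X) Y u.
Proof.
move=> b0; have bn0 : b%:R != 0 :> R by rewrite pnatr_eq0 -lt0n.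
pose K (x : int) := \sum_(y <- zr Y) (gw (lam / b%:R ^+ 2) x * gw mu y)%:C%C *
  ce (x%:~R * be / b%:R + x%:~R * y%:~R * u).
transitivity (\sum_(x <- zr (b * X) | (b%:Z %| x)%Z) K x).
  rewrite zr_multiples//; apply: eq_bigr => x _; apply: eq_bigr => y _.
  rewrite /gw intrM -pmulrn; congr ((_ * _)%:C%C * ce _); last by field.
  by congr (expR (- _)); field.
rewrite -[RHS]mulr_sumr /Zf [X in _ = _ * X]exchange_big /= mulr_sumr [LHS]big_mkcond.
apply: eq_bigr => x _; rewrite [X in _ = _ * X]exchange_big /= mulr_sumr.
transitivity (\sum_(y <- zr Y) (b%:R^-1)%:C%C * ((gw (lam / b%:R ^+ 2) x * gw mu y)%:C%C *
  (ce (x%:~R * be / b%:R + x%:~R * y%:~R * u) * \sum_(c < b) ce (x%:~R * (c%:R / b%:R))))); last first.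
  apply: eq_bigr => y _; congr (_ * _); rewrite !mulr_sumr; apply: eq_bigr => c _.
  by congr (_ * _); rewrite -ceD; congr ce; field.
rewrite char_orth//; case: ifP => _; last by rewrite big1// => y _; rewrite !mulr0.
apply: eq_bigr => y _; rewrite /K.
have hb : (b%:R^-1)%:C%C * b%:R = 1 :> R[i].
  by rewrite -(rmorph_nat (real_complex R)) -rmorphM mulVf.
rewrite -[LHS]mul1r -[X in X * _ = _]hb; move: (_%:C%C) (ce _) ((gw _ _ * _)%:C%C) => z1 z2 z3.
by ring.
Qed.

(** [m' - m] and [- (m + m')] have the same parity, so the square of a theta sum gives a bilinear
    sum with this congruence. *)
Definition parity_sum (be lam a : R) (M : nat) (u : R) : R[i] :=
  \sum_(x <- zr (2 * M)) \sum_(y <- zr (2 * M) | (2 %| x - y)%Z)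
    (gw lam x * gw lam y)%:C%C * ce (x%:~R * be + a * x%:~R * y%:~R * u).

(** Adding 1/2 to [be] multiplies the terms by [(-1)^x]. Half the difference of the first two sums
    keeps the odd [x] with all [y]; the last sum, over even [y], adds the even [x] and removes the
    even [y] from the odd [x]. *)
Lemma parity_sum_Sxy (be lam : R) (a M : nat) u :
  parity_sum be lam a%:R M u =
  (2^-1)%:C%C * Sxy be lam lam a (2 * M) (2 * M) u
  - (2^-1)%:C%C * Sxy (be + 2^-1) lam lam a (2 * M) (2 * M) u
  + Sxy (be + 2^-1) lam (4 * lam) (2 * a) (2 * M) M u.
Proof.
rewrite /parity_sum /Sxy -mulrBr -sumrB mulr_sumr -big_split; apply: eq_bigr => x _ /=.
rewrite -sumrB.
pose F (y : int) := (gw lam x * gw lam y)%:C%C * ce (x%:~R * be + a%:R * x%:~R * y%:~R * u).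
have -> : \sum_(y <- zr M) (gw lam x * gw (4 * lam) y)%:C%C *
    ce (x%:~R * (be + 2^-1) + (2 * a)%:R * x%:~R * y%:~R * u) =
    \sum_(y <- zr (2 * M) | (2%:Z %| y)%Z) ce (x%:~R / 2) * F y.
  rewrite (@zr_multiples _ 2 M (fun y => ce (x%:~R / 2) * F y))//.
  apply: eq_bigr => y _; rewrite /F mulrCA -ceD /gw intrM natrM.
  congr ((_ * _)%:C%C * ce _); last by rewrite -[2%:~R]/(2%:R); field.
  by congr (expR (- _)); rewrite -[2%:~R]/(2%:R); ring.
rewrite big_mkcond [X in _ = _ + X]big_mkcond mulr_sumr -big_split /=; apply: eq_bigr => y _.
rewrite -mulrBr -/(F y).
have -> : ce (x%:~R * (be + 2^-1) + a%:R * x%:~R * y%:~R * u) =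
    ce (x%:~R / 2) * ce (x%:~R * be + a%:R * x%:~R * y%:~R * u).
  by rewrite -ceD; congr ce; ring.
set G := ce (_ + _); set W := (gw _ _ * _)%:C%C.
have half : (2^-1)%:C%C * 2 = 1 :> R[i].
  by rewrite -(rmorph_nat (real_complex R)) -rmorphM mulVf.
have hpi : ce (2^-1 : R) = -1.
  rewrite /ce /expi (_ : 2 * pi * 2^-1 = pi); last by field.
  by rewrite cospi sinpi; apply/eqP; rewrite eq_complex /= oppr0 !eqxx.
have [k [hk|hk]] : exists k : int, x = 2 * k \/ x = 2 * k + 1.
  by exists (x %/ 2)%Z; case: (x) => m; lia.
- have -> : ce (x%:~R / 2 : R) = 1.
    by rewrite hk intrM -[2%:~R]/(2%:R) mulrC mulKf// ce_int.
  have -> : (2 %| x - y)%Z = (2%:Z %| y)%Z by rewrite hk; lia.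
  by rewrite mul1r subrr !mulr0 add0r mul1r; case: ifP.
have -> : ce (x%:~R / 2 : R) = -1.
  have -> : x%:~R / 2 = 2^-1 + k%:~R :> R.
    by rewrite hk intrD intrM -[2%:~R]/(2%:R); field.
  by rewrite ceDint.
have -> : (2 %| x - y)%Z = ~~ (2%:Z %| y)%Z by rewrite hk; lia.
have e : (2^-1)%:C%C * (W * (G - -1 * G)) = W * G.
  transitivity ((2^-1)%:C%C * 2 * (W * G)); last by rewrite half mul1r.
  by move: (_%:C%C) => z1; ring.
rewrite e; case: (2%:Z %| y)%Z => /=; last by rewrite addr0.
by rewrite mulN1r; apply/esym; exact: subrr.
Qed.

End characters.

Section theta_square.
Context {R : realType}.

Definition thetaM (lam a al : R) (M : nat) (u : R) : R[i] :=
  \sum_(m <- zr M) (gw lam m)%:C%C * ce (a * m%:~R ^+ 2 * u - m%:~R * al).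

Lemma size_zr M : size (zr M) = (M.*2).+1.
Proof. by rewrite size_map size_iota. Qed.

Lemma nc_thetaM (lam a al : R) M u : 0 <= lam -> nc (thetaM lam a al M u) <= (M.*2).+1%:R.
Proof.
move=> l0; apply: (le_trans (nc_sum _ _ _)).
apply: le_trans (_ : \sum_(m <- zr M) 1 <= _).
  by apply: ler_sum => m _; rewrite ncM nc_ce mulr1 nc_real ger0_norm ?gw_ge0// gw_le1.
by rewrite big_const_seq count_predT size_zr iter_addr addr0.
Qed.

(** [m ^ 2 - m' ^ 2 = x y] and [2 (m ^ 2 + m' ^ 2) = x ^ 2 + y ^ 2], hence the weight [2 lam] in the
    theta sum. The square [|m|, |m'| <= M] becomes a diamond; points of the box outside it satisfy
    [x ^ 2 + y ^ 2 >= 2 M ^ 2]. *)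
Lemma theta_sq (lam a al : R) M u : 0 <= lam ->
  nc ((nc (thetaM (2 * lam) a al M u) ^+ 2)%:C%C - parity_sum al lam a M u) <=
  ((2 * M).*2).+1%:R ^+ 2 * expR (- (2 * lam * M%:R ^+ 2)).
Proof.
move=> l0.
pose H (p : int * int) : R[i] := (gw lam p.1 * gw lam p.2)%:C%C * ce (p.1%:~R * al + a * p.1%:~R * p.2%:~R * u).
pose phi (p : int * int) := (p.2 - p.1, - (p.1 + p.2)).
pose LM := [seq (m, m') | m <- zr M, m' <- zr M].
pose L2 := [seq (x, y) | x <- zr (2 * M), y <- zr (2 * M)].
pose par (p : int * int) := (2 %| p.1 - p.2)%Z.
pose good (p : int * int) := (`|(p.1 + p.2)%R| <= 2 * M)%N && (`|(p.1 - p.2)%R| <= 2 * M)%N.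
have inLM p : (p \in LM) = (`|p.1| <= M)%N && (`|p.2| <= M)%N.
  case: p => x y; apply/allpairsP/andP => [[[x' y'] /= [h1 h2 [-> ->]]]|[h1 h2]].
    by rewrite -!mem_zr.
  by exists (x, y); rewrite /= !mem_zr.
have inL2 p : (p \in L2) = (`|p.1| <= 2 * M)%N && (`|p.2| <= 2 * M)%N.
  case: p => x y; apply/allpairsP/andP => [[[x' y'] /= [h1 h2 [-> ->]]]|[h1 h2]].
    by rewrite -!mem_zr.
  by exists (x, y); rewrite /= !mem_zr.
have uL2 : uniq L2.
  by apply: allpairs_uniq; rewrite ?zr_uniq// => [[? ?] [? ?]] _ _ [-> ->].
have uLM : uniq LM.
  by apply: allpairs_uniq; rewrite ?zr_uniq// => [[? ?] [? ?]] _ _ [-> ->].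
have phi_inj : injective phi.
  move=> [m m'] [k k'] [] /= e1 e2; congr (_, _).
    by move: e1 e2; clear; lia.
  by move: e1 e2; clear; lia.
have e1 : parity_sum al lam a M u = \sum_(p <- L2 | par p) H p.
  rewrite /L2 [RHS]big_mkcond big_allpairs_dep /= /parity_sum; apply: eq_bigr => x _.
  by rewrite big_mkcond.
have conjM (z1 z2 : R[i]) : (z1 * z2)^*%C = z1^*%C * z2^*%C by exact: (rmorphM (@conjc R)).
have conjs (s : seq int) (F : int -> R[i]) :
    (\sum_(i <- s) F i)^*%C = \sum_(i <- s) (F i)^*%C by exact: (rmorph_sum (@conjc R)).
have conjr (r : R) : (r%:C%C)^*%C = r%:C%C :> R[i] by rewrite /= oppr0.
have e2 : (nc (thetaM (2 * lam) a al M u) ^+ 2)%:C%C = \sum_(p <- LM) H (phi p).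
  rewrite nc_sqr /thetaM conjs big_allpairs_dep mulr_suml; apply: eq_bigr => m _.
  rewrite mulr_sumr; apply: eq_bigr => m' _.
  rewrite conjM conjr -ceNconj mulrACA -ceD -rmorphM; congr (_%:C%C * ce _).
    rewrite /gw /phi /= -!expRD; congr expR; rewrite intrB intrN intrD; ring.
  by rewrite /phi /= intrB intrN intrD; ring.
have pe : perm_eq [seq p <- L2 | par p && good p] (map phi LM).
  apply: uniq_perm; rewrite ?filter_uniq// ?map_inj_uniq// => -[x y].
  rewrite mem_filter inL2; apply/idP/mapP.
    rewrite /par /good /= => /andP[/andP[/dvdzP[k hk] /andP[g1 g2]] _].
    exists (- y - k, k); last by rewrite /phi /=; congr (_, _); move: hk; clear; lia.
    by rewrite inLM /=; move: hk g1 g2; clear; lia.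
  case=> -[m m']; rewrite inLM /par /good /= => /andP[h1 h2] [-> ->].
  rewrite (_ : (2 %| _)%Z = true) /=; last by apply/dvdzP; exists m'; clear; lia.
  by move: h1 h2; clear; lia.
have e3 : \sum_(p <- L2 | par p && good p) H p = \sum_(p <- LM) H (phi p).
  by rewrite -big_filter (perm_big _ pe) big_map.
rewrite e1 (bigID good) e3 e2 opprD addrA subrr sub0r ncN.
apply: (le_trans (nc_sum _ _ _)).
apply: le_trans (_ : \sum_(p <- L2) expR (- (2 * lam * M%:R ^+ 2)) <= _); last first.
  rewrite big_const_seq count_predT size_allpairs !size_zr iter_addr addr0.
  by rewrite -[leLHS]mulr_natl natrM expr2.
rewrite big_mkcond /= big_seq [leRHS]big_seq; apply: ler_sum => -[x y] _.
case: ifP => [/andP[_ ng]|_]; last exact: expR_ge0.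
rewrite /H /= ncM nc_ce mulr1 nc_real ger0_norm ?mulr_ge0 ?gw_ge0// /gw -expRD ler_expR.
have sq (z : int) : ~~ (`|z| <= 2 * M)%N -> (2 * M%:R) ^+ 2 <= z%:~R ^+ 2 :> R.
  rewrite -ltnNge => /ltnW h; rewrite -[z%:~R ^+ 2]real_normK ?num_real// -intr_norm -natr_absz.
  by rewrite lerXn2r ?nnegrE// -natrM ler_nat.
have : 2 * M%:R ^+ 2 <= x%:~R ^+ 2 + y%:~R ^+ 2 :> R.
  move: ng; rewrite /good /= negb_and => /orP[/sq|/sq].
    by rewrite intrD; have := sqr_ge0 (x%:~R - y%:~R : R); nra.
  by rewrite intrB; have := sqr_ge0 (x%:~R + y%:~R : R); nra.
move=> h; have := ler_wpM2l l0 h; lra.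
Qed.

Lemma nc_parity_sum (lam a al : R) M u : 0 <= lam ->
  nc (parity_sum al lam a M u) <= ((2 * M).*2).+1%:R ^+ 2.
Proof.
move=> l0; apply: (le_trans (nc_sum _ _ _)).
apply: le_trans (_ : \sum_(x <- zr (2 * M)) ((2 * M).*2).+1%:R <= _); last first.
  by rewrite big_const_seq count_predT size_zr iter_addr addr0 -[leLHS]mulr_natl expr2.
apply: ler_sum => x _; apply: (le_trans (nc_sum _ _ _)).
apply: le_trans (_ : \sum_(y <- zr (2 * M)) 1 <= _); last first.
  by rewrite big_const_seq count_predT size_zr iter_addr addr0.
rewrite big_mkcond; apply: ler_sum => y _; case: ifP => // _.
rewrite ncM nc_ce mulr1 nc_real ger0_norm ?mulr_ge0 ?gw_ge0//.
by rewrite mulr_ile1 ?gw_ge0 ?gw_le1.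
Qed.

Section pieces.
Variables (BB : nat).
(* [parity_sum_Sxy] removes the parity condition, and [Sxy_Zf] the factor [b = a] or [2 a] of
   [x y u]; a piece [(t, c)] is the [c]-th term of [Sxy_Zf] in the [t]-th term of
   [parity_sum_Sxy], with [c] ranging over a type independent of [a] and coefficient 0 when
   [c] is too large. *)
Definition piece := ('I_3 * 'I_BB)%type.
Definition pbb (a : nat) (p : piece) : nat := if p.1 == 2 :> nat then (2 * a)%N else a.
Definition psh (p : piece) : R := (if p.1 == 0%N :> nat then 0 else 2^-1) + (p.2 : nat)%:R.
Definition psg (p : piece) : R := if p.1 == 1%N :> nat then -1 else 1.
Definition pcoef (a : nat) (p : piece) : R :=
  if ((p.2 : nat) < pbb a p)%N then psg p / (2 * a%:R) else 0.
Definition pal (a : nat) (al : R) (p : piece) : R := (al + psh p) / (pbb a p)%:R.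
Definition plam (a : nat) (lam : R) (p : piece) : R := lam / (pbb a p)%:R ^+ 2.
Definition pmu (lam : R) (p : piece) : R := if p.1 == 2 :> nat then 4 * lam else lam.
Definition pX (a M : nat) (p : piece) : nat := (pbb a p * (2 * M))%N.
Definition pY (M : nat) (p : piece) : nat := if p.1 == 2 :> nat then M else (2 * M)%N.

Lemma sum_piece (V : nmodType) (F : piece -> V) :
  \sum_p F p = \sum_(c < BB) F (ord0, c) + \sum_(c < BB) F (inord 1, c) + \sum_(c < BB) F (inord 2, c).
Proof.
transitivity (\sum_(t < 3) \sum_(c < BB) F (t, c)).
  by rewrite pair_bigA; apply: eq_bigr => -[].
rewrite !big_ord_recl big_ord0 addr0 addrA.
by congr (_ + _ + _); apply: eq_bigr => c _; congr (F (_, _)); apply: val_inj; rewrite /= inordK.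
Qed.

Lemma parity_sum_pieces (al lam : R) (a M : nat) u : (0 < a)%N -> (2 * a <= BB)%N ->
  parity_sum al lam a%:R M u =
  \sum_p (pcoef a p)%:C%C * Zf (pal a al p) (plam a lam p) (pmu lam p) (pX a M p) (pY M p) u.
Proof.
move=> a0 aB; have an0 : a%:R != 0 :> R by rewrite pnatr_eq0 -lt0n.
rewrite parity_sum_Sxy !Sxy_Zf ?muln_gt0// sum_piece.
have wid b (F : nat -> R[i]) (k : R) : (b <= BB)%N ->
    k%:C%C * \sum_(c < b) F c = \sum_(c < BB) (if (c < b)%N then k else 0)%:C%C * F c.
  move=> bB; rewrite (big_ord_widen _ F bB) mulr_sumr big_mkcond; apply: eq_bigr => c _.
  by case: ifP => _; rewrite // mul0r.
have aB' : (a <= BB)%N by apply: leq_trans aB; rewrite leq_pmull.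
congr (_ + _ + _).
- rewrite -mulr_sumr mulrA -rmorphM (_ : 2^-1 * a%:R^-1 = 1 / (2 * a%:R)); last by field.
  rewrite (wid a (fun c => Zf ((al + c%:R) / a%:R) (lam / a%:R ^+ 2) lam (a * (2 * M)) (2 * M) u))//.
  apply: eq_bigr => c _; rewrite /pcoef /psg /pal /plam /pmu /pX /pY /pbb /psh /= add0r.
  by [].
- rewrite -mulr_sumr mulrA -rmorphM -mulNr -rmorphN (_ : - (2^-1 * a%:R^-1) = -1 / (2 * a%:R)); last by field.
  rewrite (wid a (fun c => Zf ((al + 2^-1 + c%:R) / a%:R) (lam / a%:R ^+ 2) lam (a * (2 * M)) (2 * M) u))//.
  apply: eq_bigr => c _; rewrite /pcoef /psg /pal /plam /pmu /pX /pY /pbb /psh /= inordK//= addrA.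
  by [].
rewrite -mulr_sumr (wid (2 * a)%N (fun c => Zf ((al + 2^-1 + c%:R) / (2 * a)%:R) (lam / (2 * a)%:R ^+ 2) (4 * lam) (2 * a * (2 * M)) M u))//.
apply: eq_bigr => c _; rewrite /pcoef /psg /pal /plam /pmu /pX /pY /pbb /psh /= inordK//= addrA.
by rewrite -[2 * a%:R]natrM div1r.
Qed.

(** The main terms of the first two kinds of pieces cancel; the third kind, averaged over its [2 a]
    residues, leaves the sum over even [y = 2 z], as the parity condition at [x = 0] demands. *)
Lemma piece_main (lam : R) (a M : nat) : (0 < a)%N -> (2 * a <= BB)%N ->
  \sum_p (pcoef a p)%:C%C * Kf (pmu lam p) (pY M p) 0 = (\sum_(z <- zr M) gw (4 * lam) z)%:C%C.
Proof.
move=> a0 aB; have an0 : a%:R != 0 :> R by rewrite pnatr_eq0 -lt0n.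
have aB' : (a <= BB)%N by apply: leq_trans aB; rewrite leq_pmull.
have wid b (k : R) : (b <= BB)%N -> \sum_(c < BB) (if (c < b)%N then k else 0)%:C%C = (b%:R * k)%:C%C :> R[i].
  move=> bB; rewrite -rmorph_sum -big_mkcond -(big_ord_widen _ (fun=> k) bB) sumr_const card_ord.
  by rewrite mulr_natl.
rewrite sum_piece /pcoef /psg /pmu /pY /pbb /= -!mulr_suml !inordK//= !wid//.
rewrite mulN1r.
rewrite (_ : a%:R * (1 / (2 * a%:R)) = 2^-1); last by field.
rewrite (_ : a%:R * (- (2 * a%:R)^-1) = - 2^-1); last by field.
rewrite (_ : (2 * a)%:R * (1 / (2 * a%:R)) = 1); last by rewrite natrM; field.
rewrite rmorphN mulNr subrr add0r mul1r /Kf rmorph_sum; apply: eq_bigr => z _.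
by rewrite mulr0 ce0 mulr1.
Qed.

End pieces.
End theta_square.

Section average.
Context {R : realType}.

Definition half_shift (al : R) (s : int) (b : nat) : R := (al + s%:~R / 2) / b%:R.

(** Multiplied by 2 and by all the [b k], a relation becomes one between the [al j] and 1. *)
Lemma no_relation_half_shift n (al : 'I_n -> R) (s : 'I_n -> int) (b : 'I_n -> nat) :
  (forall j, (0 < b j)%N) -> no_relation al ->
  no_relation (fun j => half_shift (al j) (s j) (b j)).
Proof.
move=> b0 hal c d hcd j.
pose Bj i : int := \prod_(k | k != i) (b k)%:Z.
have hb k : (b k)%:R != 0 :> R by rewrite pnatr_eq0 -lt0n.
have := hal (fun i => 2 * c i * Bj i) (2 * (\prod_k (b k)%:Z) * d - \sum_i c i * s i * Bj i) _ j.
have -> : \sum_i (2 * c i * Bj i)%:~R * al i =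
  (2 * (\prod_k (b k)%:Z) * d - \sum_i c i * s i * Bj i)%:~R.
  rewrite intrB !intrM -hcd mulr_sumr rmorph_sum /= -sumrB; apply: eq_bigr => i _.
  rewrite (bigD1 i)//= -/(Bj i) !intrM /half_shift -[(b i)%:~R]/((b i)%:R).
  by field.
move=> /(_ erefl)/eqP; rewrite !mulf_eq0 /= => /orP[/eqP//|].
move=> /prodf_eq0[k _]; by rewrite eqz_nat -leqn0 leqNgt b0.
Qed.

(** Approximation of the shifted numbers with denominator [q] is approximation of [al] with
    denominator [2 q]: this costs [2 ^ tau], and clearing [2 b j] costs [2 B]. *)
Lemma badly_half_shift n (al : 'I_n -> R) (s : 'I_n -> int) (b : 'I_n -> nat) c0 tau (B : nat) :
  0 < c0 -> (forall j, (0 < b j <= B)%N) -> badly al c0 tau ->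
  badly (fun j => half_shift (al j) (s j) (b j)) (c0 / (2 `^ tau * (2 * B%:R))) tau.
Proof.
move=> c00 hb hal q q0; have [|j hj] := hal (2 * q)%N; first by rewrite muln_gt0.
exists j => k; have /andP[b0 bB] := hb j.
have bp : 0 < (b j)%:R :> R by rewrite ltr0n.
have Bp : 0 < B%:R :> R by rewrite ltr0n (leq_trans b0).
have := hj (2 * (b j)%:Z * k - q%:Z * s j).
have -> : (2 * q)%:R * al j - (2 * (b j)%:Z * k - q%:Z * s j)%:~R =
    (2 * (b j)%:R) * (q%:R * half_shift (al j) (s j) (b j) - k%:~R).
  rewrite intrB !intrM natrM /half_shift -[(b j)%:~R]/((b j)%:R) -[(q%:Z)%:~R]/(q%:R); field.
  by rewrite gt_eqF.
rewrite normrM (gtr0_norm (mulr_gt0 _ _))// natrM powRM// => h.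
set w := `|_| in h *; have w0 : 0 <= w by exact: normr_ge0.
have p2 : 0 < 2 `^ tau :> R by exact: powR_gt0.
have pq : 0 < q%:R `^ tau :> R by rewrite powR_gt0 ?ltr0n.
have : c0 / (2 `^ tau * q%:R `^ tau) <= 2 * B%:R * w.
  by apply: (le_trans h); rewrite ler_wpM2r// ler_wpM2l// ler_nat.
rewrite -ler_pdivrMl ?mulr_gt0// => h2; apply: le_trans h2.
by rewrite le_eqVlt; apply/orP; left; apply/eqP; field; rewrite !gt_eqF.
Qed.

(** Twice [psh], as a natural number. *)
Definition psh2 BB (p : piece BB) : nat :=
  if p.1 == 0%N :> nat then (2 * p.2)%N else (2 * p.2).+1.

Lemma pal_half_shift BB (a : nat) (al : R) (p : piece BB) :
  pal a al p = half_shift al (psh2 p) (pbb a p).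
Proof.
rewrite /psh2 /pal /half_shift /psh; congr ((_ + _) / _); case: ifP => _.
  by rewrite -[_%:~R]/((2 * p.2)%N%:R) natrM mulrC mulKf ?add0r.
rewrite (_ : (2 * p.2).+1%:~R = 1 + 2 * p.2%:R :> R); first by field.
by rewrite -[_.+1%:~R]/((2 * p.2).+1%N%:R) mulrSr natrM addrC.
Qed.

Lemma pbb_bounds BB a (p : piece BB) : (0 < a)%N -> (2 * a <= BB)%N -> (0 < pbb a p <= BB)%N.
Proof. rewrite /pbb; case: ifP => _; lia. Qed.

Lemma nc_pcoef BB a (p : piece BB) : (0 < a)%N -> nc (pcoef a p)%:C%C <= 1 :> R.
Proof.
move=> a0; rewrite nc_real /pcoef; case: ifP => _; last by rewrite normr0.
rewrite normrM normfV (ger0_norm (mulr_ge0 _ _))//.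
have -> : `|psg p| = 1 :> R by rewrite /psg; case: ifP => _; rewrite ?normrN normr1.
by rewrite div1r invf_le1 ?mulr_gt0 ?ltr0n// -natrM ler1n muln_gt0.
Qed.

(** Expanding over the pieces of every coordinate gives finitely many [Zprod], a number that depends
    only on [a] and [n], with coefficients of modulus at most 1. The rational shifts and scalings
    preserve the hypotheses of [avg_Zprod] with changed constants. *)
Lemma avg_parity n (al : 'I_n -> R) (a : 'I_n -> nat) (c1 c2 c0 tau eps : R) :
  (1 < n)%N -> (forall j, (0 < a j)%N) -> 0 < c1 -> 0 < c2 ->
  0 < c0 -> 0 < tau -> (n.-1%:R - 1) * tau < 1 -> badly al c0 tau -> no_relation al ->
  0 < eps ->
  exists L0 : nat, forall (L P M : nat) (lam : 'I_n -> R),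
  (L0 < L)%N -> (L ^ 2 <= P)%N -> (forall q, (0 < q <= L)%N -> (q %| P)%N) ->
  scaled c1 c2 L lam -> (L ^ 2 <= M)%N ->
  nc (\sum_(b < P) \prod_j parity_sum (al j) (lam j) (a j)%:R M (b%:R / P%:R)
      - (\prod_j \sum_(z <- zr M) gw (4 * lam j) z)%:C%C *+ P)
    <= eps * P%:R * L%:R ^+ n.
Proof.
move=> n1 a0 c10 c20 c00 tau0 ht hb hal eps0.
pose BB := (2 * \max_j a j)%N.
have aB j : (2 * a j <= BB)%N by rewrite leq_mul2l /=; exact: (leq_bigmax j).
have B0 : (0 < BB)%N by apply: leq_trans (aB (Ordinal (ltnW n1))); rewrite muln_gt0 a0.
pose FT : finType := {ffun 'I_n -> piece BB}.
have c1' : 0 < c1 / BB%:R ^+ 2 by rewrite divr_gt0// exprn_gt0// ltr0n.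
have c2' : 0 < 4 * c2 by rewrite mulr_gt0.
have epsF : 0 < eps / (#|FT|%:R + 1) by rewrite divr_gt0// ltr_wpDl.
pose albf (f : FT) j := pal (a j) (al j) (f j).
have hL (f : FT) := @avg_Zprod R n (albf f) _ _ (c0 / (2 `^ tau * (2 * BB%:R))) tau _ n1 c1' c2'
  (divr_gt0 c00 (mulr_gt0 (powR_gt0 _ (ltr0Sn _ 1)) (mulr_gt0 (ltr0Sn _ 1) (etrans (ltr0n _ _) B0)))) tau0 ht.
have badf f : badly (albf f) (c0 / (2 `^ tau * (2 * BB%:R))) tau.
  rewrite (_ : albf f = fun j => half_shift (al j) (psh2 (f j)) (pbb (a j) (f j))); last by apply/funext => j; exact: pal_half_shift.
  have := @badly_half_shift _ al (fun j => psh2 (f j)) (fun j => pbb (a j) (f j)) c0 tau BB.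
  by apply => // j; exact: pbb_bounds.
have norf f : no_relation (albf f).
  rewrite (_ : albf f = fun j => half_shift (al j) (psh2 (f j)) (pbb (a j) (f j))); last by apply/funext => j; exact: pal_half_shift.
  have := @no_relation_half_shift _ al (fun j => psh2 (f j)) (fun j => pbb (a j) (f j)).
  by apply => // j; have /andP[] := pbb_bounds (f j) (a0 j) (aB j).
have {hL} /choice[L0 hL0] := fun f => hL _ f (badf f) (norf f) epsF.
exists (\max_(f : FT) L0 f)%N => L P M lam LL LP hP sl LM.
have LLf f : (L0 f < L)%N by apply: leq_ltn_trans LL; exact: (leq_bigmax f).
have L_gt0 : (0 < L)%N by exact: leq_ltn_trans LL.
have lamp j : 0 < lam j by exact: scaled_gt0 sl.
have sB1 : 1 <= BB%:R ^+ 2 :> R by rewrite exprn_ege1// ler1n.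
have lef f : nc (\sum_(b < P) Zprod (albf f) (fun j => plam (a j) (lam j) (f j))
     (fun j => pmu (lam j) (f j)) (fun j => pX (a j) M (f j)) (fun j => pY M (f j)) (b%:R / P%:R)
     - Kprod (fun j => pmu (lam j) (f j)) (fun j => pY M (f j)) *+ P)
   <= eps / (#|FT|%:R + 1) * P%:R * L%:R ^+ n.
  apply: hL0 => //.
  - move=> j; have /andP[h1 h2] := sl j; have /andP[b1 b2] := pbb_bounds (f j) (a0 j) (aB j).
    have b1' : 1 <= (pbb (a j) (f j))%:R ^+ 2 :> R by rewrite exprn_ege1// ler1n.
    have b2' : (pbb (a j) (f j))%:R ^+ 2 <= BB%:R ^+ 2 :> R by rewrite lerXn2r ?nnegrE// ler_nat.
    rewrite /plam mulrAC; apply/andP; split.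
      apply: le_trans (_ : c1 / (pbb (a j) (f j))%:R ^+ 2 <= _).
        by rewrite ler_pM2l// lef_pV2 ?posrE// exprn_gt0 ?ltr0n.
      by rewrite ler_wpM2r ?invr_ge0.
    rewrite ler_pdivrMr ?exprn_gt0 ?ltr0n//; apply: (le_trans h2).
    by rewrite -[leLHS]mulr1; apply: ler_pM; rewrite ?(ltW c20)//; lra.
  - move=> j; have /andP[h1 h2] := sl j.
    have : lam j * L%:R ^+ 2 <= pmu (lam j) (f j) * L%:R ^+ 2 <= 4 * (lam j * L%:R ^+ 2).
      by rewrite /pmu; have := lamp j; have := sqr_ge0 (L%:R : R); case: ifP => _ *; apply/andP; split; nra.
    move=> /andP[g1 g2]; apply/andP; split; last by lra.
    apply: le_trans g1; apply: le_trans h1; rewrite ler_pdivrMr ?exprn_gt0 ?ltr0n//.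
    by rewrite ler_peMr ?(ltW c10).
  - move=> j; rewrite /pX; apply: (leq_trans LM).
    have /andP[b1 b2] := pbb_bounds (f j) (a0 j) (aB j).
    by rewrite mulnA; apply: leq_pmull; rewrite muln_gt0 b1.
  - by move=> j; rewrite /pY; apply: (leq_trans LM); case: ifP => _; rewrite ?leq_pmull.
pose cf (f : FT) : R[i] := \prod_j (pcoef (a j) (f j))%:C%C.
have E1 b : \prod_j parity_sum (al j) (lam j) (a j)%:R M b =
    \sum_f cf f * Zprod (albf f) (fun j => plam (a j) (lam j) (f j))
     (fun j => pmu (lam j) (f j)) (fun j => pX (a j) M (f j)) (fun j => pY M (f j)) b.
  rewrite (eq_bigr _ (fun j _ => parity_sum_pieces _ _ _ _ (a0 j) (aB j))) bigA_distr_bigA /=.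
  by apply: eq_bigr => f _; rewrite -big_split.
have E2 : (\prod_j \sum_(z <- zr M) gw (4 * lam j) z)%:C%C =
    \sum_f cf f * Kprod (fun j => pmu (lam j) (f j)) (fun j => pY M (f j)).
  rewrite rmorph_prod /= (eq_bigr _ (fun j _ => esym (piece_main _ _ (a0 j) (aB j)))) bigA_distr_bigA /=.
  by apply: eq_bigr => f _; rewrite -big_split.
rewrite (eq_bigr _ (fun b _ => E1 _)) exchange_big /= E2 -sumrMnl -sumrB.
apply: (le_trans (nc_sum _ _ _)).
apply: le_trans (_ : \sum_(f : FT) eps / (#|FT|%:R + 1) * P%:R * L%:R ^+ n <= _).
  apply: ler_sum => f _; rewrite -mulr_sumr -mulrnAr -mulrBr ncM.
  apply: le_trans (lef f); apply: ler_piMl; first exact: nc_ge0.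
  by rewrite nc_prod; apply: prodr_ile1 => j; rewrite nc_ge0 nc_pcoef.
rewrite sumr_const -[leLHS]mulr_natl !mulrA ler_wpM2r ?exprn_ge0// ler_wpM2r//.
by rewrite ler_pdivrMr ?ltr_wpDl// mulrC ler_wpM2l ?(ltW eps0)// lerDl.
Qed.

End average.

(** * Damped sums over boxes of lattice points *)

Section laplace.
Context {R : realType}.

Lemma poly_gauss_small (c K eps : R) (k : nat) : 0 < c -> 0 <= K -> 0 < eps ->
  exists L1 : nat, forall L : nat, (L1 < L)%N -> K * L%:R ^+ (2 * k) * expR (- (c * L%:R ^+ 2)) <= eps.
Proof.
move=> c0 K0 eps0; pose d := (c / k.+1%:R) ^+ k.+1.
have d0 : 0 < d by rewrite exprn_gt0 ?divr_gt0.
have [L1 hL1] := natr_unbounded (K / (d * eps)).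
exists L1.+1 => L LL; have L1' : 1 <= L%:R :> R by rewrite ler1n; apply: leq_ltn_trans LL.
have Lp : 0 < L%:R :> R by lra.
rewrite expRN ler_pdivrMr ?expR_gt0//.
have h1 : d * (L%:R ^+ (2 * k) * L%:R) <= expR (c * L%:R ^+ 2).
  apply: le_trans (_ : d * (L%:R ^+ 2) ^+ k.+1 <= _).
    rewrite ler_wpM2l ?(ltW d0)// -exprM -exprSr.
    by rewrite ler_weXn2l//; lia.
  rewrite -exprMn (_ : c * L%:R ^+ 2 = k.+1%:R * (c / k.+1%:R * L%:R ^+ 2)); last first.
    by field; rewrite ?natr1 ?nat1r pnatr_eq0.
  rewrite expRM_natl lerXn2r ?nnegrE ?expR_ge0 ?mulr_ge0 ?exprn_ge0 ?invr_ge0 ?(ltW c0)//.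
  by apply: le_trans (expR_ge1Dx _); rewrite lerDr.
apply: le_trans (_ : eps * (d * (L%:R ^+ (2 * k) * L%:R)) <= _); last by rewrite ler_wpM2l// ltW.
have : K <= d * eps * L%:R.
  move: hL1; rewrite ltr_pdivrMr ?mulr_gt0// => /ltW h; apply: (le_trans h).
  rewrite mulrC ler_wpM2l ?(ltW (mulr_gt0 _ _))// ler_nat; exact: ltnW.
move=> /(ler_wpM2r (exprn_ge0 (2 * k) (ltW Lp))) h; apply: (le_trans h).
by rewrite le_eqVlt; apply/orP; left; apply/eqP; ring.
Qed.

(** Integer points with coordinates of size at most [M], stored as offsets that [zv] decodes; as a
    finite function type it lets products over coordinates distribute over sums. *)
Definition box n (M : nat) : finType := {ffun 'I_n -> 'I_(M.*2).+1}.
Definition zv M (i : 'I_(M.*2).+1) : int := i%:Z - M%:Z.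
Definition QB n (a : 'I_n -> nat) M (f : box n M) : nat := \sum_j a j * `|zv (f j)| ^ 2.
Definition rB n (al : 'I_n -> R) (a : 'I_n -> nat) M (p : nat) : R[i] :=
  \sum_(f : box n M | QB a f == p) ce (- \sum_j (zv (f j))%:~R * al j).
Definition vB n (a : 'I_n -> nat) M (p : nat) : nat := \sum_(f : box n M | QB a f == p) 1.

Lemma QB_real n (a : 'I_n -> nat) M (f : box n M) :
  (QB a f)%:R = \sum_j (a j)%:R * (zv (f j))%:~R ^+ 2 :> R.
Proof.
rewrite natr_sum; apply: eq_bigr => j _; rewrite natrM natrX natr_absz intr_norm.
by rewrite real_normK ?num_real.
Qed.

Lemma prod_gw n (a : 'I_n -> nat) M (f : box n M) (th : R) :
  \prod_j gw (th * (a j)%:R) (zv (f j)) = expR (- (th * (QB a f)%:R)).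
Proof.
rewrite QB_real mulr_sumr -sumrN expR_sum; apply: eq_bigr => j _.
by rewrite /gw -mulrA.
Qed.

Lemma prod_gauss n (a : 'I_n -> nat) M (th : R) P : (forall f : box n M, QB a f < P)%N ->
  \prod_j \sum_(z <- zr M) gw (th * (a j)%:R) z = \sum_(p < P) expR (- (th * p%:R)) * (vB a M p)%:R.
Proof.
move=> hP; under eq_bigr do rewrite sum_zr_ord.
rewrite bigA_distr_bigA /=.
under eq_bigr => f _ do rewrite (prod_gw a f th).
rewrite (partition_big (fun f => Ordinal (hP f)) xpredT)//=; apply: eq_bigr => p _.
rewrite /vB natr_sum mulr_sumr; apply: eq_big => [f|f /eqP <-]; last by rewrite mulr1.
by rewrite -val_eqE.
Qed.

Lemma prod_theta n (al : 'I_n -> R) (a : 'I_n -> nat) M (th u : R) :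
  \prod_j thetaM (th * (a j)%:R) (a j)%:R (al j) M u =
  \sum_(f : box n M) ((expR (- (th * (QB a f)%:R)))%:C%C * ce (- \sum_j (zv (f j))%:~R * al j)) *
     ce ((QB a f)%:R * u).
Proof.
rewrite /thetaM; under eq_bigr do rewrite sum_zr_ord.
rewrite bigA_distr_bigA /=; apply: eq_bigr => f _.
rewrite big_split /= -rmorph_prod /= prod_gw -mulrA; congr (_ * _).
rewrite -ceD -ce_sum; congr ce; rewrite QB_real mulr_suml addrC -sumrB.
by apply: eq_bigr => j _.
Qed.

Lemma parseval_theta n (al : 'I_n -> R) (a : 'I_n -> nat) M (th : R) P :
  (forall f : box n M, QB a f < P)%N ->
  \sum_(b < P) \prod_j nc (thetaM (th / 2 * (a j)%:R) (a j)%:R (al j) M (b%:R / P%:R)) ^+ 2 =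
  P%:R * \sum_(p < P) expR (- (th * p%:R)) * nc (rB al a M p) ^+ 2.
Proof.
move=> hP.
under eq_bigr => b _ do rewrite prodrXl -nc_prod prod_theta.
rewrite (parseval _ hP); congr (_ * _); apply: eq_bigr => p _.
rewrite (_ : \sum_(_ | _) _ = (expR (- (th / 2 * p%:R)))%:C%C * rB al a M p).
  rewrite ncM nc_real ger0_norm ?expR_ge0// exprMn; congr (_ * _).
  by rewrite expr2 -expRD; congr expR; field.
by rewrite /rB mulr_sumr; apply: eq_bigr => f /eqP ->.
Qed.

(** The weight [th / 2] on the theta sums squares to [th] in [parseval_theta]. So [theta_sq] is used
    with [lam = th a / 4], and the weight [4 lam = th a] of the main term is the one for which
    [prod_gauss] yields the damped count of lattice points. With [M = L ^ 2] the error of [theta_sq]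
    beats every power of [L]. *)
Lemma laplace n (al : 'I_n -> R) (a : 'I_n -> nat) (c1 c2 c0 tau eps : R) :
  (1 < n)%N -> (forall j, (0 < a j)%N) -> 0 < c1 -> 0 < c2 ->
  0 < c0 -> 0 < tau -> (n.-1%:R - 1) * tau < 1 -> badly al c0 tau -> no_relation al ->
  0 < eps ->
  exists L0 : nat, forall (L P : nat) (th : R),
  (L0 < L)%N -> (L ^ 2 <= P)%N -> (forall q, (0 < q <= L)%N -> (q %| P)%N) ->
  (forall f : box n (L ^ 2), QB a f < P)%N -> c1 <= th * L%:R ^+ 2 <= c2 ->
  `| \sum_(p < P) expR (- (th * p%:R)) * (nc (rB al a (L ^ 2) p) ^+ 2 - (vB a (L ^ 2) p)%:R) |
    <= eps * L%:R ^+ n.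
Proof.
move=> n1 a0 c10 c20 c00 tau0 ht hb hal eps0.
pose A := (\max_j a j)%N.
have aA j : (a j <= A)%N by exact: (leq_bigmax j).
have A0 : (0 < A)%N by apply: leq_trans (aA (Ordinal (ltnW n1))).
have Ap : 0 < A%:R :> R by rewrite ltr0n.
have c1' : 0 < c1 / 4 by lra.
have c2' : 0 < c2 * A%:R / 4 by rewrite divr_gt0 ?mulr_gt0.
have e2 : 0 < eps / 2 by lra.
have [L0 hL0] := avg_parity n1 a0 c1' c2' c00 tau0 ht hb hal e2.
(* [25 = 5 ^ 2] stems from [4 M + 1 <= 5 M], which bounds [B] by [25 L ^ 4]. *)
have [L1 hL1] := @poly_gauss_small (c1 / 2) (n%:R * 25 ^+ n) (eps / 2) (2 * n)
  (divr_gt0 c10 (ltr0Sn _ 1)) (mulr_ge0 (ler0n _ _) (exprn_ge0 _ (ler0n _ _))) e2.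
exists (maxn L0 L1) => L P th; rewrite gtn_max => /andP[LL0 LL1] LP hdiv hQ /andP[t1 t2].
have L_gt0 : (0 < L)%N by exact: leq_ltn_trans LL0.
have Lp : 1 <= L%:R :> R by rewrite ler1n.
have P0 : (0 < P)%N by apply: leq_trans LP; rewrite expn_gt0 L_gt0.
have Pp : 0 < P%:R :> R by rewrite ltr0n.
set M := (L ^ 2)%N in hQ *.
have th0 : 0 < th.
  have L2 : 0 < L%:R ^+ 2 :> R by rewrite exprn_gt0//; lra.
  by rewrite -(pmulr_lgt0 _ L2); lra.
have le_dd (m : nat) : (m.*2.+1 <= (2 * m).*2.+1)%N by clear; lia.
have le_5m (m : nat) : (0 < m)%N -> ((2 * m).*2.+1 <= 5 * m)%N by clear; lia.
pose lam j := th / 4 * (a j)%:R.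
have lam4 j : 4 * lam j = th * (a j)%:R by rewrite /lam; field.
have lam2 j : th / 2 * (a j)%:R = 2 * lam j by rewrite /lam; field.
have sl : scaled (c1 / 4) (c2 * A%:R / 4) L lam.
  move=> j; rewrite /lam; have a1 : 1 <= (a j)%:R :> R by rewrite ler1n.
  have aA' : (a j)%:R <= A%:R :> R by rewrite ler_nat.
  rewrite (_ : _ * L%:R ^+ 2 = (th * L%:R ^+ 2) * (a j)%:R / 4); last by ring.
  apply/andP; split; rewrite ler_pM2r//; last by apply: ler_pM => //; rewrite ?ler0n//; apply: le_trans t1; exact: ltW.
  by apply: (le_trans t1); rewrite ler_peMr//; apply: le_trans t1; exact: ltW.
have main := hL0 L P M lam LL0 LP hdiv sl (leqnn _).
have EG : \prod_j \sum_(z <- zr M) gw (4 * lam j) z = \prod_j \sum_(z <- zr M) gw (th * (a j)%:R) z.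
  by apply: eq_bigr => j _; rewrite lam4.
rewrite EG in main.
rewrite (prod_gauss th hQ) in main.
pose TH (b : 'I_P) j := (nc (thetaM (th / 2 * (a j)%:R) (a j)%:R (al j) M (b%:R / P%:R)) ^+ 2)%:C%C.
pose PS (b : 'I_P) j := parity_sum (al j) (lam j) (a j)%:R M (b%:R / P%:R).
pose B : R := ((2 * M).*2).+1%:R ^+ 2.
have B0 : 0 <= B by rewrite exprn_ge0.
pose d : R := B * expR (- (c1 / 2 * L%:R ^+ 2)).
have d0 : 0 <= d by rewrite mulr_ge0 ?expR_ge0.
have lam0 j : 0 <= lam j by rewrite mulr_ge0// divr_ge0// ltW.
have dif b : nc (\prod_j TH b j - \prod_j PS b j) <= n%:R * B ^+ n.-1 * d.
  apply: nc_prod_diff => // j.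
  - rewrite nc_real ger0_norm ?exprn_ge0 ?nc_ge0// /B lerXn2r ?nnegrE ?nc_ge0//.
    apply: le_trans (_ : (M.*2).+1%:R <= _); last by rewrite ler_nat.
    by apply: nc_thetaM; rewrite mulr_ge0// divr_ge0// ltW.
  - exact: nc_parity_sum.
  rewrite /TH /PS lam2.
  apply: (le_trans (theta_sq _ _ _ _ (lam0 j))); rewrite /d -/B ler_wpM2l// ler_expR lerN2.
  have /andP[h1 _] := sl j.
  have : c1 / 4 * L%:R ^+ 2 <= lam j * L%:R ^+ 2 * L%:R ^+ 2.
    by rewrite ler_wpM2r ?exprn_ge0.
  by rewrite /M natrX; lra.
have dsmall : n%:R * B ^+ n.-1 * d <= eps / 2 * L%:R ^+ n.
  apply: le_trans (_ : eps / 2 <= _); last by rewrite ler_peMr ?exprn_ege1//; lra.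
  apply: le_trans (hL1 _ LL1).
  rewrite /d !mulrA ler_wpM2r ?expR_ge0// -!mulrA ler_wpM2l// -exprSr (prednK (ltnW n1)).
  rewrite (_ : (2 * (2 * n))%N = (4 * n)%N); last by rewrite mulnA.
  rewrite exprM -exprMn lerXn2r ?nnegrE ?mulr_ge0 ?exprn_ge0//.
  rewrite (_ : 25 * L%:R ^+ 4 = (5 * L%:R ^+ 2) ^+ 2); last by ring.
  rewrite /B lerXn2r ?nnegrE ?mulr_ge0 ?exprn_ge0// -natrX -/M -natrM ler_nat.
  by apply: le_5m; rewrite expn_gt0 L_gt0.
have E : (\sum_(b < P) \prod_j TH b j) =
   (P%:R * \sum_(p < P) expR (- (th * p%:R)) * nc (rB al a M p) ^+ 2)%:C%C.
  rewrite -(parseval_theta _ _ hQ) rmorph_sum /=; apply: eq_bigr => b _.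
  by rewrite rmorph_prod.
have tot : nc (\sum_(b < P) \prod_j TH b j - (\sum_(p < P) expR (- (th * p%:R)) * (vB a M p)%:R)%:C%C *+ P)
   <= P%:R * (eps * L%:R ^+ n).
  rewrite -[X in X - _](subrK (\sum_(b < P) \prod_j PS b j)) -addrA.
  apply: (le_trans (ncD _ _)).
  have h1 : nc (\sum_(b < P) \prod_j TH b j - \sum_(b < P) \prod_j PS b j) <= P%:R * (eps / 2 * L%:R ^+ n).
    rewrite -sumrB; apply: (le_trans (nc_sum _ _ _)).
    apply: le_trans (_ : \sum_(b < P) (eps / 2 * L%:R ^+ n) <= _).
      by apply: ler_sum => b _; apply: (le_trans (dif b)).
    by rewrite sumr_const card_ord mulr_natl.
  by apply: (le_trans (lerD h1 main)); rewrite le_eqVlt; apply/orP; left; apply/eqP; field.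
move: tot; rewrite E -rmorphMn -rmorphB /= nc_real.
have EB (S T : R) : P%:R * S - T *+ P = P%:R * (S - T) by rewrite mulrBr !mulr_natl.
rewrite EB normrM gtr0_norm// ler_pM2l// => h.
by under eq_bigr do rewrite mulrBr; rewrite sumrB.
Qed.

End laplace.

(** * Removing the damping *)

Section tauberian.
Context {R : realType}.

(** A polynomial without constant term in [expR (- (k x))], so that every term has a positive
    damping rate. *)
Definition dampsum (m k : nat) (c : 'I_m -> R) (x : R) : R :=
  \sum_(i < m) c i * expR (- ((k * i.+1)%:R * x)).

Lemma one_sub_exp (m : nat) : exists c : 'I_m -> R, forall z : R,
  1 - (1 - z) ^+ m = \sum_(i < m) c i * z ^+ i.+1.
Proof.
exists (fun i => - ((-1) ^+ i.+1 *+ 'C(m, i.+1))) => z.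
rewrite exprBn big_ord_recl /= bin0 expr0 !mul1r expr0 expr1n mulr1n opprD mulr1 addrA subrr add0r -sumrN.
apply: eq_bigr => i _; rewrite /bump leq0n add1n expr1n mulr1.
by rewrite mulNr mulrnAl.
Qed.

(* Stone's polynomial [1 - (1 - y ^ k) ^ m] at [y = e^-x], with [m] of the order of
   [e^(k t0) / eta], approximates the indicator of [x <= t0]. *)
Lemma stone (t0 t1 eta : R) : 0 <= t0 < t1 -> 0 < eta <= 1 ->
  exists (m k : nat) (c : 'I_m -> R), (0 < k)%N /\ forall x : R, 0 <= x ->
  [/\ 0 <= dampsum k c x, dampsum k c x <= 1, (x <= t0 -> 1 - eta <= dampsum k c x) &
    (t1 <= x -> dampsum k c x <= eta * expR (- x))].
Proof.
move=> /andP[t00 t01] /andP[e0 e1].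
have d0 : 0 < t1 - t0 by rewrite subr_gt0.
(* Chosen, by way of [expR s >= s], to have [(eta^-1 + 1) expR (t1 - k.+1 (t1 - t0)) <= eta]. *)
have [k hk] := natr_unbounded ((eta^-1 + 1) * expR t1 / eta / (t1 - t0)).
have hm1 : eta^-1 * expR (k.+1%:R * t0) <= (Num.truncn (eta^-1 * expR (k.+1%:R * t0))).+1%:R.
  exact/ltW/truncnS_gt.
set m0 := (Num.truncn _).+1 in hm1.
have hm2 : m0%:R <= (eta^-1 + 1) * expR (k.+1%:R * t0).
  rewrite /m0 mulrDl mul1r -natr1 lerD//.
    by rewrite truncn_le// mulr_ge0 ?expR_ge0// invr_ge0 ltW.
  by rewrite -[leLHS]expR0 ler_expR mulr_ge0.
have [c hc] := one_sub_exp m0.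
exists m0, k.+1, c; split=> // x x0.
pose z := expR (- (k.+1%:R * x)).
have z0 : 0 < z by exact: expR_gt0.
have z1 : z <= 1 by rewrite /z -[leRHS]expR0 ler_expR oppr_le0 mulr_ge0.
have E : dampsum k.+1 c x = 1 - (1 - z) ^+ m0.
  rewrite hc /dampsum; apply: eq_bigr => i _; congr (_ * _).
  by rewrite /z -expRM_natl natrM; congr expR; ring.
rewrite E; have p0 : 0 <= (1 - z) ^+ m0 by rewrite exprn_ge0// subr_ge0.
have p1 : (1 - z) ^+ m0 <= 1 by rewrite exprn_ile1 ?subr_ge0 ?gerBl// ltW.
split; rewrite ?subr_ge0 ?gerBl//.
  move=> xt; rewrite lerD2l lerN2.
  apply: le_trans (_ : expR (- z) ^+ m0 <= _).
    by rewrite lerXn2r ?nnegrE ?expR_ge0 ?subr_ge0//; exact: expR_ge1Dx.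
  rewrite -expRM_natl mulrN expRN -[leRHS]invrK lef_pV2 ?posrE ?expR_gt0 ?invr_gt0//.
  have h : eta^-1 <= m0%:R * z.
    apply: le_trans (_ : eta^-1 * expR (k.+1%:R * t0) * z <= _); last by rewrite ler_wpM2r// ltW.
    rewrite -mulrA ler_peMr ?invr_ge0 ?(ltW e0)// /z -expRD -[leLHS]expR0 ler_expR.
    by rewrite -mulrBr mulr_ge0// subr_ge0.
  by apply: (le_trans h); apply: le_trans (expR_ge1Dx _); rewrite lerDr.
move=> tx; apply: le_trans (_ : m0%:R * z <= _).
  have : forall j : nat, 1 - (1 - z) ^+ j <= j%:R * z.
    elim=> [|j IH]; first by rewrite expr0 subrr mul0r.
    have q0 : 0 <= (1 - z) ^+ j by rewrite exprn_ge0// subr_ge0.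
    have q1 : (1 - z) ^+ j <= 1 by rewrite exprn_ile1 ?subr_ge0 ?gerBl// ltW.
    by rewrite exprS -natr1; nra.
  by apply.
apply: (le_trans (ler_wpM2r (ltW z0) hm2)).
rewrite /z -mulrA -expRD.
rewrite (_ : expR _ = expR (k.+1%:R * t0 - k.+1%:R * x + x) * expR (- x)); last first.
  by rewrite -expRD; congr expR; ring.
rewrite mulrA ler_wpM2r ?expR_ge0//.
apply: le_trans (_ : (eta^-1 + 1) * expR (t1 - k.+1%:R * (t1 - t0)) <= _).
  rewrite ler_wpM2l ?addr_ge0 ?invr_ge0 ?(ltW e0)// ler_expR.
  have : 0 <= (k.+1%:R - 1) * (x - t1) by rewrite mulr_ge0 ?subr_ge0// ler1n.
  by lra.
rewrite expRD expRN mulrA ler_pdivrMr ?expR_gt0// -ler_pdivrMl// [leLHS]mulrC.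
apply: le_trans (_ : k.+1%:R * (t1 - t0) <= _); last by apply: le_trans (expR_ge1Dx _); rewrite lerDr.
by move: hk; rewrite ltr_pdivrMr// => /ltW.
Qed.

(** Stated for two nonnegative sequences that can be exchanged. Beyond [t1] the bound
    [eta expR (- x)], rather than [eta], lets the single damped sum [K] control the tail. *)
Lemma tauber (P m k : nat) (c : 'I_m -> R) (D V : nat -> R) (N t0 t1 eta K e : R) :
  0 < N -> 0 <= eta -> (forall p, 0 <= D p) -> (forall p, 0 <= V p) ->
  (forall x, 0 <= x -> [/\ 0 <= dampsum k c x, dampsum k c x <= 1,
    (x <= t0 -> 1 - eta <= dampsum k c x) & (t1 <= x -> dampsum k c x <= eta * expR (- x))]) ->
  \sum_(p < P) dampsum k c (p%:R / N) * D p <= \sum_(p < P) dampsum k c (p%:R / N) * V p + e ->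
  \sum_(p < P) expR (- (p%:R / N)) * V p <= K ->
  (1 - eta) * \sum_(p < P | p%:R / N <= t0) D p <= \sum_(p < P | p%:R / N < t1) V p + eta * K + e.
Proof.
move=> N0 eta0 D0 V0 hd h1 h2.
have pN p : 0 <= p%:R / N by rewrite divr_ge0// ltW.
apply: le_trans (_ : \sum_(p < P) dampsum k c (p%:R / N) * D p <= _).
  rewrite mulr_sumr big_mkcond /=; apply: ler_sum => p _.
  have [g1 g2 g3 g4] := hd _ (pN p); case: ifP => [/g3 h|_]; last by rewrite mulr_ge0.
  by rewrite ler_wpM2r.
apply: (le_trans h1); rewrite lerD2r.
apply: le_trans (_ : \sum_(p < P | p%:R / N < t1) V p + eta * \sum_(p < P) expR (- (p%:R / N)) * V p <= _);
  last by rewrite lerD2l ler_wpM2l.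
rewrite [X in X + _]big_mkcond mulr_sumr -big_split /=; apply: ler_sum => p _.
have [g1 g2 g3 g4] := hd _ (pN p).
have w0 : 0 <= eta * (expR (- (p%:R / N)) * V p) by rewrite !mulr_ge0 ?expR_ge0.
case: ltP => [_|/g4 h].
  by apply: le_trans (_ : V p <= _); rewrite ?lerDl// ler_piMl.
by rewrite add0r mulrA ler_wpM2r.
Qed.

Lemma prod_gauss_le n (a : 'I_n -> nat) M (N : nat) : (forall j, (0 < a j)%N) -> (0 < N)%N ->
  \prod_j \sum_(z <- zr M) gw (N%:R^-1 * (a j)%:R) z <= (2 * gaussC) ^+ n * Num.sqrt N%:R ^+ n :> R.
Proof.
move=> a0 N0; have Np : 1 <= N%:R :> R by rewrite ler1n.
have N_gt0 : 0 < N%:R :> R by lra.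
have s1 : 1 <= Num.sqrt N%:R :> R by rewrite -[leLHS]sqrtr1 ler_wsqrtr.
rewrite -exprMn; apply: le_trans (_ : \prod_(j < n) (2 * gaussC * Num.sqrt N%:R) <= _); last first.
  by rewrite prodr_const card_ord.
apply: ler_prod => j _; apply/andP; split; first by apply: sumr_ge0 => z _; exact: gw_ge0.
have ap : 1 <= (a j)%:R :> R by rewrite ler1n.
have p0 : 0 < N%:R^-1 * (a j)%:R :> R by rewrite mulr_gt0 ?invr_gt0//; lra.
have := @gauss_sum R (zr M) _ 0 (zr_uniq M) p0.
under eq_bigr do rewrite addr0.
move=> h; apply: (le_trans h).
have : (Num.sqrt (N%:R^-1 * (a j)%:R))^-1 <= Num.sqrt N%:R :> R.
  rewrite -sqrtrV ?(ltW p0)// ler_wsqrtr// invfM invrK ler_piMr ?(ltW N_gt0)//.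
  by rewrite invf_le1//; lra.
by have := @gaussC_gt0 R; nra.
Qed.

(** The damping rates are [j / N] with [1 <= j <= B], and [N <= L ^ 2 <= 4 N], so [th L ^ 2] stays
    in [[1, 4 B]] and [laplace] applies to all of them; dividing [eta] by [S + 1] absorbs the
    coefficients [c]. *)
Lemma one_sided n (al : 'I_n -> R) (a : 'I_n -> nat) (c0 tau t0 t1 eta : R) :
  (1 < n)%N -> (forall j, (0 < a j)%N) ->
  0 < c0 -> 0 < tau -> (n.-1%:R - 1) * tau < 1 -> badly al c0 tau -> no_relation al ->
  0 <= t0 < t1 -> 0 < eta <= 1 ->
  exists L0 : nat, forall (L P N : nat),
  (L0 < L)%N -> (0 < N <= L ^ 2)%N -> (L ^ 2 <= 4 * N)%N -> (L ^ 2 <= P)%N ->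
  (forall q, (0 < q <= L)%N -> (q %| P)%N) ->
  (forall f : box n (L ^ 2), QB a f < P)%N ->
  let D p := nc (rB al a (L ^ 2) p) ^+ 2 in
  let V p := (vB a (L ^ 2) p)%:R in
  let K := (2 * gaussC) ^+ n * Num.sqrt N%:R ^+ n in
  (1 - eta) * \sum_(p < P | p%:R / N%:R <= t0) D p <=
    \sum_(p < P | p%:R / N%:R < t1) V p + eta * (K + 2 * L%:R ^+ n) /\
  (1 - eta) * \sum_(p < P | p%:R / N%:R <= t0) V p <=
    \sum_(p < P | p%:R / N%:R < t1) D p + eta * (K + 2 * L%:R ^+ n).
Proof.
move=> n1 a0 c00 tau0 ht hb hal ht01 he.
have [m [k [c [k0 hc]]]] := stone ht01 he.
have /andP[e0 e1] := he.
pose S := \sum_(i < m) `|c i|.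
have S0 : 0 <= S by apply: sumr_ge0 => i _; exact: normr_ge0.
pose ep := eta / (S + 1).
have ep0 : 0 < ep by rewrite divr_gt0// ltr_wpDl.
pose B := (k * m).+1.
have c20 : 0 < 4 * B%:R :> R by rewrite mulr_gt0// ltr0n.
have [L0 hL0] := laplace n1 a0 ltr01 c20 c00 tau0 ht hb hal ep0.
exists L0 => L P N LL /andP[N0 NL] LN LP hdiv hQ D V K.
have Np : 0 < N%:R :> R by rewrite ltr0n.
have lap j : (0 < j <= B)%N ->
   `|\sum_(p < P) expR (- (j%:R * (p%:R / N%:R))) * (D p - V p)| <= ep * L%:R ^+ n.
  move=> /andP[j0 jB].
  rewrite (eq_bigr (fun p : 'I_P => expR (- (j%:R / N%:R * p%:R)) * (D p - V p))); last first.
    by move=> p _; congr (expR (- _) * _); ring.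
  apply: hL0 => //; rewrite mulrAC ler_pdivlMr// ler_pdivrMr// mul1r -natrX -!natrM !ler_nat.
  apply/andP; split; first by apply: (leq_trans NL); rewrite leq_pmull.
  by rewrite [(4 * _)%N]mulnC -mulnA; apply: leq_mul.
have Ln : 0 <= L%:R ^+ n :> R by rewrite exprn_ge0.
have dampD : `|\sum_(p < P) dampsum k c (p%:R / N%:R) * D p - \sum_(p < P) dampsum k c (p%:R / N%:R) * V p|
     <= eta * L%:R ^+ n.
  rewrite -sumrB; under eq_bigr => p _ do rewrite -mulrBr /dampsum mulr_suml.
  rewrite exchange_big /=; apply: (le_trans (ler_norm_sum _ _ _)).
  apply: le_trans (_ : \sum_(i < m) `|c i| * (ep * L%:R ^+ n) <= _).
    apply: ler_sum => i _; under eq_bigr do rewrite -mulrA.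
    rewrite -mulr_sumr normrM ler_wpM2l//; apply: lap; rewrite muln_gt0 k0 /= /B.
    by rewrite ltnW// ltnS leq_pmul2l.
  rewrite -mulr_suml -/S mulrA ler_wpM2r//.
  by rewrite /ep mulrA ler_pdivrMr ?ltr_wpDl// mulrC ler_wpM2l ?(ltW e0)// lerDl.
have D0 p : 0 <= D p by rewrite exprn_ge0// nc_ge0.
have V0 p : 0 <= V p by rewrite ler0n.
have hV : \sum_(p < P) expR (- (p%:R / N%:R)) * V p <= K.
  apply: le_trans (prod_gauss_le (L ^ 2) a0 N0).
  by rewrite (prod_gauss _ hQ); apply: ler_sum => p _; rewrite [_ / _]mulrC.
have ep1 : ep <= 1.
  by rewrite /ep ler_pdivrMr ?ltr_wpDl// mul1r; lra.
have hD : \sum_(p < P) expR (- (p%:R / N%:R)) * D p <= K + L%:R ^+ n.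
  have := lap 1%N; rewrite ltnS leq0n => /(_ isT).
  under eq_bigr => p _ do rewrite mul1r mulrBr.
  rewrite sumrB ler_norml => /andP[_]; rewrite lerBlDr => h; apply: (le_trans h).
  by rewrite addrC lerD// ler_piMl.
move: dampD; rewrite ler_norml => /andP[d1 d2]; split.
  have h1 : \sum_(p < P) dampsum k c (p%:R / N%:R) * D p <=
    \sum_(p < P) dampsum k c (p%:R / N%:R) * V p + eta * L%:R ^+ n by lra.
  have := tauber Np (ltW e0) D0 V0 hc h1 hV => h; apply: (le_trans h).
  by have := mulr_ge0 (ltW e0) Ln; lra.
have h1 : \sum_(p < P) dampsum k c (p%:R / N%:R) * V p <=
    \sum_(p < P) dampsum k c (p%:R / N%:R) * D p + eta * L%:R ^+ n by lra.
have := tauber Np (ltW e0) V0 D0 hc h1 hD => h; apply: (le_trans h).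
by lra.
Qed.

End tauberian.

Section sandwich.
Context {R : realType}.

Lemma ceil_sqrt (N : nat) : (0 < N)%N -> exists L : nat, (N <= L ^ 2)%N /\ (L ^ 2 <= 4 * N)%N.
Proof.
move=> N0; have ex : exists L : nat, (N <= L ^ 2)%N by exists N; rewrite -mulnn leq_pmull.
exists (ex_minn ex); case: ex_minnP => L h1 h2; split=> //.
case: L h1 h2 => [|[|L]] h1 h2; first by [].
  by rewrite exp1n; lia.
have : (L.+1 ^ 2 < N)%N by rewrite ltnNge; apply/negP => /h2; rewrite ltnn.
rewrite -!mulnn; clear; nia.
Qed.

Definition cntQ n (a : 'I_n -> nat) M (x : R) : nat := \sum_(f : box n M | (QB a f)%:R <= x) 1.

Lemma sum_vB n (a : 'I_n -> nat) M P (T : pred nat) : (forall f : box n M, QB a f < P)%N ->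
  \sum_(p < P | T p) (vB a M p)%:R = (\sum_(f : box n M | T (QB a f)) 1)%:R :> R.
Proof.
move=> hP; rewrite -natr_sum; congr (_%:R).
rewrite (partition_big (fun f => Ordinal (hP f)) (fun p : 'I_P => T p))//=.
apply: eq_bigr => p Tp; rewrite /vB; apply: eq_bigl => f.
by rewrite -val_eqE /=; case: eqP => [->|]; rewrite ?andbT ?andbF.
Qed.

(** Only the origin represents 0. The damped sums contain the term [p = 0], which [Rsum] leaves
    out. *)
Lemma nc_rB0 n (al : 'I_n -> R) (a : 'I_n -> nat) M : (forall j, (0 < a j)%N) -> nc (rB al a M 0) <= 1.
Proof.
move=> a0; pose f0 : box n M := [ffun=> inord M].
rewrite /rB (bigD1 f0) /=; last first.
  by rewrite /QB big1// => j _; rewrite ffunE /zv inordK ?subrr ?muln0//; lia.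
rewrite [X in _ + X]big1 ?addr0 ?nc_ce// => f /andP[/eqP h /eqP ne]; case: ne.
apply/ffunP => j; apply: val_inj; rewrite ffunE /= inordK; last by lia.
move/eqP: h; rewrite /QB sum_nat_eq0 => /forallP/(_ j).
by rewrite muln_eq0 eqn0Ngt a0 /= expn_eq0 andbT absz_eq0 /zv subr_eq0 => /eqP[].
Qed.

Lemma sandwich n (al : 'I_n -> R) (a : 'I_n -> nat) (c0 tau : R) :
  (1 < n)%N -> (forall j, (0 < a j)%N) ->
  0 < c0 -> 0 < tau -> (n.-1%:R - 1) * tau < 1 -> badly al c0 tau -> no_relation al ->
  exists2 C : R, 0 < C & forall d eta : R, 0 < d < 1 -> 0 < eta <= 1 ->
  exists N0 : nat, forall N, (N0 < N)%N -> exists M : nat, (N <= M)%N /\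
    let S := \sum_(1 <= p < N.+1) nc (rB al a M p) ^+ 2 in
    let E := eta * (C * Num.sqrt N%:R ^+ n) in
    (1 - eta) * S <= (cntQ a M ((1 + d) * N%:R))%:R + E /\
    (1 - eta) * (cntQ a M ((1 - d) * N%:R))%:R <= 1 + S + E.
Proof.
move=> n1 a0 c00 tau0 ht hb hal.
(* [L ^ 2 <= 4 N] gives [L ^ n <= 2 ^ n sqrt N ^ n]; the other part is the constant in [K] of
   [one_sided]. *)
exists ((2 * gaussC) ^+ n + 2 * 2 ^+ n).
  by rewrite addr_gt0// ?mulr_gt0// exprn_gt0// mulr_gt0// gaussC_gt0.
move=> d eta /andP[d0 d1] he; have /andP[e0 e1] := he.
have ha1 : 0 <= (1 : R) < 1 + d by lra.
have ha2 : 0 <= 1 - d < 1 by lra.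
have [L1 hL1] := one_sided n1 a0 c00 tau0 ht hb hal ha1 he.
have [L2 hL2] := one_sided n1 a0 c00 tau0 ht hb hal ha2 he.
exists (maxn L1 L2 ^ 2)%N => N hN.
have N0 : (0 < N)%N by exact: leq_ltn_trans hN.
have [L [NL LN]] := ceil_sqrt N0.
have : (maxn L1 L2 < L)%N by rewrite -(ltn_exp2r _ _ (isT : (0 < 2)%N)) (leq_trans hN).
rewrite gtn_max => /andP[LL1 LL2].
pose M := (L ^ 2)%N; exists M; split=> // S E.
have Np : 0 < N%:R :> R by rewrite ltr0n.
pose mx := (\max_(f : box n M) QB a f).+1.
(* The factorial makes every [q <= L] divide [P]; the other factor puts [P] above [N] and the values
   of the form, and at least at [L ^ 2]. *)
pose P := (L`! * (mx + L ^ 2 + N.+1))%N.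
have big : (mx + L ^ 2 + N.+1 <= P)%N by rewrite /P leq_pmull// fact_gt0.
have LP : (L ^ 2 <= P)%N by apply: leq_trans big; rewrite addnAC leq_addl.
have NP : (N < P)%N by apply: leq_trans big; rewrite leq_addl.
have hQ (f : box n M) : (QB a f < P)%N.
  apply: leq_trans big; rewrite -addnA; apply: (@leq_trans mx); last exact: leq_addr.
  by rewrite ltnS; exact: (leq_bigmax f).
have hdiv q : (0 < q <= L)%N -> (q %| P)%N by move=> h; rewrite dvdn_mulr// dvdn_fact.
have N0L : (0 < N <= L ^ 2)%N by rewrite N0.
have [A1 _] := hL1 L P N LL1 N0L LN LP hdiv hQ.
have [_ A2] := hL2 L P N LL2 N0L LN LP hdiv hQ.
have LE : L%:R ^+ n <= 2 ^+ n * Num.sqrt N%:R ^+ n :> R.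
  rewrite -exprMn lerXn2r ?nnegrE ?mulr_ge0 ?sqrtr_ge0//.
  rewrite -(@ler_pXn2r _ 2) ?nnegrE ?mulr_ge0 ?sqrtr_ge0// exprMn sqr_sqrtr ?ler0n//.
  by rewrite -natrX -[2 ^+ 2]natrX -natrM ler_nat.
have EE : eta * ((2 * gaussC) ^+ n * Num.sqrt N%:R ^+ n + 2 * L%:R ^+ n) <= E.
  by rewrite /E ler_wpM2l ?(ltW e0)//; lra.
pose D p := nc (rB al a M p) ^+ 2.
have D0 p : 0 <= D p by rewrite exprn_ge0 ?nc_ge0.
have SE : \sum_(p < P | (p%:R / N%:R <= 1 :> R)) D p = D 0%N + S.
  transitivity (\sum_(0 <= p < N.+1) D p); last by rewrite big_ltn.
  rewrite big_mkord.
  rewrite (big_ord_widen _ D NP); apply: eq_bigl => p.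
  by rewrite ler_pdivrMr// mul1r ler_nat ltnS.
split.
  have {}A1 := le_trans A1 (lerD (lexx _) EE).
  move: A1; rewrite (sum_vB (fun p => p%:R / N%:R < 1 + d) hQ) SE => A1.
  apply: le_trans (_ : (1 - eta) * (D 0%N + S) <= _).
    by rewrite ler_wpM2l// ?lerDr//; lra.
  apply: (le_trans A1); rewrite lerD2r ler_nat.
  rewrite /cntQ big_mkcond [leqRHS]big_mkcond /=; apply: leq_sum => f _.
  by case: ltP => // h; rewrite -ler_pdivrMr// (ltW h).
have {}A2 := le_trans A2 (lerD (lexx _) EE).
move: A2; rewrite (sum_vB (fun p => p%:R / N%:R <= 1 - d) hQ) => A2.
rewrite (_ : cntQ _ _ _ = \sum_(f : box n M | ((QB a f)%:R / N%:R <= 1 - d)%R) 1)%N; last first.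
  by apply: eq_bigl => f; rewrite ler_pdivrMr.
apply: (le_trans A2); rewrite lerD2r.
apply: le_trans (_ : D 0%N + S <= _); last first.
  by rewrite lerD2r /D exprn_ile1 ?nc_ge0 ?nc_rB0.
rewrite -SE big_mkcond [leRHS]big_mkcond /=; apply: ler_sum => p _.
by case: ltP => [/ltW ->|_]//; case: ifP.
Qed.

End sandwich.

(** * Lattice points and volume *)

Section lattice_volume.
Context {R : realType}.
Local Notation mR := (measurableTypeR R).

(** Half-open, so that the cubes of distinct integer points are disjoint and cover the space. *)
Definition cube n (s : R) (m : 'I_n -> int) : set (n.-tuple mR) :=
  [set t | forall i, s * (m i)%:~R <= tnth t i < s * (m i + 1)%:~R].

Lemma measurable_cube n (s : R) (m : 'I_n -> int) : measurable (cube s m).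
Proof.
rewrite (_ : cube s m = \bigcap_(i in [set: 'I_n])
  ((@tnth n mR)^~ i @^-1` `[s * (m i)%:~R, s * (m i + 1)%:~R[)).
  apply: fin_bigcap_measurable => // i _; rewrite -[X in measurable X]setTI.
  by apply: measurable_tnth => //; exact: measurable_itv.
apply/seteqP; split=> t /= ht i; first by move=> _; rewrite /= in_itv /= ht.
by have := ht i I; rewrite /= in_itv.
Qed.

Lemma cube_volume n (s : R) (m : 'I_n -> int) : 0 < s -> lebesgue_tuple n (cube s m) = (s ^+ n)%:E.
Proof.
move=> s0; elim: n m => [|n IH] m.
  rewrite /= diracE (_ : _ \in _) ?expr0// inE => i; by case: i.
rewrite /= /cons_measure /pushforward.
rewrite (_ : _ @^-1` _ = `[s * (m ord0)%:~R, s * (m ord0 + 1)%:~R[%classic `*`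
   cube s (fun i => m (lift ord0 i))).
  rewrite product_measure1E; [|exact: measurable_itv|exact: measurable_cube].
  rewrite IH exprS EFinM; congr (_ * _)%E.
  have := @lebesgue_measure_itv R `[s * (m ord0)%:~R, s * (m ord0 + 1)%:~R[ => /= ->.
  rewrite lte_fin ltr_pM2l// ltr_int ltzD1 lexx -EFinB intrD mulrDr mulr1 addrAC subrr add0r.
  by [].
apply/seteqP; split=> [[x t] /= ht|[x t] /= [hx ht] i].
  split=> [|i]; first by have := ht ord0; rewrite (tnth_nth 0) /= in_itv.
  by have := ht (lift ord0 i); rewrite !(tnth_nth 0).
case: (unliftP ord0 i) => [j ->|->]; last by rewrite (tnth_nth 0) /=; move: hx; rewrite in_itv.
by have := ht j; rewrite !(tnth_nth 0).
Qed.

Lemma trivIset_cube n (s : R) M (D : set (box n M)) : 0 < s ->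
  trivIset D (fun f : box n M => cube s (fun j => zv (f j))).
Proof.
move=> s0 f g _ _ [t [/= hf hg]]; apply/ffunP => j; apply: val_inj.
have /andP[f1 f2] := hf j; have /andP[g1 g2] := hg j.
have : (zv (f j) < zv (g j) + 1)%R.
  by rewrite -(ltr_int R) -(ltr_pM2l s0) (le_lt_trans f1).
have : (zv (g j) < zv (f j) + 1)%R.
  by rewrite -(ltr_int R) -(ltr_pM2l s0) (le_lt_trans g1).
by rewrite /zv /=; clear; lia.
Qed.

Lemma volume_cubes n (s : R) M (p : pred (box n M)) : 0 < s ->
  measurable (\bigcup_(f in [set f | p f]) cube s (fun j => zv (f j))) /\
  lebesgue_tuple n (\bigcup_(f in [set f | p f]) cube s (fun j => zv (f j))) =
    (s ^+ n * (\sum_(f | p f) 1)%:R)%:E.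
Proof.
move=> s0; have fD : finite_set [set f | p f] by exact: finite_finset.
split; first by apply: fin_bigcup_measurable => // f _; exact: measurable_cube.
rewrite measure_fin_bigcup//; last first.
- by move=> f _; exact: measurable_cube.
- exact: trivIset_cube.
pose r := [seq f <- index_enum (box n M) | p f].
rewrite (_ : [set f | p f] = [set` r]); last first.
  by apply/seteqP; split=> f /=; rewrite mem_filter mem_index_enum andbT.
rewrite -fsbig_seq ?filter_uniq ?index_enum_uniq// big_filter.
rewrite (eq_bigr (fun=> (s ^+ n)%:E)); last by move=> f _; exact: cube_volume.
by rewrite sumEFin natr_sum mulr_sumr; under [in RHS]eq_bigr do rewrite mulr1.
Qed.

Definition ell n (a : 'I_n -> nat) : set (n.-tuple mR) :=
  [set t | \sum_i (a i)%:R * tnth t i ^+ 2 <= 1].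

Lemma measurable_ell n (a : 'I_n -> nat) : measurable (ell a).
Proof.
pose h (t : n.-tuple mR) : R := \sum_i (a i)%:R * tnth t i ^+ 2.
rewrite (_ : ell a = h @^-1` `]-oo, 1]); last first.
  by apply/seteqP; split=> t; rewrite /= in_itv.
rewrite -[X in measurable X]setTI.
have mh : measurable_fun setT h.
  apply: measurable_sum => i; apply: measurable_funM => //.
  by apply: measurable_funX; exact: measurable_tnth.
by apply: mh => //; exact: measurable_itv.
Qed.

Lemma volume_ellipsoid n (a : 'I_n -> nat) :
  volume (ellipsoid (diagZ a) : set 'cV[R]_n) = lebesgue_tuple n (ell a).
Proof.
have E t : qform (map_mx intr (diagZ a)) (\col_i tnth t i) = \sum_i (a i)%:R * tnth t i ^+ 2 :> R.
  apply: eq_bigr => i _; rewrite [(_ *m _)%R i 0]mxE (bigD1 i)//= big1 ?addr0.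
    by rewrite !mxE eqxx mulr1n mulrA.
  by move=> j ji; rewrite !mxE eq_sym (negPf ji) mulr0n mul0r.
by rewrite /volume; congr (lebesgue_tuple n _); apply/seteqP; split=> t; rewrite /= /ellipsoid /= E.
Qed.

Definition asum n (a : 'I_n -> nat) : R := \sum_i (a i)%:R.

(** With [w = x - y], the cross term satisfies [2 y w <= sg y ^ 2 + w ^ 2 / sg]. *)
Lemma sqr_perturb (sg x y : R) : 0 < sg -> x ^+ 2 <= (1 + sg) * y ^+ 2 + (1 + sg^-1) * (x - y) ^+ 2.
Proof.
move=> g0; set w := x - y; have -> : x = y + w by rewrite /w; ring.
have : 0 <= (sg * y - w) ^+ 2 / sg by rewrite divr_ge0 ?sqr_ge0// ltW.
rewrite (_ : (sg * y - w) ^+ 2 / sg = sg * y ^+ 2 - 2 * y * w + sg^-1 * w ^+ 2); last by field; rewrite gt_eqF.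
by rewrite (_ : (y + w) ^+ 2 = y ^+ 2 + 2 * y * w + w ^+ 2); [lra|ring].
Qed.

Lemma quad_perturb n (a : 'I_n -> nat) (sg s : R) (x y : 'I_n -> R) : 0 < sg ->
  (forall i, `|x i - y i| <= s) ->
  \sum_i (a i)%:R * x i ^+ 2 <= (1 + sg) * (\sum_i (a i)%:R * y i ^+ 2) + (1 + sg^-1) * s ^+ 2 * asum a.
Proof.
move=> g0 hs; rewrite /asum !mulr_sumr -big_split /=; apply: ler_sum => i _.
have s0 : 0 <= s by apply: le_trans (hs i).
have h1 := sqr_perturb (x i) (y i) g0.
have h2 : (x i - y i) ^+ 2 <= s ^+ 2.
  by rewrite -real_normK ?num_real// lerXn2r ?nnegrE.
have h3 : (1 + sg^-1) * (x i - y i) ^+ 2 <= (1 + sg^-1) * s ^+ 2.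
  by rewrite ler_wpM2l// addr_ge0// invr_ge0 ltW.
have a0 : 0 <= (a i)%:R :> R by [].
have := ler_wpM2l a0 (le_trans h1 (lerD (lexx _) h3)).
by move=> h; apply: (le_trans h); rewrite le_eqVlt; apply/orP; left; apply/eqP; ring.
Qed.

Lemma cube_dist n (s : R) (m : 'I_n -> int) t i : 0 < s -> cube s m t -> `|tnth t i - s * (m i)%:~R| <= s.
Proof.
by move=> s0 /(_ i)/andP[h1 h2]; rewrite ger0_norm ?subr_ge0//; move: h2; rewrite intrD mulrDr mulr1; lra.
Qed.

(** Rounding a point of the ellipsoid down to the corner of its cube changes the form by an amount
    that the last hypothesis absorbs, so the corner is counted; [T <= M ^ 2] places it in the
    box. *)
Lemma volume_le_count n (a : 'I_n -> nat) (s sg T : R) M : (forall j, (0 < a j)%N) ->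
  0 < s -> 0 < sg -> 0 <= T -> T <= M%:R ^+ 2 ->
  (1 + sg) + (1 + sg^-1) * s ^+ 2 * asum a <= s ^+ 2 * T ->
  (lebesgue_tuple n (ell a) <= (s ^+ n * (cntQ a M T)%:R)%:E)%E.
Proof.
move=> a0 s0 g0 T0 TM h.
have [mc <-] := @volume_cubes n s M (fun f => (QB a f)%:R <= T) s0.
apply: le_measure; rewrite ?inE//; first exact: measurable_ell.
move=> t; rewrite /ell /= => ht.
pose m i : int := Num.floor (tnth t i / s).
have hm i : s * (m i)%:~R <= tnth t i < s * (m i + 1)%:~R.
  apply/andP; split; rewrite mulrC; first by rewrite -ler_pdivlMr// floor_le_tmp.
  by rewrite -ltr_pdivrMr// floorD1_gt.
have hd i : `|s * (m i)%:~R - tnth t i| <= s.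
  by rewrite distrC; exact: (@cube_dist n s m t i s0 hm).
have hq := quad_perturb a (x := fun i => s * (m i)%:~R) (y := tnth t) g0 hd.
have {hq} : \sum_i (a i)%:R * (m i)%:~R ^+ 2 <= T.
  have s2 : 0 < s ^+ 2 by rewrite exprn_gt0.
  rewrite -(ler_pM2l s2); apply: le_trans h; apply: le_trans (_ : _ <= _) => [|].
    apply: le_trans hq; rewrite mulr_sumr; apply: ler_sum => i _.
    by rewrite le_eqVlt; apply/orP; left; apply/eqP; ring.
  by rewrite lerD2r ler_piMr//; lra.
move=> hq.
have mM i : (`|m i| <= M)%N.
  rewrite leqNgt; apply/negP => hM.
  have : (a i)%:R * (m i)%:~R ^+ 2 <= M%:R ^+ 2 :> R.
    apply: le_trans TM; apply: le_trans hq; rewrite (bigD1 i)//= lerDl.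
    by apply: sumr_ge0 => j _; rewrite mulr_ge0// sqr_ge0.
  apply/negP; rewrite -ltNge -[(m i)%:~R ^+ 2]real_normK ?num_real// -intr_norm -natr_absz.
  rewrite -!natrX -natrM ltr_nat.
  have : (M ^ 2 < `|m i| ^ 2)%N by rewrite ltn_exp2r.
  by move=> hh; apply: (leq_trans hh); rewrite leq_pmull.
pose f : box n M := [ffun i => inord `|(m i + M%:Z)%R|%N].
have fz i : zv (f i) = m i.
  rewrite /f ffunE /zv inordK; first by have := mM i; clear; lia.
  by have := mM i; clear; lia.
exists f => /=; last by move=> i; rewrite fz.
by rewrite QB_real; under eq_bigr do rewrite fz.
Qed.

(** The last hypothesis leaves room for the whole cube of each counted point inside the
    ellipsoid. *)
Lemma count_le_volume n (a : 'I_n -> nat) (s sg T : R) M :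
  0 < s -> 0 < sg ->
  (1 + sg) * (s ^+ 2 * T) + (1 + sg^-1) * s ^+ 2 * asum a <= 1 ->
  ((s ^+ n * (cntQ a M T)%:R)%:E <= lebesgue_tuple n (ell a))%E.
Proof.
move=> s0 g0 h.
have [mc <-] := @volume_cubes n s M (fun f => (QB a f)%:R <= T) s0.
apply: le_measure; rewrite ?inE//; first exact: measurable_ell.
move=> t [f /= hf ht]; rewrite /ell /=; apply: le_trans h.
have hq := quad_perturb a (x := tnth t) (y := fun i => s * (zv (f i))%:~R) g0
  (fun i => cube_dist i s0 ht).
apply: (le_trans hq); rewrite lerD2r ler_wpM2l//; first by lra.
apply: le_trans (_ : s ^+ 2 * (QB a f)%:R <= _); last by rewrite ler_wpM2l// sqr_ge0.
rewrite QB_real mulr_sumr; apply: ler_sum => i _.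
by rewrite le_eqVlt; apply/orP; left; apply/eqP; ring.
Qed.

End lattice_volume.

(** * Translation of the hypotheses, and the limit *)

Section translation.
Context {R : realType}.

(** [|m i| <= a i (m i)^2 <= p <= M], so the box contains all representations of [p]. *)
Lemma rcoef_rB n (a : 'I_n -> nat) (alpha : 'cV[R]_n) (M p : nat) : (forall j, (0 < a j)%N) ->
  (p <= M)%N -> rcoef (diagZ a) alpha p = rB (fun j => alpha j 0) a M p.
Proof.
move=> a0 pM; pose h (f : box n M) : 'cV[int]_n := \col_j zv (f j).
have hinj : injective h.
  move=> f g /colP e; apply/ffunP => j; apply: val_inj => /=.
  by have := e j; rewrite /h !mxE => /addIr[].
pose r := [seq h f | f <- [seq f <- index_enum (box n M) | QB a f == p]].
have qE (m : 'cV[int]_n) : qform (diagZ a) m = (\sum_i a i * `|m i 0%R| ^ 2)%N%:Z.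
  rewrite -natz natr_sum; apply: eq_bigr => i _.
  rewrite [(_ *m _) i 0]mxE (bigD1 i)//= big1 ?addr0.
    rewrite !mxE eqxx mulr1n natz PoszM -mulrA; congr (_ * _)%R.
    by rewrite -abszX abszE ger0_norm ?sqr_ge0// expr2.
  by move=> j ji; rewrite !mxE eq_sym (negPf ji) mulr0n mul0r.
rewrite /rcoef (_ : [set m | _] = [set` r]); last first.
  apply/seteqP; split=> m /=.
    rewrite qE => -[e]; apply/mapP.
    have mM i : (`|m i 0%R| <= M)%N.
      apply: leq_trans pM; rewrite -e (bigD1 i)//=; apply: leq_trans (leq_addr _ _).
      by case: `|m i 0%R|%N => // k; rewrite -mulnn mulnCA leq_pmulr// muln_gt0 a0.
    pose f : box n M := [ffun i => inord `|(m i 0%R + M%:Z)%R|%N].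
    have fz i : zv (f i) = m i 0.
      rewrite /f ffunE /zv inordK; first by have := mM i; clear; lia.
      by have := mM i; clear; lia.
    exists f; last by apply/colP => i; rewrite mxE fz.
    rewrite mem_filter mem_index_enum andbT /QB.
    by under eq_bigr do rewrite fz; rewrite e.
  case/mapP => f; rewrite mem_filter => /andP[/eqP e _] ->; rewrite qE -e; congr Posz.
  by apply: eq_bigr => i _; rewrite mxE.
rewrite -fsbig_seq ?map_inj_uniq ?filter_uniq ?index_enum_uniq// big_map big_filter.
apply: eq_bigr => f _; rewrite /ce -mulrN; congr (expi (_ * - _)).
by apply: eq_bigr => j _; rewrite !mxE.
Qed.

(** If all coordinates of [q alpha] were closer than [C / (n q ^ tau)] to integers, these integers
    over [q] would contradict the diophantine type, because [q ^ kappa <= q q ^ tau]. *)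
Lemma diophantine_badly n (alpha : 'cV[R]_n) (kappa tau : R) : (0 < n)%N ->
  diophantine_type kappa alpha -> kappa - 1 <= tau ->
  exists2 c0 : R, 0 < c0 & badly (fun j => alpha j 0) c0 tau.
Proof.
move=> n0 [C C0 hC] kt; have np : 0 < n%:R :> R by rewrite ltr0n.
exists (C / n%:R) => [|q q0]; first by rewrite divr_gt0.
apply: contrapT => /forallNP hN.
have /choice[k hk] : forall j, exists k : int,
    `|q%:R * alpha j 0 - k%:~R| < C / n%:R / q%:R `^ tau.
  move=> j; have /existsNP[k hk] := hN j; exists k; rewrite ltNge; exact/negP.
have qp : 0 < q%:R :> R by rewrite ltr0n.
have := hC (\col_j k j) q q0; apply/negP; rewrite -leNgt.
pose b : R := C / q%:R `^ kappa.
have b0 : 0 <= b by rewrite divr_ge0 ?(ltW C0) ?powR_ge0.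
have hb j : `|alpha j 0 - (k j)%:~R / q%:R| <= b / n%:R.
  have -> : alpha j 0 - (k j)%:~R / q%:R = q%:R^-1 * (q%:R * alpha j 0 - (k j)%:~R).
    by field; rewrite gt_eqF.
  rewrite normrM gtr0_norm ?invr_gt0// ler_pdivrMl//.
  apply: (le_trans (ltW (hk j))); rewrite /b.
  have pk : 0 < q%:R `^ kappa :> R by rewrite powR_gt0.
  have pt : 0 < q%:R `^ tau :> R by rewrite powR_gt0.
  have : q%:R `^ kappa <= q%:R * q%:R `^ tau :> R.
    rewrite -{2}[q%:R](powRr1 (ltW qp)) -powRD; last by rewrite (gt_eqF qp) implybT.
    by apply: ler_powR; rewrite ?ler1n//; lra.
  move=> h; rewrite (_ : q%:R * (C / q%:R `^ kappa / n%:R) = C / n%:R * (q%:R / q%:R `^ kappa)); last by ring.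
  rewrite ler_pM2l ?divr_gt0// ler_pdivlMr// mulrC ler_pdivrMr//.
rewrite /enorm -/b -(@ger0_norm _ b)// -sqrtr_sqr; apply: ler_wsqrtr.
apply: le_trans (_ : \sum_(j < n) (b / n%:R) ^+ 2 <= _).
  apply: ler_sum => j _; rewrite !mxE -expr2 -real_normK ?num_real//.
  have bn0 : 0 <= b / n%:R by exact: divr_ge0.
  by apply: lerXn2r; rewrite ?nnegrE ?normr_ge0//; exact: hb.
rewrite sumr_const card_ord -[leLHS]mulr_natl expr_div_n mulrCA ler_piMr ?sqr_ge0//.
by rewrite expr2 invfM mulrA divff ?gt_eqF// mul1r invf_le1// ler1n.
Qed.

(** [tau] is [kappa - 1], enlarged where needed to be positive. For [n = 2] the coefficient [n - 2]
    is 0, and for [n > 2] the fallback value [1 / (2 (n - 2))] still meets the second condition. *)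
Lemma kappa_exponent n (kappa : R) : (2 <= n)%N -> (kappa%:E < kappa_bound n)%E ->
  exists2 tau : R, 0 < tau & kappa - 1 <= tau /\ (n.-1%:R - 1) * tau < 1.
Proof.
case: n => [|[|n]]//= _; rewrite /kappa_bound -[n.+1%:R]natr1 addrK.
case: n => [_|n].
  by exists (Num.max (kappa - 1) 1); rewrite ?lt_max ?ltr01 ?orbT// le_max lexx mul0r.
rewrite (_ : (n.+3 == 2%N) = false)// lte_fin -[n.+3%:R]natr1 -[n.+2%:R]natr1.
have p : 0 < n.+1%:R :> R by rewrite ltr0n.
rewrite (_ : n.+1%:R + 1 + 1 - 1 = n.+1%:R + 1); last by ring.
rewrite (_ : n.+1%:R + 1 + 1 - 2 = n.+1%:R); last by ring.
rewrite ltr_pdivlMr// => h.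
exists (Num.max (kappa - 1) (2^-1 / n.+1%:R)).
  by rewrite lt_max [X in _ || X]divr_gt0 ?orbT.
split; first by rewrite le_max lexx.
rewrite (maxr_pMr _ _ (ltW p)) gt_max; apply/andP; split; first by lra.
by rewrite mulrC divfK ?gt_eqF//; lra.
Qed.

Lemma independent_no_relation n (alpha : 'cV[R]_n) :
  Q_independent (col_mx alpha (const_mx 1 : 'cV[R]_1)) -> no_relation (fun j => alpha j 0).
Proof.
move=> hi c d e j.
pose c' : 'cV[rat]_(n + 1) := col_mx (\col_i (c i)%:~R) (const_mx (- d%:~R)).
have /matrixP/(_ (lshift 1 j) 0) : c' = 0.
  apply: hi; rewrite big_split_ord /= big_ord1 !col_mxEd !mxE rmorphN /= ratr_int mulr1.
  rewrite (eq_bigr (fun i => (c i)%:~R * alpha i 0)) ?e ?subrr// => i _.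
  by rewrite !col_mxEu !mxE ratr_int.
by rewrite col_mxEu !mxE => /eqP; rewrite intr_eq0 => /eqP.
Qed.

Lemma exp_near1 n (r : R) : 0 <= r <= 1 ->
  (1 + r) ^+ n <= 1 + 3 ^+ n * r /\ 1 - 3 ^+ n * r <= (1 - r) ^+ n.
Proof.
move=> /andP[r0 r1]; elim: n => [|n [IH1 IH2]]; first by rewrite !expr0; split; lra.
have K1 : 1 <= 3 ^+ n :> R by rewrite exprn_ege1//; lra.
rewrite !exprS; have Kr : 0 <= 3 ^+ n * r by rewrite mulr_ge0//; lra.
have Krr : 3 ^+ n * r * r <= 3 ^+ n * r by rewrite ler_piMr.
have q0 : 0 <= (1 - r) ^+ n by rewrite exprn_ge0; lra.
have q1 : (1 - r) ^+ n <= 1 by rewrite exprn_ile1; lra.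
have rK : r <= 3 ^+ n * r by rewrite ler_peMl.
split.
  have : (1 + r) * (1 + r) ^+ n <= (1 + r) * (1 + 3 ^+ n * r) by rewrite ler_wpM2l//; lra.
  by lra.
have : r * (1 - r) ^+ n <= r by rewrite ler_piMr.
by lra.
Qed.

Lemma sandwich_limit n (v C : R) (x : nat -> R) : 0 <= v -> 0 <= C -> (forall N, 0 <= x N) ->
  (forall eta : R, 0 < eta <= 2^-1 -> exists N0 : nat, forall N, (N0 < N)%N ->
    (1 - eta) * x N <= v * (1 + eta) ^+ n + eta * C /\
    (1 - eta) * (v * (1 - eta) ^+ n) <= x N + eta * C) ->
  x N @[N --> \oo] --> v.
Proof.
move=> v0 C0 x0 hx; apply/cvgrPdist_le => e e0.
pose K : R := 3 ^+ n; have K1 : 1 <= K by rewrite exprn_ege1//; lra.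
pose B := 2 * (v * (1 + K) + C).
have vK : 0 <= v * K by rewrite mulr_ge0//; lra.
have B0 : 0 <= B by rewrite mulr_ge0// addr_ge0// mulr_ge0//; lra.
(* [B] is an a priori bound for [x N], valid as [eta <= 1/2]; [G] then dominates the coefficients of
   the error terms, all linear in [eta] by [exp_near1]. *)
pose G := 2 * (v * K + C + B + v) + 1.
have G0 : 0 < G by rewrite /G; lra.
pose eta := Num.min 2^-1 (e / G).
have eta0 : 0 < eta by rewrite /eta lt_min divr_gt0// andbT invr_gt0.
have eta2 : eta <= 2^-1 by rewrite /eta ge_min lexx.
have etae : eta * G <= e by rewrite -ler_pdivlMr// /eta ge_min lexx orbT.
have [|N0 hN] := hx eta; first by rewrite eta0.
exists N0.+1 => // N /= NN; have [h1 h2] := hN N NN.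
have [|g1 g2] := @exp_near1 n eta; first by apply/andP; split; lra.
have {}h1 : (1 - eta) * x N <= v * (1 + K * eta) + eta * C.
  by apply: (le_trans h1); rewrite lerD2r ler_wpM2l.
have {}h2 : (1 - eta) * (v * (1 - K * eta)) <= x N + eta * C.
  by apply: le_trans h2; rewrite ler_wpM2l ?ler_wpM2l//; lra.
have vKe : v * K * eta <= v * K by rewrite ler_piMr//; lra.
have eC : eta * C <= C by rewrite ler_piMl//; lra.
have ex : eta * x N <= 2^-1 * x N by rewrite ler_wpM2r.
have xB : x N <= B by rewrite /B; lra.
have exB : eta * x N <= eta * B by rewrite ler_wpM2l// ltW.
have e2K : 0 <= eta * (v * K * eta) by rewrite !mulr_ge0//; lra.
have ev : 0 <= eta * v by rewrite mulr_ge0// ltW.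
have evK : 0 <= eta * (v * K) by rewrite mulr_ge0// ltW.
have eB : 0 <= eta * B by rewrite mulr_ge0// ltW.
have eC0 : 0 <= eta * C by rewrite mulr_ge0// ltW.
rewrite ler_norml /G in etae *.
by apply/andP; split; lra.
Qed.

End translation.

Section final.
Context {R : realType}.

(** Cubes of side 1 already bound the volume by a finite count. *)
Lemma volume_fin n (a : 'I_n -> nat) : (forall j, (0 < a j)%N) ->
  lebesgue_tuple n (ell (R := R) a) \is a fin_num.
Proof.
move=> a0; pose T : R := 2 + 2 * asum a.
have A0 : 0 <= asum (R := R) a by apply: sumr_ge0.
have [k hk] := natr_unbounded T.
have TM : T <= k.+1%:R ^+ 2.
  by apply: (le_trans (ltW hk)); rewrite expr2 ler_peMl// ler1n.
have T0 : 0 <= T by rewrite /T; lra.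
have h : (1 + 1) + (1 + 1^-1) * 1 ^+ 2 * asum a <= 1 ^+ 2 * T.
  by rewrite invr1 expr1n mul1r mulr1 /T; lra.
have := volume_le_count a0 ltr01 ltr01 T0 TM h.
rewrite ge0_fin_numE ?measure_ge0// => hle; apply: (le_lt_trans hle).
exact: ltry.
Qed.

(** Cubes of side [1 / ((1 + eta) sqrt N)] and [1 / ((1 - eta) sqrt N)], with [sg = eta / 2]: the
    gap between [1 + eta / 2] and [1 + eta], or its counterpart with minus signs, pays for the
    rounding error, which the lower bound on [N] makes small. *)
Lemma normalized_sandwich n (a : 'I_n -> nat) (v eta : R) (N M : nat) : (forall j, (0 < a j)%N) ->
  lebesgue_tuple n (ell (R := R) a) = v%:E -> (0 < N)%N -> (N <= M)%N -> 0 < eta <= 2^-1 ->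
  (1 + 2 / eta) * asum a * 2 / eta <= N%:R ->
  (cntQ a M ((1 + eta / 2) * N%:R))%:R <= v * (1 + eta) ^+ n * Num.sqrt N%:R ^+ n /\
  v * (1 - eta) ^+ n * Num.sqrt N%:R ^+ n <= (cntQ a M ((1 - eta / 2) * N%:R))%:R.
Proof.
move=> a0 hv N0 NM /andP[e0 e1] hN; set w := Num.sqrt _.
have Np : 0 < N%:R :> R by rewrite ltr0n.
have w0 : 0 < w by rewrite sqrtr_gt0.
have w2 : w ^+ 2 = N%:R by rewrite sqr_sqrtr ?ler0n.
have sg0 : 0 < eta / 2 by lra.
have iv : (eta / 2)^-1 = 2 / eta by field; rewrite gt_eqF.
have hN2 : (1 + 2 / eta) * asum a * 2 <= eta * N%:R.
  by move: hN; rewrite ler_pdivrMr// [N%:R * _]mulrC.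
have p1 : 0 < (1 + eta) * w by rewrite mulr_gt0//; lra.
have p2 : 0 < (1 - eta) * w by rewrite mulr_gt0//; lra.
have eN : 0 <= eta * N%:R by rewrite mulr_ge0// ltW.
have eeN : 0 <= eta * eta * N%:R by rewrite mulr_ge0// mulr_ge0// ltW.
have eeeN : eta * eta * eta * N%:R <= 4^-1 * (eta * N%:R).
  rewrite -[X in X <= _]mulrA ler_wpM2r//.
  have h : 0 <= (2^-1 - eta) * (2^-1 + eta) by rewrite mulr_ge0//; lra.
  by move: h; lra.
split.
  have h : (1 + eta / 2) * (((1 + eta) * w)^-1 ^+ 2 * ((1 + eta / 2) * N%:R)) +
      (1 + (eta / 2)^-1) * ((1 + eta) * w)^-1 ^+ 2 * asum a <= 1.
    rewrite (_ : _ + _ = ((1 + eta / 2) ^+ 2 * N%:R + (1 + (eta / 2)^-1) * asum a) / ((1 + eta) * w) ^+ 2); last first.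
      by rewrite exprVn; ring.
    rewrite ler_pdivrMr ?exprn_gt0// mul1r exprMn w2 iv.
    rewrite (_ : (1 + eta / 2) ^+ 2 * N%:R = N%:R + eta * N%:R + 4^-1 * (eta * eta * N%:R)); last by field.
    rewrite (_ : (1 + eta) ^+ 2 * N%:R = N%:R + 2 * (eta * N%:R) + eta * eta * N%:R); last by ring.
    by lra.
  have sp : 0 < ((1 + eta) * w)^-1 by rewrite invr_gt0.
  have := @count_le_volume R n a _ _ ((1 + eta / 2) * N%:R) M sp sg0 h.
  rewrite hv lee_fin exprVn ler_pdivrMl ?exprn_gt0// exprMn => hh; apply: (le_trans hh).
  by rewrite le_eqVlt; apply/orP; left; apply/eqP; ring.
have h : (1 + eta / 2) + (1 + (eta / 2)^-1) * ((1 - eta) * w)^-1 ^+ 2 * asum a <=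
    ((1 - eta) * w)^-1 ^+ 2 * ((1 - eta / 2) * N%:R).
  have q0 : 0 < ((1 - eta) * w) ^+ 2 by rewrite exprn_gt0.
  rewrite iv exprVn [leRHS]mulrC ler_pdivlMr// mulrDl -!mulrA [_^-1 * _]mulrCA mulVf ?gt_eqF// mulr1.
  rewrite exprMn w2.
  rewrite (_ : (1 + eta / 2) * ((1 - eta) ^+ 2 * N%:R) =
     N%:R - 3 / 2 * (eta * N%:R) + 2^-1 * (eta * eta * eta * N%:R)); last by field.
  by lra.
have sp : 0 < ((1 - eta) * w)^-1 by rewrite invr_gt0.
have T0 : 0 <= (1 - eta / 2) * N%:R by rewrite mulr_ge0//; lra.
have TM : (1 - eta / 2) * N%:R <= M%:R ^+ 2.
  apply: le_trans (_ : N%:R <= _); first by rewrite ler_piMl//; lra.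
  by rewrite -natrX ler_nat (leq_trans NM)// -mulnn leq_pmull// (leq_trans N0).
have := @volume_le_count R n a _ _ _ M a0 sp sg0 T0 TM h.
rewrite hv lee_fin exprVn ler_pdivlMl ?exprn_gt0// exprMn => hh; apply: le_trans hh.
by rewrite le_eqVlt; apply/orP; left; apply/eqP; ring.
Qed.

End final.

Theorem theorem1p3 (R : realType) (n : nat) (hn : (2 <= n)%N)
  (alpha : 'cV[R]_n) (kappa : R)
  (hkappa : (kappa%:E < kappa_bound n)%E)
  (halpha : diophantine_type kappa alpha)
  (hind : Q_independent (col_mx alpha (const_mx 1 : 'cV[R]_1)))
  (a : 'I_n -> nat) (ha : forall i, (0 < a i)%N) :
  ((N%:R `^ (n%:R / 2))^-1 * Rsum (diagZ a) alpha N)%:E @[N --> \oo]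
    --> volume (ellipsoid (diagZ a)).
Proof.
have [tau tau0 [kt ht]] := kappa_exponent hn hkappa.
have [c0 c00 hb] := diophantine_badly (ltnW hn) halpha kt.
have hal := independent_no_relation hind.
have [C C0 hC] := sandwich hn ha c00 tau0 ht hb hal.
have fin := volume_fin (R := R) ha.
rewrite volume_ellipsoid; set v := fine (lebesgue_tuple n (ell (R := R) a)).
have hv : lebesgue_tuple n (ell (R := R) a) = v%:E by rewrite /v fineK.
have v0 : 0 <= v by rewrite fine_ge0.
rewrite hv; apply: cvg_EFin; first by near=> N.
rewrite (_ : fine \o _ = fun N : nat => (Num.sqrt N%:R ^+ n)^-1 * Rsum (diagZ a) alpha N); last first.
  apply/funext => N /=; congr (_^-1 * _).
  by rewrite [n%:R / 2]mulrC powRrM powR12_sqrt// powR_mulrn// sqrtr_ge0.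
apply: (@sandwich_limit R n v (C + 1)) => // [|N|eta he].
- by rewrite addr_ge0// ltW.
- by rewrite mulr_ge0 ?invr_ge0 ?exprn_ge0 ?sqrtr_ge0// sumr_ge0// => p _; exact: exprn_ge0 (nc_ge0 _).
have /andP[e0 e1] := he.
have hd : 0 < eta / 2 < 1 by lra.
have he1 : 0 < eta <= 1 by lra.
have [N0 hN0] := hC _ _ hd he1.
have [N1 hN1] := natr_unbounded ((1 + 2 / eta) * asum a * 2 / eta).
(* Ensures [eta * W >= 1], by [W >= N] for [n >= 2]. This absorbs the 1 that the term [p = 0] leaves
   in [sandwich], whence [C + 1] above. *)
have [N2 hN2] := natr_unbounded eta^-1.
exists (maxn N0 (maxn N1 N2)) => N; rewrite !gtn_max => /and3P[l0 l1 l2].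
have N_gt0 : (0 < N)%N by exact: leq_ltn_trans l0.
have [M [NM [A1 A2]]] := hN0 _ l0.
have hN1' : (1 + 2 / eta) * asum a * 2 / eta <= N%:R.
  by apply: (le_trans (ltW hN1)); rewrite ler_nat.
have [B1 B2] := normalized_sandwich ha hv N_gt0 NM he hN1'.
have ES : Rsum (diagZ a) alpha N = \sum_(1 <= p < N.+1) nc (rB (fun j => alpha j 0) a M p) ^+ 2.
  rewrite /Rsum; apply: eq_big_nat => p /andP[_ pN].
  by rewrite (rcoef_rB _ (M := M))//; apply: leq_trans NM.
rewrite -ES in A1 A2; set S := Rsum _ _ _ in A1 A2 *.
set W := _ ^+ n in A1 A2 B1 B2 *.
have Ne : eta^-1 <= N%:R by apply: (le_trans (ltW hN2)); rewrite ler_nat.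
have Np : 1 <= N%:R :> R by rewrite ler1n.
have s1 : 1 <= Num.sqrt N%:R :> R by rewrite -[leLHS]sqrtr1 ler_wsqrtr.
have WN : N%:R <= W.
  rewrite -[leLHS](@sqr_sqrtr _ N%:R)//; exact: ler_weXn2l.
have W0 : 0 < W by apply: lt_le_trans WN; lra.
have eW : 1 <= eta * W.
  by rewrite -ler_pdivrMl// mulr1 (le_trans Ne).
have e1' : 0 <= 1 - eta by lra.
split.
  rewrite mulrCA ler_pdivrMl//; apply: (le_trans A1); apply: (le_trans (lerD B1 (lexx _))).
  have : 0 <= eta * W by rewrite mulr_ge0// ltW.
  by lra.
have := ler_wpM2l e1' B2 => B3; have {A2}B3 := le_trans B3 A2.
rewrite -(ler_pM2l W0) mulrDr mulVKf ?gt_eqF//.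
by lra.
Unshelve. all: by end_near.
Qed.
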